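(* For $n\ge1$ let $S=S_{parab}=\{(\tau,\omega)\in\mathbb{R}\times\mathbb{R}^n:\tau=|\omega|^2\}$ be the paraboloid endowed with the measure $d\sigma$ given by $\int_S g(\tau,\omega)\,d\sigma=\int_{\mathbb{R}^n}g(|\omega|^2,\omega)\,d\omega$. For $n=1$ and all $g\in L^2(S;d\sigma)$, $$\|\widehat{g\,d\sigma}\|_{L^6(\mathbb{R}^2)}\le(2\pi)^{-1/2}\,12^{-1/12}\,\|g\|_{L^2(S;\,d\sigma)},\qquad(1)$$ and for $n=2$ and all $g\in L^2(S;d\sigma)$, $$\|\widehat{g\,d\sigma}\|_{L^4(\mathbb{R}^3)}\le(4\pi)^{-1/2}\,\|g\|_{L^2(S;\,d\sigma)}.\qquad(2)$$ These inequalities are sharp (the constants are the best possible). For $g$ not identically zero, equality occurs in (1) (with $n=1$), respectively in (2) (with $n=2$), if and only if $$g(|\omega|^2,\omega)=e^{A|\omega|^2+b\cdot\omega+C}$$ for almost every $\omega\in\mathbb{R}^n$, where $A,C\in\mathbb{C}$, $b\in\mathbb{C}^n$ and $\Re(A)<0$.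
   Context: $\widehat{g\,d\sigma}$ denotes the Fourier transform of the measure $g\,d\sigma$ on $\mathbb{R}^{n+1}$: $$\widehat{g\,d\sigma}(t,x)=\frac{1}{(2\pi)^{(n+1)/2}}\int_S g(\tau,\omega)\,e^{-i(t\tau+\omega\cdot x)}\,d\sigma,\qquad(t,x)\in\mathbb{R}\times\mathbb{R}^n.$$ For general $g\in L^2(S;d\sigma)$ this is understood as the Fourier transform of a tempered distribution, equivalently by density from nice functions $g$. Here $b\cdot\omega=\sum_j b_j\omega_j$. *)

(* Defs.v *)
(* MathComp-Analysis over an abstract realType R. The library has no Lebesgue
   measure on R^n and no integration of complex-valued functions: both are set
   up here, the latter componentwise on R[i]. *)
From HB Require Import structures.
From mathcomp Require Import all_boot all_order all_algebra.
From mathcomp Require Import all_classical all_reals all_analysis.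
From mathcomp Require Import measurable_realfun.
From mathcomp.real_closed Require Import complex.
Set Implicit Arguments.
Unset Strict Implicit.
Unset Printing Implicit Defensive.
Import Order.TTheory GRing.Theory Num.Theory.
Import numFieldNormedType.Exports.

Local Open Scope classical_set_scope.
Local Open Scope ring_scope.
Local Open Scope complex_scope.

(* [measurableTypeR R] is R with its Borel sigma-algebra; tuples carry the
   product sigma-algebra. *)
Notation Rn R n := (n.-tuple (measurableTypeR R)).
Notation spacetime R n := (measurableTypeR R * Rn R n)%type.

Section lebesgue_step.
Context {R : realType} (n : nat).
Variable m : {sigma_finite_measure set (Rn R n) -> \bar R}.

Definition lebesgue_prod : set (spacetime R n) -> \bar R :=
  (@lebesgue_measure R \x m)%E.

HB.instance Definition _ := Measure.on lebesgue_prod.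

Let lebesgue_prod_sigma_finite : sigma_finite setT lebesgue_prod.
Proof.
have /sigma_finiteP[F [TF ndF Foo]] := sigma_finiteT (@lebesgue_measure R).
have /sigma_finiteP[G [TG ndG Goo]] := sigma_finiteT m.
exists (fun k => F k `*` G k).
  rewrite -setXTT TF TG predeqE => -[x y]; split.
    move=> [/= [i _ Fix] [j _ Gjy]]; exists (maxn i j) => //; split.
    - by move: x Fix; exact/subsetPset/ndF/leq_maxl.
    - by move: y Gjy; exact/subsetPset/ndG/leq_maxr.
  by move=> [i _ []/= ? ?]; split; exists i.
move=> k; have [? ?] := Foo k; have [? ?] := Goo k.
split; first exact: measurableX.
by rewrite /lebesgue_prod product_measure1E// lte_mul_pinfty// ge0_fin_numE.
Qed.

HB.instance Definition _ := Measure_isSigmaFinite.Build _ _ _ lebesgue_prod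
  lebesgue_prod_sigma_finite.

Definition consT (p : spacetime R n) : Rn R n.+1 := [tuple of p.1 :: p.2].

Let measurable_consT : measurable_fun setT consT.
Proof. exact: measurable_cons. Qed.

HB.instance Definition _ :=
  isMeasurableFun.Build _ _ _ _ consT measurable_consT.

Definition lebesgue_step : set (Rn R n.+1) -> \bar R :=
  pushforward lebesgue_prod consT.

Let lebesgue_step0 : lebesgue_step set0 = 0%E.
Proof. exact: measure0. Qed.

Let lebesgue_step_ge0 A : (0 <= lebesgue_step A)%E.
Proof. exact: measure_ge0. Qed.

Let lebesgue_step_sigma_additive : semi_sigma_additive lebesgue_step.
Proof. exact: measure_semi_sigma_additive. Qed.

HB.instance Definition _ := isMeasure.Build _ _ _ lebesgue_step
  lebesgue_step0 lebesgue_step_ge0 lebesgue_step_sigma_additive.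

Let lebesgue_step_sigma_finite : sigma_finite setT lebesgue_step.
Proof.
pose un (w : Rn R n.+1) : spacetime R n := (thead w, [tuple of behead w]).
have mun : measurable_fun setT un.
  apply: measurable_fun_pair; first exact: measurable_tnth.
  exact: measurable_behead.
have consK : cancel consT un.
  by move=> [x w]; rewrite /un theadE; congr pair; exact/val_inj.
have [F FT Ffin] := sigma_finiteT lebesgue_prod.
exists (fun i => un @^-1` F i).
  by rewrite -preimage_bigcup -FT preimage_setT.
move=> i; have [mF Foo] := Ffin i; split.
  by rewrite -[X in measurable X]setTI; exact: mun.
rewrite /lebesgue_step /pushforward.
by rewrite [X in lebesgue_prod X](_ : _ = F i)//; apply/seteqP;
  split => p /=; rewrite consK.
Qed.

HB.instance Definition _ := Measure_isSigmaFinite.Build _ _ _ lebesgue_step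
  lebesgue_step_sigma_finite.

End lebesgue_step.

(* Lebesgue measure on R^n, as the n-fold product of [lebesgue_measure]. *)
Fixpoint lebesgueRn (R : realType) (n : nat) :
    {sigma_finite_measure set (Rn R n) -> \bar R} :=
  match n with
  | 0%N => dirac ([tuple] : Rn R 0)
  | n'.+1 => lebesgue_step (lebesgueRn R n')
  end.

Definition lebesgueST (R : realType) (n : nat) :
    {sigma_finite_measure set (spacetime R n) -> \bar R} :=
  lebesgue_prod (lebesgueRn R n).

Definition dotp (R : realType) (n : nat) (v w : Rn R n) : R :=
  \sum_(j < n) (tnth v j : R) * (tnth w j : R).

Definition cdotp (R : realType) (n : nat) (b : n.-tuple R[i]) (w : Rn R n) :
    R[i] :=
  \sum_(j < n) tnth b j * (tnth w j : R)%:C.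

Definition cexp (R : realType) (z : R[i]) : R[i] :=
  (expR (complex.Re z))%:C * (cos (complex.Im z) +i* sin (complex.Im z)).

Section complex_functions.
Context d (T : measurableType d) (R : realType).
Variables (mu : {measure set T -> \bar R}) (D : set T).

Definition cmeasurable (f : T -> R[i]) :=
  measurable_fun D (fun x => complex.Re (f x)) /\
  measurable_fun D (fun x => complex.Im (f x)).

Definition cintegral (f : T -> R[i]) : R[i] :=
  (\int[mu]_(x in D) complex.Re (f x)) +i*
  (\int[mu]_(x in D) complex.Im (f x)).

(* The L^p(D) norm. [normc] is the modulus with values in R (the norm `|z| lives
   in R[i]); [\_ D] extends by 0 outside D. *)
Definition cLnorm (p : R) (f : T -> R[i]) : \bar R :=
  'N[mu]_(p%:E)[(fun x => (ComplexField.Normc.normc (f x))%:E) \_ D]%E.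

Definition memL (p : R) (f : T -> R[i]) :=
  cmeasurable f /\ (cLnorm p f < +oo)%E.

End complex_functions.

Section paraboloid.
Context (R : realType) (n : nat).

Definition paraboloid : set (spacetime R n) :=
  [set p | p.1 = dotp p.2 p.2].

Definition lift_parab (w : Rn R n) : spacetime R n := (dotp w w, w).

Let measurable_lift_parab : measurable_fun setT lift_parab.
Proof.
apply: measurable_fun_pair => //.
apply: measurable_sum => j; apply: measurable_funM;
  exact: measurable_tnth.
Qed.

HB.instance Definition _ :=
  isMeasurableFun.Build _ _ _ _ lift_parab measurable_lift_parab.

Definition dsigma_def : set (spacetime R n) -> \bar R :=
  pushforward (lebesgueRn R n) lift_parab.

Let dsigma0 : dsigma_def set0 = 0%E.
Proof. exact: measure0. Qed.

Let dsigma_ge0 A : (0 <= dsigma_def A)%E.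
Proof. exact: measure_ge0. Qed.

Let dsigma_sigma_additive : semi_sigma_additive dsigma_def.
Proof. exact: measure_semi_sigma_additive. Qed.

HB.instance Definition _ := isMeasure.Build _ _ _ dsigma_def
  dsigma0 dsigma_ge0 dsigma_sigma_additive.

(* The image of Lebesgue measure on R^n under w |-> (|w|^2, w), so that
   \int g dsigma = \int g(|w|^2, w) dw; it is carried by [paraboloid]. *)
Definition dsigma : {measure set (spacetime R n) -> \bar R} := dsigma_def.

(* Pointwise Fourier integral of g dsigma; meaningful for g in L^1(S). *)
Definition fourier_dsigma (g : spacetime R n -> R[i]) (tx : spacetime R n) :
    R[i] :=
  ((2 * pi) `^ (- (n.+1%:R / 2)))%:C *
  cintegral dsigma paraboloid
    (fun p => g p * cexp (0 -i* ((tx.1 : R) * (p.1 : R) + dotp p.2 tx.2))).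

(* F is the Fourier transform of g dsigma for g in L^2(S), in the sense of
   extension by density: L^2(S)-approximation of g by elements h k of
   (L^1 /\ L^2)(S), with convergence of the transforms in L^q(R^(n+1)).
   For g itself in L^1 /\ L^2, [fourier_dsigma g] qualifies (constant sequence).
   Since F is determined only up to a null set, this is a relation. *)
Definition is_fourier_dsigma (q : R) (g F : spacetime R n -> R[i]) :=
  cmeasurable setT F /\
  exists h : nat -> spacetime R n -> R[i],
    [/\ forall k, memL dsigma paraboloid 1 (h k) /\
                  memL dsigma paraboloid 2 (h k),
        (fun k => cLnorm dsigma paraboloid 2 (fun p => h k p - g p))
          @ \oo --> 0%E
      & (fun k => cLnorm (lebesgueST R n) setT q
                    (fun z => fourier_dsigma (h k) z - F z))
          @ \oo --> 0%E].

End paraboloid.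

Arguments paraboloid : clear implicits.
Arguments dsigma : clear implicits.

(* Main.v *)
Require Import Defs.
From HB Require Import structures.
From mathcomp Require Import all_boot all_order all_algebra.
From mathcomp Require Import all_classical all_reals all_analysis.
From mathcomp Require Import measurable_realfun.
From mathcomp.real_closed Require Import complex.
From mathcomp Require Import ring lra.
Import Order.TTheory GRing.Theory Num.Theory.
Import numFieldNormedType.Exports.

Set Implicit Arguments.
Unset Strict Implicit.
Unset Printing Implicit Defensive.

Local Open Scope classical_set_scope.
Local Open Scope ring_scope.
Local Open Scope complex_scope.


(** Let [f] be a density on the paraboloid over [R^n], and let [E f] be the
    transform of [f dsigma] without its normalising factor. The exponents are
    even: [6 = 2 m] with [m = 3] copies of the line, and [4 = 2 m] with [m = 2]
    copies of the plane. The power [(E f)^m] is an integral of the tensor power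
    of [f] over [m] copies of frequency space, with phase
    [t sum |w_j|^2 + x . sum w_j]. In orthogonal coordinates [(s, d)], where [s]
    is the component along the diagonal, this phase is
    [t (|s|^2 + |d|^2) + sqrt m x . s] (lemmas [ext1_cube] and [ext2_square]).
    In both cases [n (m - 1) = 2], so that [d] ranges over a plane, where area is
    a product measure in the squared radius [r = |d|^2] and the direction
    ([mpres_polar]). Hence [(E f)^m] is, up to the factor [chi (t |s|^2)] of
    modulus 1, the Fourier transform in [(s, r)] of the integrals of the tensor
    power over the circles with given [s] and [r], and Plancherel's theorem turns
    the [2 m]-th power of the [L^(2 m)] norm of [E f] into a constant times the
    squared [L^2] norm of these circular integrals: an identity
    ([energy_extension]).

    On each circle, the squared modulus of the mean is at most the mean of the
    squared modulus, and the difference is the variance ([arc_variance]). This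
    gives the inequality with the stated constants, with equality if and only if
    the tensor power is a function of [s] and [r] alone. Tensor powers of
    Gaussians [exp (A |w|^2 + b . w + C)] have this property, since the exponents
    add up to [A (|s|^2 + r) + sqrt m b . s + m C]; so the constants are optimal.

    Conversely, suppose that the tensor power of [f] is radial in [d]. This
    remains true for [g w = exp (- |w|^2) * f w], which is integrable together
    with [w g]. The reflection of the [d]-plane in a line preserves radial
    functions and characters along that line, and changes the sign of linear
    forms across it; so the integral of a product of the three vanishes
    ([radial_orthogonal]). In the original coordinates this is a relation between
    the transform [psi] of [g] and its gradient at [m] arbitrary points
    ([functional_equation1] and [functional_equation2]). Fixing all points but
    one shows that the gradient of [psi] is [psi] times an affine function whose
    linear part is scalar; so [psi] is a Gaussian, and then so are [g] and [f],
    as the transform is injective.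

    The integral defining [E f] requires [f] to be integrable. For other
    square-integrable densities the transform is a limit in [L^(2 m)], and the
    identity above passes to the limit, its right-hand side being continuous in
    mean square ([spacetime_energy_cvg], [pint_is_fourier_dsigma]); such limits
    exist by the inequality and completeness ([exists_fourier_dsigma]).

    Plancherel's theorem on the line is obtained by regularising with a Gaussian
    weight, whose effect is measured exactly by the mean-square distance between
    [f] and its translates ([regularized_plancherel]). *)

(** * Complex-valued measurable and integrable functions *)

Notation cmeas := (cmeasurable setT).
Notation cint mu := (cintegral mu setT).

Section modulus.
Context {R : realType}.
Implicit Types (x y : R[i]) (a b : R).

Definition sqn x : R := complex.Re x ^+ 2 + complex.Im x ^+ 2.

Lemma ReD x y : complex.Re (x + y) = complex.Re x + complex.Re y.
Proof. by case: x; case: y. Qed.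

Lemma ImD x y : complex.Im (x + y) = complex.Im x + complex.Im y.
Proof. by case: x; case: y. Qed.

Lemma ReN x : complex.Re (- x) = - complex.Re x.
Proof. by case: x. Qed.

Lemma ImN x : complex.Im (- x) = - complex.Im x.
Proof. by case: x. Qed.

Lemma ReM x y : complex.Re (x * y) =
  complex.Re x * complex.Re y - complex.Im x * complex.Im y.
Proof. by case: x; case: y. Qed.

Lemma ImM x y : complex.Im (x * y) =
  complex.Re x * complex.Im y + complex.Im x * complex.Re y.
Proof. by case: x => a b; case: y => c e /=; rewrite addrC. Qed.

Definition ReImE := (ReD, ImD, ReN, ImN, ReM, ImM).

Lemma complex_ext x y :
  complex.Re x = complex.Re y -> complex.Im x = complex.Im y -> x = y.
Proof. by case: x => a b; case: y => c e /= -> ->. Qed.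

Lemma sqn_ge0 x : 0 <= sqn x.
Proof. by rewrite addr_ge0// sqr_ge0. Qed.

Lemma normcE x : ComplexField.Normc.normc x = Num.sqrt (sqn x).
Proof. by case: x. Qed.

Lemma normc_ge0 x : 0 <= ComplexField.Normc.normc x.
Proof. by rewrite normcE sqrtr_ge0. Qed.

Lemma normcX2 x : ComplexField.Normc.normc x ^+ 2 = sqn x.
Proof. by rewrite normcE sqr_sqrtr// sqn_ge0. Qed.

Lemma sqnM x y : sqn (x * y) = sqn x * sqn y.
Proof. by rewrite /sqn !ReImE; ring. Qed.

Lemma sqn0 : sqn 0 = 0. Proof. by rewrite /sqn /=; ring. Qed.

Lemma sqnN x : sqn (- x) = sqn x.
Proof. by rewrite /sqn !ReImE !sqrrN. Qed.

Lemma sqnR a : sqn a%:C = a ^+ 2.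
Proof. by rewrite /sqn /=; ring. Qed.

Lemma sqn_eq0 x : sqn x = 0 -> x = 0.
Proof.
move=> /eqP; rewrite paddr_eq0 ?sqr_ge0// !sqrf_eq0 => /andP[/eqP a /eqP b].
exact: complex_ext.
Qed.

Lemma normr_Re_le x : `|complex.Re x| <= ComplexField.Normc.normc x.
Proof. by rewrite normcE -sqrtr_sqr ler_sqrt ?sqn_ge0// lerDl sqr_ge0. Qed.

Lemma normr_Im_le x : `|complex.Im x| <= ComplexField.Normc.normc x.
Proof. by rewrite normcE -sqrtr_sqr ler_sqrt ?sqn_ge0// lerDr sqr_ge0. Qed.

Lemma normc_leReIm x : ComplexField.Normc.normc x <=
  `|complex.Re x| + `|complex.Im x|.
Proof.
rewrite normcE -[leRHS]ger0_norm ?addr_ge0// -sqrtr_sqr ler_sqrt ?sqr_ge0//.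
rewrite /sqn -(real_normK (num_real (complex.Re x))).
rewrite -(real_normK (num_real (complex.Im x))).
by rewrite sqrrD lerD2r lerDl mulrn_wge0// mulr_ge0.
Qed.

Lemma sqn_cexp x : sqn (cexp x) = expR (complex.Re x) ^+ 2.
Proof.
rewrite /cexp sqnM sqnR /sqn /= -[RHS]mulr1; congr (_ * _).
by rewrite cos2Dsin2.
Qed.

Lemma normc_cexp x :
  ComplexField.Normc.normc (cexp x) = expR (complex.Re x).
Proof. by rewrite normcE sqn_cexp sqrtr_sqr ger0_norm// expR_ge0. Qed.

Lemma cexpD x y : cexp (x + y) = cexp x * cexp y.
Proof.
rewrite /cexp !ReImE expRD cosD sinD.
by apply: complex_ext; rewrite !ReImE /=; ring.
Qed.

Lemma cexp0 : cexp (0 : R[i]) = 1.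
Proof. by rewrite /cexp /= expR0 cos0 sin0 mul1r. Qed.

Lemma cexp_neq0 x : cexp x != 0.
Proof.
apply/eqP => e0; have := sqn_cexp x; rewrite e0 sqn0 => /eqP.
by rewrite eq_sym expf_eq0/= gt_eqF// expR_gt0.
Qed.

End modulus.

Section measurability.
Context d (T : measurableType d) {R : realType}.
Implicit Types (f g : T -> R[i]) (h : T -> R).

Lemma cmeas_cst (c : R[i]) : cmeas (fun _ : T => c).
Proof. by split; exact: measurable_cst. Qed.

Lemma cmeas_real h : measurable_fun setT h -> cmeas (fun x => (h x)%:C).
Proof. by move=> mh; split => //=; exact: measurable_cst. Qed.

Lemma cmeas_im h : measurable_fun setT h -> cmeas (fun x => 0 +i* h x).
Proof. by move=> mh; split => //=; exact: measurable_cst. Qed.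

Lemma cmeasD f g : cmeas f -> cmeas g -> cmeas (fun x => f x + g x).
Proof.
move=> [f1 f2] [g1 g2]; split.
  by under eq_fun do rewrite ReD; exact: measurable_funD.
by under eq_fun do rewrite ImD; exact: measurable_funD.
Qed.

Lemma cmeasN f : cmeas f -> cmeas (fun x => - f x).
Proof.
move=> [f1 f2]; split.
  by under eq_fun do rewrite ReN; exact: measurableT_comp.
by under eq_fun do rewrite ImN; exact: measurableT_comp.
Qed.

Lemma cmeasB f g : cmeas f -> cmeas g -> cmeas (fun x => f x - g x).
Proof. by move=> mf mg; apply: cmeasD => //; exact: cmeasN. Qed.

Lemma cmeasM f g : cmeas f -> cmeas g -> cmeas (fun x => f x * g x).
Proof.
move=> [f1 f2] [g1 g2]; split.
  under eq_fun do rewrite ReM.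
  by apply: measurable_funB; exact: measurable_funM.
under eq_fun do rewrite ImM.
by apply: measurable_funD; exact: measurable_funM.
Qed.

Lemma cmeas_cexp f : cmeas f -> cmeas (fun x => cexp (f x)).
Proof.
move=> [f1 f2]; apply: cmeasM.
  by apply: cmeas_real; exact: measurableT_comp.
split => /=; apply: measurableT_comp => //; apply: continuous_measurable_fun.
  exact: continuous_cos.
exact: continuous_sin.
Qed.

Lemma cmeas_comp d' (T' : measurableType d') (phi : T' -> T) f :
  cmeas f -> measurable_fun setT phi -> cmeas (fun x => f (phi x)).
Proof.
move=> [f1 f2] mphi; split; first exact: (measurableT_comp f1 mphi).
exact: (measurableT_comp f2 mphi).
Qed.

Lemma measurable_sqn f : cmeas f -> measurable_fun setT (fun x => sqn (f x)).
Proof.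
by move=> [f1 f2]; apply: measurable_funD; exact: measurable_funX.
Qed.

Lemma measurable_sqn_EFin f :
  cmeas f -> measurable_fun setT (fun x => (sqn (f x))%:E).
Proof. by move=> mf; apply/measurable_EFinP; exact: measurable_sqn. Qed.

Lemma measurable_normc f :
  cmeas f -> measurable_fun setT (fun x => ComplexField.Normc.normc (f x)).
Proof.
move=> mf; under eq_fun do rewrite normcE.
apply: measurableT_comp (measurable_sqn mf).
by apply: continuous_measurable_fun; exact: sqrt_continuous.
Qed.

End measurability.

Section integrability.
Context d (T : measurableType d) {R : realType} (mu : {measure set T -> \bar R}).
Implicit Types (f g : T -> R[i]) (h : T -> R).

Definition cintegrable f :=
  mu.-integrable setT (fun x => (complex.Re (f x))%:E) /\
  mu.-integrable setT (fun x => (complex.Im (f x))%:E).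

Lemma cintegrable_cmeas f : cintegrable f -> cmeas f.
Proof.
by move=> [/integrableP[/measurable_EFinP ? _]
  /integrableP[/measurable_EFinP ? _]].
Qed.

Lemma cintegrable_le f h : cmeas f -> mu.-integrable setT (EFin \o h) ->
  (forall x, ComplexField.Normc.normc (f x) <= h x) -> cintegrable f.
Proof.
move=> [f1 f2] ih fh; split; apply: (le_integrable _ _ _ ih) => //.
- exact/measurable_EFinP.
- move=> x _; rewrite !abse_EFin lee_fin (le_trans (normr_Re_le _))//.
  by rewrite (le_trans (fh _))// ler_norm.
- exact/measurable_EFinP.
- move=> x _; rewrite !abse_EFin lee_fin (le_trans (normr_Im_le _))//.
  by rewrite (le_trans (fh _))// ler_norm.
Qed.

Lemma integrable_normc f : cintegrable f ->
  mu.-integrable setT (fun x => (ComplexField.Normc.normc (f x))%:E).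
Proof.
move=> intf; have mf := cintegrable_cmeas intf; case: intf => f1 f2.
have ih := integrableD measurableT (integrable_abse f1) (integrable_abse f2).
apply: (le_integrable _ _ _ ih) => //.
  by apply/measurable_EFinP; exact: measurable_normc.
move=> x _; rewrite !abse_EFin /= lee_fin [leLHS]ger0_norm ?normc_ge0//.
by rewrite [leRHS]ger0_norm ?addr_ge0//; exact: normc_leReIm.
Qed.

Lemma cintegrable_dominated f g : cmeas f -> cintegrable g ->
  (forall x, ComplexField.Normc.normc (f x) <=
     ComplexField.Normc.normc (g x)) -> cintegrable f.
Proof. by move=> mf /integrable_normc; exact: cintegrable_le. Qed.

Lemma cintegrableD f g :
  cintegrable f -> cintegrable g -> cintegrable (fun x => f x + g x).
Proof.
move=> [f1 f2] [g1 g2]; split.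
  under eq_fun do rewrite ReD EFinD; exact: integrableD.
under eq_fun do rewrite ImD EFinD; exact: integrableD.
Qed.

Lemma cintegrableZ (c : R[i]) f :
  cintegrable f -> cintegrable (fun x => c * f x).
Proof.
move=> [f1 f2]; split.
  under eq_fun do rewrite ReM EFinB !EFinM.
  by apply: integrableB => //; exact: integrableZl.
under eq_fun do rewrite ImM EFinD !EFinM.
by apply: integrableD => //; exact: integrableZl.
Qed.

Lemma cintegrableB f g :
  cintegrable f -> cintegrable g -> cintegrable (fun x => f x - g x).
Proof.
move=> intf intg; under eq_fun do rewrite -mulN1r.
by apply: cintegrableD => //; exact: cintegrableZ.
Qed.

Lemma cintD f g : cintegrable f -> cintegrable g ->
  cint mu (fun x => f x + g x) = cint mu f + cint mu g.
Proof.
move=> [f1 f2] [g1 g2]; apply: complex_ext; rewrite ReImE /=.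
  by under eq_Rintegral do rewrite ReD; exact: RintegralD.
by under eq_Rintegral do rewrite ImD; exact: RintegralD.
Qed.

Lemma cintZ (c : R[i]) f : cintegrable f ->
  cint mu (fun x => c * f x) = c * cint mu f.
Proof.
move=> [f1 f2]; apply: complex_ext; rewrite ReImE /=.
  under eq_Rintegral do rewrite ReM.
  by rewrite RintegralB ?RintegralZl// /comp; under eq_fun do rewrite EFinM;
    exact: integrableZl.
under eq_Rintegral do rewrite ImM.
by rewrite RintegralD ?RintegralZl// /comp; under eq_fun do rewrite EFinM;
  exact: integrableZl.
Qed.

Lemma cintB f g : cintegrable f -> cintegrable g ->
  cint mu (fun x => f x - g x) = cint mu f - cint mu g.
Proof.
move=> intf intg; rewrite -[- cint mu g]mulN1r -cintZ// -cintD//.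
  by congr (cint mu _); apply/funext => x; rewrite mulN1r.
exact: cintegrableZ.
Qed.

Lemma cint_real h : cint mu (fun x => (h x)%:C) = (\int[mu]_x h x)%:C.
Proof. by apply: complex_ext => //=; rewrite /Rintegral integral0. Qed.

Lemma ae_eq_cint f g : cmeas f -> cmeas g -> {ae mu, forall x, f x = g x} ->
  cint mu f = cint mu g.
Proof.
move=> [f1 f2] [g1 g2] fg; apply: complex_ext; rewrite /= /Rintegral.
  congr fine; apply: ae_eq_integral => //; [exact/measurable_EFinP..|].
  by apply: filterS fg => x /= ->.
congr fine; apply: ae_eq_integral => //; [exact/measurable_EFinP..|].
by apply: filterS fg => x /= ->.
Qed.

(** Squared [L^2] norm, as an extended real. *)
Definition energy f : \bar R := (\int[mu]_x (sqn (f x))%:E)%E.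

Lemma energy_ge0 f : (0 <= energy f)%E.
Proof. by apply: integral_ge0 => x _; rewrite lee_fin sqn_ge0. Qed.

Lemma energy_integrable f : cmeas f -> (energy f < +oo)%E ->
  mu.-integrable setT (fun x => (sqn (f x))%:E).
Proof.
move=> mf Ef; apply/integrableP; split; first exact: measurable_sqn_EFin.
by under eq_integral do rewrite gee0_abs ?lee_fin ?sqn_ge0//.
Qed.

Lemma cintegrable_mulL2 f g : cmeas f -> cmeas g ->
  (energy f < +oo)%E -> (energy g < +oo)%E ->
  cintegrable (fun x => f x * g x).
Proof.
move=> mf mg Ef Eg; have If := energy_integrable mf Ef.
have Ig := energy_integrable mg Eg.
apply: (@cintegrable_le _ (fun x => sqn (f x) + sqn (g x))).
- exact: cmeasM.
- exact: (integrableD measurableT If Ig).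
- move=> x; rewrite ComplexField.Normc.normcM -!normcX2.
  have := normc_ge0 (f x); have := normc_ge0 (g x).
  set a := ComplexField.Normc.normc (f x); set b := ComplexField.Normc.normc _.
  move=> b0 a0; have := sqr_ge0 (a - b).
  nra.
Qed.

Lemma ae_eq_energy f g : cmeas f -> cmeas g ->
  {ae mu, forall x, f x = g x} -> energy f = energy g.
Proof.
move=> mf mg fg; apply: ae_eq_integral => //; [exact: measurable_sqn_EFin..|].
by apply: filterS fg => x /= ->.
Qed.

Lemma energy0_ae f : cmeas f -> energy f = 0%E -> {ae mu, forall x, f x = 0}.
Proof.
move=> mf Ef.
have [+ _] := ae_eq_integral_abs mu measurableT (measurable_sqn_EFin mf).
have -> : (\int[mu]_x `|(sqn (f x))%:E|)%E = energy f.
  by apply: eq_integral => x _; rewrite gee0_abs ?lee_fin ?sqn_ge0.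
by move=> /(_ Ef); apply: filterS => x /= /(_ I) [/sqn_eq0].
Qed.

Lemma energy0 f : {ae mu, forall x, f x = 0} -> cmeas f -> energy f = 0%E.
Proof.
move=> f0 mf; rewrite (ae_eq_energy mf (cmeas_cst T (0 : R[i])) f0) /energy.
by under eq_integral do rewrite sqn0; rewrite integral0.
Qed.

Lemma energyZ (c : R[i]) f : cmeas f ->
  energy (fun x => c * f x) = ((sqn c)%:E * energy f)%E.
Proof.
move=> mf; rewrite /energy; under eq_integral do rewrite sqnM EFinM.
rewrite ge0_integralZl//; first exact: measurable_sqn_EFin.
- by move=> x _; rewrite lee_fin sqn_ge0.
- by rewrite lee_fin sqn_ge0.
Qed.

End integrability.

(** * Products of sigma-finite measures *)

Section product_measure.
Context {R : realType} d1 d2 (X : measurableType d1) (Y : measurableType d2).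
Variables (mu : {sigma_finite_measure set X -> \bar R}).
Variables (nu : {sigma_finite_measure set Y -> \bar R}).

(** The product measure, packaged with its sigma-finiteness so that products
    can be iterated. *)
Definition prodm : set (X * Y) -> \bar R := (mu \x nu)%E.

HB.instance Definition _ := Measure.on prodm.

Let prodm_sigma_finite : sigma_finite setT prodm.
Proof.
have /sigma_finiteP[F [TF ndF Foo]] := sigma_finiteT mu.
have /sigma_finiteP[G [TG ndG Goo]] := sigma_finiteT nu.
exists (fun k => F k `*` G k).
  rewrite -setXTT TF TG predeqE => -[x y]; split.
    move=> [/= [i _ Fix] [j _ Gjy]]; exists (maxn i j) => //; split.
    - by move: x Fix; exact/subsetPset/ndF/leq_maxl.
    - by move: y Gjy; exact/subsetPset/ndG/leq_maxr.
  by move=> [i _ []/= ? ?]; split; exists i.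
move=> k; have [? ?] := Foo k; have [? ?] := Goo k.
split; first exact: measurableX.
by rewrite /prodm product_measure1E// lte_mul_pinfty// ge0_fin_numE.
Qed.

HB.instance Definition _ := Measure_isSigmaFinite.Build _ _ _ prodm
  prodm_sigma_finite.

Section tonelli.
Variables (F : X * Y -> \bar R) (mF : measurable_fun setT F).
Hypothesis F0 : forall z, (0 <= F z)%E.

Lemma tonelli1 : (\int[prodm]_z F z = \int[mu]_x \int[nu]_y F (x, y))%E.
Proof. exact: fubini_tonelli1. Qed.

Lemma tonelli2 : (\int[prodm]_z F z = \int[nu]_y \int[mu]_x F (x, y))%E.
Proof. exact: fubini_tonelli2. Qed.

Lemma measurable_tonelli1 : measurable_fun setT (fun x => (\int[nu]_y F (x, y))%E).
Proof. exact: measurable_fun_fubini_tonelli_F. Qed.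

Lemma measurable_tonelli2 : measurable_fun setT (fun y => (\int[mu]_x F (x, y))%E).
Proof. exact: measurable_fun_fubini_tonelli_G. Qed.

End tonelli.

End product_measure.

Notation "mu \X nu" := (prodm mu nu) (at level 40, left associativity).

(** * Measure-preserving maps *)

Section measure_preserving.
Context {R : realType}.

(** Stated on integrals of nonnegative functions rather than on measurable
    sets: in this form Tonelli's theorem composes such maps directly. *)
Definition mpres d1 d2 (X : measurableType d1) (Y : measurableType d2)
    (mu : {measure set X -> \bar R}) (nu : {measure set Y -> \bar R})
    (phi : X -> Y) :=
  measurable_fun setT phi /\
  forall F : Y -> \bar R, measurable_fun setT F -> (forall y, 0 <= F y)%E ->
    (\int[mu]_x F (phi x) = \int[nu]_y F y)%E.

Section one_map.
Context d1 d2 (X : measurableType d1) (Y : measurableType d2).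
Variables (mu : {measure set X -> \bar R}) (nu : {measure set Y -> \bar R}).
Variables (phi : X -> Y) (phiP : mpres mu nu phi).

Lemma mpres_integral (f : Y -> \bar R) : measurable_fun setT f ->
  (\int[mu]_x f (phi x) = \int[nu]_y f y)%E.
Proof.
move=> mf; rewrite integralE [RHS]integralE.
rewrite -(phiP.2 _ (measurable_funepos mf)); last by move=> y; exact: funepos_ge0.
rewrite -(phiP.2 _ (measurable_funeneg mf)); last by move=> y; exact: funeneg_ge0.
by congr (_ - _)%E; apply: eq_integral => x _; rewrite ?funeposE ?funenegE.
Qed.

Lemma mpres_cint (f : Y -> R[i]) : cmeas f ->
  cint mu (fun x => f (phi x)) = cint nu f.
Proof.
move=> [f1 f2]; apply: complex_ext; rewrite /= /Rintegral.
  by rewrite -mpres_integral//; exact/measurable_EFinP.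
by rewrite -mpres_integral//; exact/measurable_EFinP.
Qed.

Lemma mpres_energy (f : Y -> R[i]) : cmeas f ->
  energy mu (fun x => f (phi x)) = energy nu f.
Proof.
by move=> mf; rewrite [RHS]/energy -mpres_integral//; exact: measurable_sqn_EFin.
Qed.

Lemma mpres_cintegrable (f : Y -> R[i]) : cmeas f ->
  cintegrable mu (fun x => f (phi x)) <-> cintegrable nu f.
Proof.
move=> [/measurable_EFinP f1 /measurable_EFinP f2].
have key (h : Y -> \bar R) : measurable_fun setT h ->
    mu.-integrable setT (fun x => h (phi x)) <-> nu.-integrable setT h.
  move=> mh; have mah : measurable_fun setT (abse \o h) by exact: measurableT_comp.
  have E := mpres_integral mah; split => /integrableP[_ h1]; apply/integrableP.
    by split => //; rewrite -[X in (X < _)%E]E.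
  by split; [exact: (measurableT_comp mh phiP.1)|rewrite [X in (X < _)%E]E].
by split => -[i1 i2]; split; first [exact/(key _ f1)|exact/(key _ f2)].
Qed.

Lemma mpres_ae (P : set Y) : measurable P ->
  {ae mu, forall x, P (phi x)} <-> {ae nu, forall y, P y}.
Proof.
move=> mP; have mPC := measurableC mP.
have mphi : measurable (phi @^-1` (~` P)).
  by rewrite -[X in measurable X]setTI; exact: phiP.1.
have E : mu (phi @^-1` (~` P)) = nu (~` P).
  rewrite -[in RHS](setIT (~` P)) -integral_indic//.
  rewrite -[in LHS](setIT (_ @^-1` _)) -integral_indic//.
  have mI : measurable_fun setT (fun y => (\1_(~` P) y : R)%:E).
    exact/measurable_EFinP/measurable_indic.
  rewrite -(phiP.2 _ mI)//.
change (mu.-negligible (phi @^-1` (~` P)) <-> nu.-negligible (~` P)).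
split=> [/(negligibleP mu mphi) h|/(negligibleP nu mPC) h].
  by apply/(negligibleP nu mPC); rewrite -h.
by apply/(negligibleP mu mphi); rewrite -h.
Qed.

End one_map.

Lemma mpres_comp d1 d2 d3 (X : measurableType d1) (Y : measurableType d2)
    (Z : measurableType d3) (mu : {measure set X -> \bar R})
    (nu : {measure set Y -> \bar R}) (la : {measure set Z -> \bar R}) phi psi :
  mpres mu nu phi -> mpres nu la psi -> mpres mu la (fun x => psi (phi x)).
Proof.
move=> [mphi iphi] [mpsi ipsi]; split; first exact: (measurableT_comp mpsi mphi).
move=> F mF F0; rewrite (iphi (fun y => F (psi y)))// ?ipsi//.
exact: measurableT_comp.
Qed.

Lemma mpres_id d (X : measurableType d) (mu : {measure set X -> \bar R}) :
  mpres mu mu id.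
Proof. by split. Qed.

Section products.
Context d1 d2 (X : measurableType d1) (Y : measurableType d2).
Variables (mu : {sigma_finite_measure set X -> \bar R}).
Variables (nu : {sigma_finite_measure set Y -> \bar R}).

Lemma mpres_swap : mpres (mu \X nu) (nu \X mu) (fun z => (z.2, z.1)).
Proof.
split; first exact: measurable_fun_pair.
move=> F mF F0; rewrite tonelli1//=; last first.
  by apply: (measurableT_comp mF); exact: measurable_fun_pair.
by rewrite tonelli2.
Qed.

Lemma mpres_prod d3 d4 (X' : measurableType d3) (Y' : measurableType d4)
    (mu' : {sigma_finite_measure set X' -> \bar R})
    (nu' : {sigma_finite_measure set Y' -> \bar R}) phi psi :
  mpres mu mu' phi -> mpres nu nu' psi ->
  mpres (mu \X nu) (mu' \X nu') (fun z => (phi z.1, psi z.2)).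
Proof.
move=> [mphi iphi] [mpsi ipsi].
have m : measurable_fun setT (fun z : X * Y => (phi z.1, psi z.2)).
  by apply: measurable_fun_pair; exact: measurableT_comp.
split=> // F mF F0.
rewrite tonelli1//=; last exact: (measurableT_comp mF m).
rewrite tonelli1// -iphi.
- apply: eq_integral => x _ /=; rewrite (ipsi (fun y => F (phi x, y)))//.
  exact: (measurableT_comp mF (measurable_pair1 _)).
- exact: measurable_tonelli1.
- by move=> y; exact: integral_ge0.
Qed.

Lemma mpres_assoc d3 (Z : measurableType d3)
    (la : {sigma_finite_measure set Z -> \bar R}) :
  mpres ((mu \X nu) \X la) (mu \X (nu \X la))
    (fun z => (z.1.1, (z.1.2, z.2))).
Proof.
have m : measurable_fun setT (fun z : X * Y * Z => (z.1.1, (z.1.2, z.2))).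
  apply: measurable_fun_pair; first exact: measurableT_comp.
  by apply: measurable_fun_pair => //; exact: measurableT_comp.
split=> // F mF F0.
have mG := measurableT_comp mF m.
rewrite tonelli1//= tonelli1//=; last 2 first.
- exact: (measurable_tonelli1 la (F := fun w => F (w.1.1, (w.1.2, w.2)))).
- by move=> y; exact: integral_ge0.
rewrite tonelli1//; apply: eq_integral => x _.
rewrite [in RHS]tonelli1//.
exact: (measurableT_comp mF (measurable_pair1 _)).
Qed.

Lemma mpres_assocV d3 (Z : measurableType d3)
    (la : {sigma_finite_measure set Z -> \bar R}) :
  mpres (mu \X (nu \X la)) ((mu \X nu) \X la)
    (fun z => ((z.1, z.2.1), z.2.2)).
Proof.
have m : measurable_fun setT (fun z : X * (Y * Z) => ((z.1, z.2.1), z.2.2)).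
  apply: measurable_fun_pair; last exact: measurableT_comp.
  by apply: measurable_fun_pair => //; exact: measurableT_comp.
split=> // F mF F0.
rewrite -(mpres_assoc la).2//; last exact: (measurableT_comp mF m).
by apply: eq_integral => -[[x y] z].
Qed.

End products.

End measure_preserving.

(** * Fubini's theorem for complex-valued functions *)

Section complex_fubini.
Context {R : realType} d1 d2 (X : measurableType d1) (Y : measurableType d2).
Variables (mu : {sigma_finite_measure set X -> \bar R}).
Variables (nu : {sigma_finite_measure set Y -> \bar R}).

Lemma cmeas_pair1 (f : X * Y -> R[i]) x : cmeas f -> cmeas (fun y => f (x, y)).
Proof. by move=> mf; apply: (cmeas_comp mf); exact: measurable_pair1. Qed.

Lemma energy_fubini (f : X * Y -> R[i]) : cmeas f ->
  energy (mu \X nu) f = (\int[mu]_x energy nu (fun y => f (x, y)))%E.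
Proof.
move=> mf; rewrite /energy tonelli1//; first exact: measurable_sqn_EFin.
by move=> z; rewrite lee_fin sqn_ge0.
Qed.

Lemma measurable_energy (f : X * Y -> R[i]) : cmeas f ->
  measurable_fun setT (fun x => energy nu (fun y => f (x, y))).
Proof.
move=> mf; apply: (@measurable_tonelli1 _ _ _ _ _ nu
  (fun z => (sqn (f z))%:E)); first exact: measurable_sqn_EFin.
by move=> z; rewrite lee_fin sqn_ge0.
Qed.

Lemma ae_energy_fin (f : X * Y -> R[i]) : cmeas f ->
  (energy (mu \X nu) f < +oo)%E ->
  {ae mu, forall x, (energy nu (fun y => f (x, y)) < +oo)%E}.
Proof.
move=> mf; rewrite energy_fubini// => Ef.
have int : mu.-integrable setT (fun x => energy nu (fun y => f (x, y))).
  apply/integrableP; split; first exact: measurable_energy.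
  by under eq_integral do rewrite gee0_abs ?energy_ge0//.
have := integrable_ae measurableT int.
by apply: filterS => x /(_ I); rewrite ge0_fin_numE// energy_ge0.
Qed.

Lemma ae_cintegrable (f : X * Y -> R[i]) : cintegrable (mu \X nu) f ->
  {ae mu, forall x, cintegrable nu (fun y => f (x, y))}.
Proof.
by move=> [/ae_integrable1 f1 /ae_integrable1 f2]; apply: filterS2 f1 f2.
Qed.

(* the real case of Fubini's theorem, with a real-valued inner integral *)
Let fubiniR (h : X * Y -> R) : (mu \x nu)%E.-integrable setT (EFin \o h) ->
  mu.-integrable setT (fun x => (\int[nu]_y h (x, y))%:E) /\
  \int[mu]_x (\int[nu]_y h (x, y)) = \int[(mu \x nu)%E]_z h z.
Proof.
move=> ih; pose F x := (\int[nu]_y (h (x, y))%:E)%E.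
have iF : mu.-integrable setT F := integrable_fubini_F ih.
have mF : measurable_fun setT F := measurable_int _ iF.
have mF' : measurable_fun setT (fun x => (\int[nu]_y h (x, y))%:E).
  by apply/measurable_EFinP; exact: measurableT_comp.
have FF' : ae_eq mu setT F (fun x => (\int[nu]_y h (x, y))%:E).
  have := integrable_ae measurableT iF.
  by apply: filterS => x /(_ I) fx _; rewrite /Rintegral fineK.
split.
  apply/integrableP; split => //; have /integrableP[_] := iF.
  congr (_ < _)%E; apply: ae_eq_integral => //; [exact: measurableT_comp..|].
  by apply: filterS FF' => x /= H D; rewrite H.
rewrite /Rintegral -(integral12_prod_meas1 ih); congr fine.
by apply/esym; exact: ae_eq_integral.
Qed.

Lemma cmeas_cint (f : X * Y -> R[i]) : cmeas f ->
  cmeas (fun x => cint nu (fun y => f (x, y))).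
Proof.
have key (h : X * Y -> R) : measurable_fun setT h ->
    measurable_fun setT (fun x => \int[nu]_y h (x, y)).
  move=> mh; apply: measurableT_comp => //.
  have mEh : measurable_fun setT (EFin \o h) by exact/measurable_EFinP.
  rewrite (_ : (fun x => _) = (fun x => \int[nu]_y (EFin \o h)^\+ (x, y) -
      \int[nu]_y (EFin \o h)^\- (x, y))%E); last first.
    apply/funext => x; rewrite integralE; congr (_ - _)%E.
      by apply: eq_integral => y _; rewrite !funeposE.
    by apply: eq_integral => y _; rewrite !funenegE.
  apply: emeasurable_funB.
    exact: (measurable_tonelli1 nu (measurable_funepos mEh) (funepos_ge0 _)).
  exact: (measurable_tonelli1 nu (measurable_funeneg mEh) (funeneg_ge0 _)).
by move=> [/key f1 /key f2].
Qed.

Lemma cintegrable_fubini (f : X * Y -> R[i]) : cintegrable (mu \X nu) f ->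
  cintegrable mu (fun x => cint nu (fun y => f (x, y))).
Proof. by move=> [/fubiniR[? _] /fubiniR[? _]]. Qed.

Lemma cint_fubini (f : X * Y -> R[i]) : cintegrable (mu \X nu) f ->
  cint (mu \X nu) f = cint mu (fun x => cint nu (fun y => f (x, y))).
Proof.
by move=> [/fubiniR[_ f1] /fubiniR[_ f2]]; apply: complex_ext; rewrite /= ?f1 ?f2.
Qed.

Lemma cmeas_tensor (f : X -> R[i]) (g : Y -> R[i]) : cmeas f -> cmeas g ->
  cmeas (fun z : X * Y => f z.1 * g z.2).
Proof. by move=> mf mg; apply: cmeasM; apply: cmeas_comp. Qed.

Lemma cintegrable_tensor (f : X -> R[i]) (g : Y -> R[i]) :
  cintegrable mu f -> cintegrable nu g ->
  cintegrable (mu \X nu) (fun z => f z.1 * g z.2).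
Proof.
move=> intf intg; have mf := cintegrable_cmeas intf.
have mg := cintegrable_cmeas intg.
have mfg := cmeas_tensor mf mg.
apply: (@cintegrable_le _ _ _ _ _ (fun z => ComplexField.Normc.normc (f z.1 * g z.2))) => //.
apply/integrable12ltyP.
  by apply/measurable_EFinP; exact: measurable_normc.
have nf := integrable_normc intf; have ng := integrable_normc intg.
pose c := (\int[nu]_y (ComplexField.Normc.normc (g y))%:E)%E.
have c0 : (0 <= c)%E by apply: integral_ge0 => y _; rewrite lee_fin normc_ge0.
have cfin : c \is a fin_num.
  have /integrableP[_] := ng; rewrite ge0_fin_numE//.
  by under eq_integral do rewrite gee0_abs ?lee_fin ?normc_ge0//.
under eq_integral => x _.
  under eq_integral => y _.
    rewrite /= ger0_norm ?normc_ge0// ComplexField.Normc.normcM EFinM; over.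
  rewrite ge0_integralZl//; last 3 first.
  - exact: (measurable_int _ ng).
  - by move=> y _; rewrite lee_fin normc_ge0.
  - by rewrite lee_fin normc_ge0.
  rewrite -/c muleC; over.
rewrite ge0_integralZl//; last 2 first.
- exact: (measurable_int _ nf).
- by move=> y _; rewrite lee_fin normc_ge0.
rewrite lte_mul_pinfty//.
have /integrableP[_] := nf.
by under eq_integral do rewrite gee0_abs ?lee_fin ?normc_ge0//.
Qed.

Lemma cint_tensor (f : X -> R[i]) (g : Y -> R[i]) :
  cintegrable mu f -> cintegrable nu g ->
  cint (mu \X nu) (fun z => f z.1 * g z.2) = cint mu f * cint nu g.
Proof.
move=> intf intg; rewrite cint_fubini; last exact: cintegrable_tensor.
under [in LHS]eq_fun do rewrite /= cintZ// mulrC.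
by rewrite cintZ// mulrC.
Qed.

Lemma energy_tensor (f : X -> R[i]) (g : Y -> R[i]) : cmeas f -> cmeas g ->
  energy (mu \X nu) (fun z => f z.1 * g z.2) = (energy mu f * energy nu g)%E.
Proof.
move=> mf mg; rewrite energy_fubini; last exact: cmeas_tensor.
under eq_integral do rewrite /= energyZ// muleC.
rewrite ge0_integralZl// ?energy_ge0 1?muleC//.
- exact: measurable_sqn_EFin.
- by move=> x _; rewrite lee_fin sqn_ge0.
Qed.

End complex_fubini.

(** * Changes of variables for Lebesgue measure *)

Section image.
Context {R : realType} d1 d2 (X : measurableType d1) (Y : measurableType d2).
Variables (mu : {measure set X -> \bar R}) (phi : X -> Y).
Definition image_measure & measurable_fun setT phi : set Y -> \bar R :=
  pushforward mu phi.

Variable mphi : measurable_fun setT phi.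

Let image_measure0 : image_measure mphi set0 = 0%E.
Proof. by rewrite /image_measure /pushforward preimage_set0 measure0. Qed.

Let image_measure_ge0 A : (0 <= image_measure mphi A)%E.
Proof. exact: measure_ge0. Qed.

Let image_measure_additive : semi_sigma_additive (image_measure mphi).
Proof. exact: measure_semi_sigma_additive. Qed.

HB.instance Definition _ := isMeasure.Build _ _ _ (image_measure mphi)
  image_measure0 image_measure_ge0 image_measure_additive.

Lemma mpres_image : mpres mu (image_measure mphi) phi.
Proof.
by split=> // F mF F0; rewrite [RHS]ge0_integral_pushforward.
Qed.

End image.

Section lebesgue_line.
Context {R : realType}.

(** Lebesgue measure, under a name of its own so that simplification does
    not expose its sigma-finite structure. *)
Definition leb : set (measurableTypeR R) -> \bar R := @lebesgue_measure R.

HB.instance Definition _ := SigmaFiniteMeasure.copy leb (@lebesgue_measure R).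

Lemma measurable_affine (a b : R) :
  measurable_fun setT (fun x : measurableTypeR R => a * x + b : measurableTypeR R).
Proof.
apply: measurable_funD; last exact: measurable_cst.
by apply: measurable_funM => //; exact: measurable_cst.
Qed.

Let lebesgue_affine_pos (a b : R) (F : R -> \bar R) : 0 < a ->
  measurable_fun setT F -> (forall x, 0 <= F x)%E ->
  (a%:E * \int[leb]_x F (a * x + b)%R = \int[leb]_x F x)%E.
Proof.
move=> a0 mF F0.
pose phi (x : measurableTypeR R) : measurableTypeR R := a * x + b.
have mphi : measurable_fun setT phi := measurable_affine a b.
pose nu : {measure set (measurableTypeR R) -> \bar R} :=
  mscale (NngNum (ltW a0)) (image_measure leb mphi).
have E : forall A : set (measurableTypeR R), measurable A -> leb A = nu A.
  move=> A mA; apply: lebesgue_measure_unique => //= _ [[x y] _ <-] /=.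
  rewrite /nu /mscale /= /image_measure /pushforward.
  have -> : phi @^-1` `]x, y] = `](x - b) / a, (y - b) / a]%classic.
    apply/seteqP; split => z /=; rewrite !in_itv /= /phi.
      by rewrite ltr_pdivrMr// ler_pdivlMr// ltrBlDr lerBrDr mulrC.
    by rewrite ltr_pdivrMr// ler_pdivlMr// ltrBlDr lerBrDr mulrC.
  rewrite /leb !lebesgue_measure_itv /= !lte_fin.
  rewrite ltr_pM2r ?invr_gt0// ltrD2r; case: ifPn => _; last by rewrite mule0.
  by rewrite -!EFinB -EFinM; congr EFin; field; rewrite gt_eqF.
rewrite [RHS](eq_measure_integral nu); last by move=> A mA _; exact: E.
by rewrite ge0_integral_mscale//= -(mpres_image leb mphi).2.
Qed.

Lemma lebesgue_affine (a b : R) (F : R -> \bar R) : a != 0 ->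
  measurable_fun setT F -> (forall x, 0 <= F x)%E ->
  (`|a|%:E * \int[leb]_x F (a * x + b)%R = \int[leb]_x F x)%E.
Proof.
move=> a0 mF F0; case: (ltrgt0P a) a0 => // {}a0 _.
  exact: lebesgue_affine_pos.
have mN : measurable_fun setT (fun x : measurableTypeR R => - x : measurableTypeR R).
  exact: oppr_measurable.
have mFN : measurable_fun setT (fun x : measurableTypeR R => F (- x)).
  exact: (measurableT_comp mF mN).
have EN : (\int[leb]_x F (- x)%R = \int[leb]_x F x)%E.
  rewrite (mpres_image leb mN).2//; apply/esym/eq_measure_integral => A mA _.
  by rewrite /= [RHS]lebesgue_measureN.
rewrite -EN -(@lebesgue_affine_pos (- a) (- b) (fun x => F (- x)))// ?oppr_gt0//.
by congr (_ * _)%E; apply: eq_integral => x _; congr F; ring.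
Qed.

(** Two one-dimensional affine substitutions suffice: for the first row
    [(a, b)] with [a != 0], first replace [x] by [a x + b y] at fixed [y],
    then [y] by the second coordinate at fixed [a x + b y]. *)
Let mpres_linear2_pivot (a b c d : R) : a != 0 -> `|a * d - b * c| = 1 ->
  mpres (leb \X leb) (leb \X leb)
    (fun z => (a * z.1 + b * z.2, c * z.1 + d * z.2)).
Proof.
move=> a0 det1.
have m (u v : R) : measurable_fun setT
    (fun z : measurableTypeR R * measurableTypeR R => u * z.1 + v * z.2 : measurableTypeR R).
  by apply: measurable_funD; apply: measurable_funM => //; exact: measurable_cst.
have mL : measurable_fun setT (fun z : measurableTypeR R * measurableTypeR R =>
    (a * z.1 + b * z.2 : measurableTypeR R, c * z.1 + d * z.2 : measurableTypeR R)).
  by apply: measurable_fun_pair; exact: m.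
split=> // F mF F0.
have det0 : a * d - b * c != 0 by rewrite -normr_eq0 det1 oner_neq0.
pose e := (a * d - b * c) / a.
have e0 : e != 0 by rewrite mulf_neq0// invr_eq0.
have ca0 : `|a| != 0 by rewrite normr_eq0.
pose H x y := F (x, c / a * x + e * y).
have mH : measurable_fun setT (fun z : measurableTypeR R * measurableTypeR R => H z.1 z.2).
  apply: (measurableT_comp mF); apply: measurable_fun_pair => //; exact: m.
rewrite tonelli2//; last exact: (measurableT_comp mF mL).
transitivity (`|a|^-1%:E * \int[leb]_y \int[leb]_x H x y)%E.
  rewrite -ge0_integralZl//; last 2 first.
  - exact: (measurable_tonelli2 leb mH (fun=> F0 _)).
  - by move=> y _; apply: integral_ge0 => x _; exact: F0.
  apply: eq_integral => y _.
  rewrite -(@lebesgue_affine a (b * y) (H ^~ y))//; last 2 first.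
  - exact: (measurableT_comp mH (measurable_pair2 y)).
  - by move=> x; exact: F0.
  rewrite muleA -EFinM mulVf// mul1e; apply: eq_integral => x _.
  by rewrite /H /e /=; congr (F (_, _)); field.
rewrite -(tonelli2 leb leb mH (fun=> F0 _)) (tonelli1 leb leb mH (fun=> F0 _)).
rewrite tonelli1//.
transitivity (`|a|^-1%:E * (\int[leb]_x (`|e|^-1%:E * \int[leb]_y F (x, y))))%E.
  congr (_ * _)%E; apply: eq_integral => x _ /=.
  rewrite -(@lebesgue_affine e (c / a * x) (fun y => F (x, y)))//; last first.
    exact: (measurableT_comp mF (measurable_pair1 x)).
  rewrite muleA -EFinM mulVf ?normr_eq0// mul1e; apply: eq_integral => y _.
  by rewrite /H addrC.
rewrite ge0_integralZl//; last 2 first.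
- exact: measurable_tonelli1.
- by move=> y _; exact: integral_ge0.
rewrite muleA -EFinM -invfM -normrM /e mulrC divfK//.
by rewrite det1 invr1 mul1e.
Qed.

Lemma mpres_linear2 (a b c d : R) : `|a * d - b * c| = 1 ->
  mpres (leb \X leb) (leb \X leb)
    (fun z => (a * z.1 + b * z.2, c * z.1 + d * z.2)).
Proof.
move=> det1; have [a0|a0] := eqVneq a 0; last exact: mpres_linear2_pivot.
have b0 : b != 0.
  apply/eqP => b0; move: det1; rewrite a0 b0 !mul0r subrr normr0 => /eqP.
  by rewrite eq_sym oner_eq0.
have /(mpres_comp (mpres_swap leb leb)) : mpres (leb \X leb) (leb \X leb)
    (fun z => (b * z.1 + a * z.2, d * z.1 + c * z.2)).
  by apply: mpres_linear2_pivot => //; rewrite distrC.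
congr (mpres _ _ _); apply/funext => z /=.
by congr (_, _); rewrite addrC.
Qed.

End lebesgue_line.

Arguments leb {R} : simpl never.

(** * Complex-valued functions of a real variable *)

(* locked, as otherwise unification unfolds them into products *)
HB.lock Definition qexp (R : realType) (A B : R[i]) (x : R) : R[i] :=
  cexp (A * (x ^+ 2)%:C + B * x%:C).

HB.lock Definition chi (R : realType) (t : R) : R[i] := cexp (0 -i* t).

Section complex_derivative.
Context {R : realType}.
Implicit Types (f g : R -> R[i]) (x : R).

Definition cderiv f x (df : R[i]) :=
  is_derive x 1 (fun y => complex.Re (f y)) (complex.Re df) /\
  is_derive x 1 (fun y => complex.Im (f y)) (complex.Im df).

Lemma cderiv_eq f x (d d' : R[i]) : cderiv f x d -> d = d' -> cderiv f x d'.
Proof. by move=> h <-. Qed.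

Lemma cderivM f g x (df dg : R[i]) : cderiv f x df -> cderiv g x dg ->
  cderiv (fun y => f y * g y) x (df * g x + f x * dg).
Proof.
move=> [f1 f2] [g1 g2]; split.
  under eq_fun do rewrite ReM.
  by apply: is_derive_eq; rewrite !ReImE /= /GRing.scale /=; ring.
under eq_fun do rewrite ImM.
by apply: is_derive_eq; rewrite !ReImE /= /GRing.scale /=; ring.
Qed.

Lemma cderiv_cexp f x (df : R[i]) : cderiv f x df ->
  cderiv (fun y => cexp (f y)) x (df * cexp (f x)).
Proof.
move=> [f1 f2]; split.
  under eq_fun do rewrite ReM /= mul0r subr0.
  by apply: is_derive_eq; rewrite !ReImE /= /GRing.scale /=; ring.
under eq_fun do rewrite ImM /= mul0r addr0.
by apply: is_derive_eq; rewrite !ReImE /= /GRing.scale /=; ring.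
Qed.

Lemma cderiv_quadratic (A B : R[i]) x :
  cderiv (fun y => A * (y ^+ 2)%:C + B * y%:C) x (2%:R * A * x%:C + B).
Proof.
case: A => A1 A2; case: B => B1 B2; split => /=.
  by apply: is_derive_eq; rewrite /= /GRing.scale /=; ring.
by apply: is_derive_eq; rewrite /= /GRing.scale /=; ring.
Qed.

Lemma cderiv0_cst f x y : (forall z, cderiv f z 0) -> f x = f y.
Proof.
move=> f0; apply: complex_ext.
  by apply: (@is_derive_0_is_cst _ (fun z => complex.Re (f z))) => z;
    have [] := f0 z.
by apply: (@is_derive_0_is_cst _ (fun z => complex.Im (f z))) => z;
  have [] := f0 z.
Qed.

Lemma cderiv_qexp (A B : R[i]) x :
  cderiv (qexp A B) x ((2%:R * A * x%:C + B) * qexp A B x).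
Proof. by rewrite qexp.unlock; apply: cderiv_cexp; exact: cderiv_quadratic. Qed.

Lemma qexpN (A B : R[i]) x : qexp (- A) (- B) x * qexp A B x = 1.
Proof.
by rewrite qexp.unlock -cexpD -[RHS](@cexp0 R); congr cexp; ring.
Qed.

Lemma linear_ode_qexp f (p q : R[i]) :
  (forall x, cderiv f x ((2%:R * p * x%:C + q) * f x)) ->
  forall x, f x = f 0 * qexp p q x.
Proof.
move=> df x.
have E0 : qexp (- p) (- q) 0 = 1.
  by rewrite qexp.unlock expr0n /= !mulr0 addr0 cexp0.
have : f x * qexp (- p) (- q) x = f 0 * qexp (- p) (- q) 0.
  apply: (@cderiv0_cst (fun y => f y * qexp (- p) (- q) y)) => z.
  apply: cderiv_eq (cderivM (df z) (cderiv_qexp (- p) (- q) z)) _; ring.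
by rewrite E0 mulr1 => <-; rewrite -mulrA qexpN mulr1.
Qed.

End complex_derivative.

(** * Differentiation of Fourier integrals *)

Section character.
Context {R : realType}.

Lemma chiE (t : R) : chi t = cos t -i* sin t.
Proof.
by rewrite chi.unlock /cexp /= expR0 cosN sinN; apply: complex_ext; rewrite ReImE /=; ring.
Qed.

Lemma Re_chi (t : R) : complex.Re (chi t) = cos t.
Proof. by rewrite chiE. Qed.

Lemma Im_chi (t : R) : complex.Im (chi t) = - sin t.
Proof. by rewrite chiE. Qed.

Lemma chiD (s t : R) : chi (s + t) = chi s * chi t.
Proof.
by rewrite chi.unlock -cexpD; congr cexp; apply: complex_ext; rewrite ReImE /=; ring.
Qed.

Lemma chi0 : chi (0 : R) = 1.
Proof. by rewrite chi.unlock oppr0 cexp0. Qed.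

Lemma sqn_chi (t : R) : sqn (chi t) = 1.
Proof. by rewrite chi.unlock sqn_cexp expR0 expr1n. Qed.

Lemma normc_chi (t : R) : ComplexField.Normc.normc (chi t) = 1.
Proof. by rewrite chi.unlock normc_cexp expR0. Qed.

Lemma cexp_chi (t : R) : cexp (0 -i* t) = chi t.
Proof. by rewrite chi.unlock. Qed.

Lemma qexp_chi (A B : R[i]) (s x : R) :
  qexp A B x * chi (s * x) = qexp A (B - 'i * s%:C) x.
Proof.
rewrite qexp.unlock chi.unlock -cexpD; congr cexp; rewrite -addrA; congr (_ + _).
by apply: complex_ext; rewrite !ReImE /=; ring.
Qed.

Lemma cmeas_chi_comp d (T : measurableType d) (a : T -> R) :
  measurable_fun setT a -> cmeas (fun x => chi (a x)).
Proof.
by move=> ma; rewrite chi.unlock; apply: cmeas_cexp; apply: cmeas_im; exact: measurableT_comp.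
Qed.

Lemma cintegrable_mul_chi d (T : measurableType d) (mu : {measure set T -> \bar R})
    (f : T -> R[i]) (a : T -> R) : cintegrable mu f -> measurable_fun setT a ->
  cintegrable mu (fun x => f x * chi (a x)).
Proof.
move=> intf ma; apply: (cintegrable_dominated _ intf).
  by apply: cmeasM; [exact: cintegrable_cmeas intf|exact: cmeas_chi_comp].
by move=> x; rewrite ComplexField.Normc.normcM normc_chi mulr1.
Qed.

End character.

Section fourier_derivative.
Context d (T : measurableType d) {R : realType} (mu : {measure set T -> \bar R}).
Variables (f : T -> R[i]) (a : T -> R).
Hypothesis intf : cintegrable mu f.
Hypothesis ma : measurable_fun setT a.
Hypothesis intaf : cintegrable mu (fun w => (a w)%:C * f w).

Let mf := cintegrable_cmeas intf.

Lemma cmeas_chi (s : R) : cmeas (fun w => chi (s * a w)).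
Proof.
apply: cmeas_chi_comp; apply: measurable_funM => //; exact: measurable_cst.
Qed.

Lemma cintegrable_chi (s : R) : cintegrable mu (fun w => f w * chi (s * a w)).
Proof.
apply: cintegrable_mul_chi; first exact: intf.
by apply: measurable_funM => //; exact: measurable_cst.
Qed.

(* the real and imaginary parts are both of this form *)
Let derivative_real (u v : T -> R) (s : R) :
  mu.-integrable setT (EFin \o u) -> mu.-integrable setT (EFin \o v) ->
  mu.-integrable setT (EFin \o (fun w => a w * u w)) ->
  mu.-integrable setT (EFin \o (fun w => a w * v w)) ->
  is_derive s 1 (fun s => \int[mu]_w (u w * cos (s * a w) + v w * sin (s * a w)))
    (\int[mu]_w (a w * v w * cos (s * a w) - a w * u w * sin (s * a w))).
Proof.
move=> iu iv iau iav.
pose h s w := u w * cos (s * a w) + v w * sin (s * a w).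
have mco (t : R) : measurable_fun setT (fun w => cos (t * a w)).
  by have [+ _] := cmeas_chi t; under eq_fun do rewrite Re_chi.
have msi (t : R) : measurable_fun setT (fun w => sin (t * a w)).
  have [_ +] := cmeas_chi t; under eq_fun do rewrite Im_chi.
  move=> m; under eq_fun do rewrite -[sin _]opprK; exact: measurableT_comp.
have mu' : measurable_fun setT u by apply/measurable_EFinP; exact: measurable_int iu.
have mv' : measurable_fun setT v by apply/measurable_EFinP; exact: measurable_int iv.
have bound (p q c e : R) : `|c| <= 1 -> `|e| <= 1 -> `|p * c + q * e| <= `|p| + `|q|.
  move=> c1 e1; rewrite (le_trans (ler_normD _ _))// !normrM.
  by apply: lerD; rewrite ler_piMr.
have intG : mu.-integrable setT (EFin \o (fun w => `|a w * u w| + `|a w * v w|)).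
  exact: (integrableD measurableT (integrable_abse iau) (integrable_abse iav)).
have dh (t : R) w : is_derive t 1 (h ^~ w) (a w * v w * cos (t * a w) - a w * u w * sin (t * a w)).
  by rewrite /h; apply: is_derive_eq; rewrite /= /GRing.scale /=; ring.
have hint (t : R) : mu.-integrable setT (EFin \o h t).
  apply: (le_integrable _ _ _ (integrableD measurableT (integrable_abse iu) (integrable_abse iv))) => //.
    apply/measurable_EFinP; apply: measurable_funD; exact: measurable_funM.
  move=> w _; rewrite !abse_EFin /= lee_fin [leRHS]ger0_norm ?addr_ge0//.
  by apply: bound; [exact: cos_max|exact: sin_max].
have E (t : R) w : partial1of2 h t w = a w * v w * cos (t * a w) - a w * u w * sin (t * a w).
  by rewrite /partial1of2 derive1E; exact: derive_val.
have Is : `](s - 1), (s + 1)[%classic s.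
  by rewrite /= in_itv /= ltrBlDr ltrDl ltr01.
have dhs (t : R) w : `](s - 1), (s + 1)[%classic t -> setT w -> derivable (h ^~ w) t 1.
  by move=> _ _; exact: (@ex_derive _ _ _ _ _ _ _ (dh t w)).
have bd (t : R) w : `](s - 1), (s + 1)[%classic t -> setT w ->
    `|partial1of2 h t w| <= `|a w * u w| + `|a w * v w|.
  move=> _ _; rewrite E -mulNr addrC -[in leRHS](normrN (a w * u w)).
  by apply: bound; [exact: sin_max|exact: cos_max].
apply: DeriveDef.
  exact: (derivable_under_integral measurableT Is (fun t _ => hint t) dhs
    (fun w => addr_ge0 (normr_ge0 _) (normr_ge0 _)) intG bd).
rewrite -derive1E.
rewrite (differentiation_under_integral measurableT Is (fun t _ => hint t) dhs
    (fun w => addr_ge0 (normr_ge0 _) (normr_ge0 _)) intG bd).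
by apply: eq_Rintegral => w _; exact: E.
Qed.

Lemma cderiv_fourier (s : R) :
  cderiv (fun s => cint mu (fun w => f w * chi (s * a w))) s
    (- 'i * cint mu (fun w => (a w)%:C * f w * chi (s * a w))).
Proof.
have [f1 f2] := intf.
have iaR : mu.-integrable setT (EFin \o (fun w => a w * complex.Re (f w))).
  have [+ _] := intaf; under eq_fun do rewrite ReM /= mul0r subr0.
  by [].
have iaI : mu.-integrable setT (EFin \o (fun w => a w * complex.Im (f w))).
  have [_ +] := intaf; under eq_fun do rewrite ImM /= mul0r addr0.
  by [].
split.
  rewrite [X in is_derive _ _ X _](_ : _ = fun t => \int[mu]_w
    (complex.Re (f w) * cos (t * a w) + complex.Im (f w) * sin (t * a w))).
    apply: is_derive_eq (derivative_real s f1 f2 iaR iaI) _.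
    rewrite !ReImE /= oppr0 mul0r sub0r mulN1r opprK.
    by apply: eq_Rintegral => w _; rewrite ImM Re_chi Im_chi !ReImE /=; ring.
  apply/funext => t /=; apply: eq_Rintegral => w _.
  by rewrite ReM Re_chi Im_chi; ring.
have f1N : mu.-integrable setT (EFin \o (fun w => - complex.Re (f w))).
  rewrite (_ : EFin \o _ = (\- (EFin \o (fun w => complex.Re (f w))))%E)//.
  exact: integrableN.
have iaRN : mu.-integrable setT (EFin \o (fun w => a w * - complex.Re (f w))).
  rewrite (_ : EFin \o _ = (\- (EFin \o (fun w => a w * complex.Re (f w))%R))%E).
    exact: integrableN.
  by apply/funext => w /=; rewrite mulrN.
rewrite [X in is_derive _ _ X _](_ : _ = fun t => \int[mu]_w
  (complex.Im (f w) * cos (t * a w) + - complex.Re (f w) * sin (t * a w))).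
  apply: is_derive_eq (derivative_real s f2 f1N iaI iaRN) _.
  rewrite !ReImE /= oppr0 mul0r add0r mulN1r -[RHS]mulN1r -RintegralZl//; last first.
    have [+ _] : cintegrable mu (fun w => (a w)%:C * f w * chi (s * a w)).
      apply: cintegrable_mul_chi; first exact: intaf.
      by apply: measurable_funM => //; exact: measurable_cst.
    by [].
  by apply: eq_Rintegral => w _; rewrite ReM Re_chi Im_chi !ReImE /=; ring.
apply/funext => t /=; apply: eq_Rintegral => w _.
by rewrite ImM Re_chi Im_chi; ring.
Qed.

End fourier_derivative.

(** * Gaussians on the line and their Fourier transforms *)

Section gaussian.
Context {R : realType}.
Local Notation leb := (@leb R).

Lemma gauss_integral (c : R) : 0 < c ->
  (\int[leb]_x (expR (- (c * x ^+ 2)))%:E = (Num.sqrt (pi / c))%:E)%E.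
Proof.
move=> c0; have s0 : 0 < Num.sqrt c by rewrite sqrtr_gt0.
have mg : measurable_fun setT (fun x : R => (gauss_fun x)%:E).
  by apply/measurable_EFinP; exact: measurable_gauss_fun.
have := @lebesgue_affine R (Num.sqrt c) 0 (fun x => (gauss_fun x)%:E)
  (lt0r_neq0 s0) mg (fun x => expR_ge0 _).
rewrite integralT_gauss ger0_norm ?ltW//.
rewrite (_ : (\int[_]_x _)%E = (\int[leb]_x (expR (- (c * x ^+ 2)))%:E)%E); last first.
  apply: eq_integral => x _; rewrite /gauss_fun addr0 exprMn sqr_sqrtr//; exact: ltW.
move=> E.
rewrite sqrtrM ?pi_ge0// sqrtrV ?ltW// EFinM -E.
rewrite muleAC -EFinM divff ?mul1e//; exact: lt0r_neq0.
Qed.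

Lemma integrable_gauss (c : R) : 0 < c ->
  leb.-integrable setT (fun x => (expR (- (c * x ^+ 2)))%:E).
Proof.
move=> c0; apply/integrableP; split.
  apply/measurable_EFinP; apply: measurableT_comp => //; apply: measurableT_comp => //.
  apply: measurable_funM; first exact: measurable_cst.
  exact: measurable_funX.
under eq_integral do rewrite gee0_abs ?lee_fin ?expR_ge0//.
by rewrite gauss_integral// ltry.
Qed.

Lemma quadratic_bound (c b x : R) : 0 < c ->
  - (c * x ^+ 2) + b * x <= b ^+ 2 / (2 * c) - c / 2 * x ^+ 2.
Proof.
move=> c0; rewrite -subr_ge0.
have -> : b ^+ 2 / (2 * c) - c / 2 * x ^+ 2 - (- (c * x ^+ 2) + b * x) =
   c / 2 * (x - b / c) ^+ 2 by field; rewrite gt_eqF.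
by rewrite mulr_ge0 ?sqr_ge0// divr_ge0// ltW.
Qed.

Lemma normr_quadratic_bound (c b x : R) : 0 < c ->
  - (c * x ^+ 2) + b * `|x| <= b ^+ 2 / (2 * c) - c / 2 * x ^+ 2.
Proof.
by move=> c0; rewrite -real_normK ?num_real//; exact: quadratic_bound.
Qed.

Variables (A B : R[i]).

Lemma normc_qexp (x : R) : ComplexField.Normc.normc (qexp A B x) =
  expR (complex.Re A * x ^+ 2 + complex.Re B * x).
Proof. by rewrite qexp.unlock normc_cexp !ReImE /= !mulr0 !subr0. Qed.

Lemma cmeas_qexp : cmeas (fun x : measurableTypeR R => qexp A B x).
Proof.
rewrite qexp.unlock; apply: cmeas_cexp; apply: cmeasD; apply: cmeasM; first exact: cmeas_cst.
- by apply: cmeas_real; exact: measurable_funX.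
- exact: cmeas_cst.
- exact: cmeas_real.
Qed.

Lemma cmeas_xqexp : cmeas (fun x : measurableTypeR R => x%:C * qexp A B x).
Proof. by apply: cmeasM; [exact: cmeas_real|exact: cmeas_qexp]. Qed.

Hypothesis A0 : complex.Re A < 0.

Let c := - complex.Re A.
Let c0 : 0 < c. Proof. by rewrite oppr_gt0. Qed.

(** A polynomial factor is absorbed in the exponential, [|x| <= exp |x|], at
    the cost of half of the quadratic decay. *)
Lemma xqexp_bound (x : R) : (1 + `|x|) * ComplexField.Normc.normc (qexp A B x) <=
  expR ((`|complex.Re B| + 1) ^+ 2 / (2 * c)) * expR (- (c / 2 * x ^+ 2)).
Proof.
rewrite normc_qexp -expRD.
apply: (@le_trans _ _ (expR `|x| * expR (complex.Re A * x ^+ 2 + complex.Re B * x))).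
  by apply: ler_wpM2r; [exact: expR_ge0|exact: expR_ge1Dx].
rewrite -expRD ler_expR; apply: le_trans (normr_quadratic_bound _ x c0).
have : complex.Re B * x <= `|complex.Re B| * `|x| by rewrite -normrM ler_norm.
rewrite /c; lra.
Qed.

Let bound_integrable : leb.-integrable setT (EFin \o (fun x =>
  expR ((`|complex.Re B| + 1) ^+ 2 / (2 * c)) * expR (- (c / 2 * x ^+ 2)))).
Proof.
rewrite /comp; under eq_fun do rewrite EFinM.
apply: integrableZl => //.
by apply: integrable_gauss; rewrite divr_gt0.
Qed.

Lemma cintegrable_qexp : cintegrable leb (qexp A B).
Proof.
apply: (cintegrable_le cmeas_qexp bound_integrable) => x.
apply: le_trans (xqexp_bound x); rewrite ler_peMl ?normc_ge0// lerDl//.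
Qed.

Lemma cintegrable_xqexp : cintegrable leb (fun x => x%:C * qexp A B x).
Proof.
apply: (cintegrable_le cmeas_xqexp bound_integrable) => x.
apply: le_trans (xqexp_bound x); rewrite ComplexField.Normc.normcM.
apply: ler_wpM2r; first exact: normc_ge0.
by rewrite normcE sqnR sqrtr_sqr lerDr.
Qed.

End gaussian.

Section integral_of_derivative.
Context {R : realType}.
Local Notation leb := (@leb R).

Lemma Rintegral_derivative (F f : R -> R) : continuous f ->
  leb.-integrable setT (EFin \o f) -> (forall x : R, is_derive x 1 F (f x)) ->
  F n%:R @[n --> \oo] --> 0 -> F (- n%:R) @[n --> \oo] --> 0 ->
  \int[leb]_x f x = 0.
Proof.
move=> cf intf dF Fp Fm.
have mf : measurable_fun setT (EFin \o f) := measurable_int _ intf.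
have FTC n : (\int[leb]_(x in `[(- n.+1%:R)%R, n.+1%:R]) (f x)%:E =
    (F n.+1%:R - F (- n.+1%:R))%:E)%E.
  rewrite EFinB; apply: continuous_FTC2.
  - by rewrite -subr_gt0 opprK addr_gt0// ltr0n.
  - exact: continuous_subspaceT.
  - have cF (x : R) : {for x, continuous F}.
      by apply: differentiable_continuous; apply/derivable1_diffP; exact: ex_derive.
    split=> [x _||]; first exact: ex_derive.
    + by apply: cvg_at_right_filter; exact: cF.
    + by apply: cvg_at_left_filter; exact: cF.
  - by move=> x _; rewrite derive1E; exact: derive_val.
have lim1 : (\int[leb]_(x in `[(- n.+1%:R)%R, n.+1%:R]) (f x)%:E @[n --> \oo] -->
    \int[leb]_x (f x)%:E)%E.
  under eq_fun do rewrite integral_mkcond.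
  have lim := @dominated_cvg _ _ _ leb setT measurableT
    (fun n => (EFin \o f) \_ `[(- n.+1%:R)%R, n.+1%:R]) (EFin \o f)
    (abse \o (EFin \o f)).
  apply: lim => //.
  - move=> n; apply/(measurable_restrictT _ _).1 => //; exact: measurable_funS mf.
  - move=> x _; apply: cvg_near_cst.
    near=> n; rewrite /patch ifT// inE /= in_itv /= -ler_norml.
    near: n; exists (Num.trunc `|x|) => // n /= xn.
    by rewrite ltW// (lt_le_trans (truncnS_gt _))// ler_nat.
  - by apply: integrable_abse.
  - move=> n x _; rewrite /patch; case: ifPn => //= _.
    by rewrite normr0 lee_fin.
have lim2 : ((F n.+1%:R - F (- n.+1%:R))%:E @[n --> \oo] --> 0%:E)%E.
  apply: cvg_EFin; first exact: nearW.
  rewrite -[X in _ --> X]subr0; apply: cvgB.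
    by have := Fp; rewrite -(cvg_shiftS).
  by have := Fm; rewrite -(cvg_shiftS).
rewrite /Rintegral (_ : (\int[leb]_x _)%E = 0%E)//.
apply: (cvg_unique _ lim1) => //.
rewrite (_ : (fun _ => _) = fun n => (F n.+1%:R - F (- n.+1%:R))%:E)//.
by apply/funext => n; exact: FTC.
Unshelve. all: end_near. Qed.

End integral_of_derivative.

Section fourier_gaussian.
Context {R : realType}.
Local Notation leb := (@leb R).

Lemma cderiv_continuous (f df : R -> R[i]) : (forall x, cderiv f x (df x)) ->
  continuous (fun x => complex.Re (f x)) /\ continuous (fun x => complex.Im (f x)).
Proof.
move=> fP; split=> x; have [f1 f2] := fP x.
  by apply: differentiable_continuous; apply/derivable1_diffP; exact: ex_derive.
by apply: differentiable_continuous; apply/derivable1_diffP; exact: ex_derive.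
Qed.

Variables (A B : R[i]) (A0 : complex.Re A < 0).

Lemma normc_qexp_cvg0 (u : nat -> R) : (forall n, `|u n| = n%:R) ->
  ComplexField.Normc.normc (qexp A B (u n)) @[n --> \oo] --> (0 : R).
Proof.
move=> un; have c0 : 0 < - complex.Re A by rewrite oppr_gt0.
set K := expR ((`|complex.Re B| + 1) ^+ 2 / (2 * - complex.Re A)).
apply: (@squeeze_cvgr _ _ _ _ (cst 0) (fun n => K * harmonic n)).
- apply/nearW => n; rewrite normc_ge0 /= /harmonic ler_pdivlMr ?ltr0n//.
  have := xqexp_bound B A0 (u n); rewrite un -/K => bnd.
  rewrite -natr1 mulrC addrC (le_trans bnd)// ler_piMr ?expR_ge0//.
  rewrite -[leRHS]expR0 ler_expR oppr_le0 mulr_ge0 ?sqr_ge0//.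
  by rewrite divr_ge0// ltW.
- exact: cvg_cst.
- rewrite -[X in _ --> X](mulr0 K); apply: cvgMr; exact: cvg_harmonic.
Qed.

Lemma cint_derivative_qexp :
  2%:R * A * cint leb (fun x => x%:C * qexp A B x) + B * cint leb (qexp A B) = 0.
Proof.
pose df x := (2%:R * A * x%:C + B) * qexp A B x.
have intdf : cintegrable leb df.
  rewrite (_ : df = fun x => 2%:R * A * (x%:C * qexp A B x) + B * qexp A B x).
    apply: cintegrableD; apply: cintegrableZ; first exact: cintegrable_xqexp.
    exact: cintegrable_qexp.
  by apply/funext => x; rewrite /df; ring.
have <- : cint leb df = 2%:R * A * cint leb (fun x => x%:C * qexp A B x) +
    B * cint leb (qexp A B).
  rewrite -!cintZ; [|exact: cintegrable_qexp|exact: cintegrable_xqexp].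
  rewrite -cintD.
  - by congr (cint leb _); apply/funext => x; rewrite /df; ring.
  - by apply: cintegrableZ; exact: cintegrable_xqexp.
  - by apply: cintegrableZ; exact: cintegrable_qexp.
have ddf x : cderiv df x (2%:R * A * qexp A B x +
    (2%:R * A * x%:C + B) * ((2%:R * A * x%:C + B) * qexp A B x)).
  apply: cderivM (cderiv_qexp A B x).
  case: (A) => A1 A2; case: (B) => B1 B2; split => /=.
    by apply: is_derive_eq; rewrite /= /GRing.scale /=; ring.
  by apply: is_derive_eq; rewrite /= /GRing.scale /=; ring.
have [cR cI] := cderiv_continuous ddf.
have [iR iI] := intdf.
have lim (h : R[i] -> R) (u : nat -> R) : (forall n, `|u n| = n%:R) ->
    (forall z, `|h z| <= ComplexField.Normc.normc z) ->
    h (qexp A B (u n)) @[n --> \oo] --> (0 : R).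
  move=> un hz; apply/norm_cvg0P.
  apply: (@squeeze_cvgr _ _ _ _ (cst 0) _ _ _ _ _ (normc_qexp_cvg0 un)).
    by apply/nearW => n; rewrite normr_ge0 /= hz.
  exact: cvg_cst.
have uN n : `|(- n%:R : R)| = n%:R by rewrite normrN normr_nat.
have uP n : `|(n%:R : R)| = n%:R by rewrite normr_nat.
apply: complex_ext; rewrite /=.
  apply: (@Rintegral_derivative _ (fun x => complex.Re (qexp A B x))) => //.
  - by move=> x; have [] := cderiv_qexp A B x.
  - exact: (lim _ _ uP (@normr_Re_le _)).
  - exact: (lim _ _ uN (@normr_Re_le _)).
apply: (@Rintegral_derivative _ (fun x => complex.Im (qexp A B x))) => //.
- by move=> x; have [] := cderiv_qexp A B x.
- exact: (lim _ _ uP (@normr_Im_le _)).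
- exact: (lim _ _ uN (@normr_Im_le _)).
Qed.

End fourier_gaussian.

(** The transform of a Gaussian solves a first order linear equation: its
    derivative is the transform of [- i x f], and [int f' = 0] expresses that
    in terms of the transform itself. *)
Lemma fourier_qexp (R : realType) (A B : R[i]) (s : R) : complex.Re A < 0 ->
  cint leb (fun x => qexp A B x * chi (s * x)) =
  cint leb (qexp A B) * qexp ((4%:R * A)^-1) ('i * B / (2%:R * A)) s.
Proof.
move=> A0; have AN0 : A != 0 by apply: contraTneq A0 => ->; rewrite /= ltxx.
pose psi s := cint leb (fun x => qexp A B x * chi (s * x)).
have psi0 : psi 0 = cint leb (qexp A B).
  by rewrite /psi; congr (cint leb _); apply/funext => x; rewrite mul0r chi0 mulr1.
rewrite -psi0; apply: (@linear_ode_qexp _ psi) => {s} s.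
apply: cderiv_eq (cderiv_fourier (cintegrable_qexp B A0) _
  (cintegrable_xqexp B A0) s) _; first exact: measurable_id.
have := cint_derivative_qexp (B - 'i * s%:C) A0.
have -> : cint leb (qexp A (B - 'i * s%:C)) = psi s.
  by congr (cint leb _); apply/funext => x; rewrite qexp_chi.
set I := cint leb _ => E.
have -> : cint leb (fun w => w%:C * qexp A B w * chi (s * w)) = I.
  by congr (cint leb _); apply/funext => x; rewrite -mulrA qexp_chi.
have i2 : 'i * 'i = -1 :> R[i] by rewrite -expr2 sqr_i.
have -> : I = - ((B - 'i * s%:C) * psi s) / (2%:R * A).
  apply/eqP; rewrite eq_sym -subr_eq0; apply/eqP.
  rewrite -(mulr0 (- (2%:R * A)^-1)) -E; field.
  exact: AN0.
have -> : 2%:R * (4%:R * A)^-1 = (2%:R * A)^-1 by field; exact: AN0.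
transitivity (('i * B - 'i * 'i * s%:C) / (2%:R * A) * psi s).
  by field; exact: AN0.
by rewrite i2; field; exact: AN0.
Qed.

(** * Mean-square continuity of translations *)

Section extended_limits.
Context {R : realType}.

Lemma cvge0P (a : nat -> \bar R) : (forall n, 0 <= a n)%E ->
  (a n @[n --> \oo] --> 0%E) <->
  (forall e : R, 0 < e -> \forall n \near \oo, (a n <= e%:E)%E).
Proof.
move=> a0; split=> [/fine_cvgP[afin /cvgrPdist_le ac] e e0|ae].
  have := ac _ e0; apply: filter_app2 afin; near=> n => an.
  by rewrite /= sub0r normrN ger0_norm ?fine_ge0// -lee_fin fineK.
apply/fine_cvgP; split.
  have := ae _ ltr01; apply: filterS => n an.
  by rewrite ge0_fin_numE// (le_lt_trans an)// ltry.
apply/cvgrPdist_le => e e0; have := ae _ e0; apply: filterS => n an.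
rewrite /= sub0r normrN ger0_norm ?fine_ge0//.
by rewrite -lee_fin fineK// ge0_fin_numE// (le_lt_trans an)// ltry.
Unshelve. all: end_near. Qed.

End extended_limits.

Section cutoff.
Context {R : realType}.
Implicit Types (x y m : R).

Definition clip m x : R := (`|x + m| - `|x - m|) / 2.

Lemma clip_bound m x : 0 <= m -> `|clip m x| <= m.
Proof.
move=> m0; rewrite /clip ler_norml.
by case: (ger0P (x + m)) => ?; case: (ger0P (x - m)) => ?; apply/andP; split; lra.
Qed.

Lemma clip_id m x : `|x| <= m -> clip m x = x.
Proof.
rewrite ler_norml => /andP[? ?].
by rewrite /clip ger0_norm ?ler0_norm; lra.
Qed.

Lemma clip_dist m x y : 0 <= m -> `|x| <= m -> `|x - clip m y| <= `|x - y|.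
Proof.
move=> m0; rewrite ler_norml => /andP[? ?]; rewrite /clip.
case: (ger0P (y + m)) => ?; case: (ger0P (y - m)) => ?; rewrite ler_norml;
  case: (ger0P (x - y)) => ?; apply/andP; split; lra.
Qed.

Lemma clip_shrink m x : 0 <= m -> `|x - clip m x| <= `|x|.
Proof.
move=> m0; rewrite /clip.
case: (ger0P (x + m)) => ?; case: (ger0P (x - m)) => ?; rewrite ler_norml;
  case: (ger0P x) => ?; apply/andP; split; lra.
Qed.

Lemma continuous_clip m : continuous (clip m).
Proof.
move=> x; apply: cvgMl; apply: cvgB.
  by apply: cvg_norm; apply: cvgD; [exact: cvg_id|exact: cvg_cst].
by apply: cvg_norm; apply: cvgB; [exact: cvg_id|exact: cvg_cst].
Qed.

(** Equal to 1 on [[-m, m]] and to 0 outside [[-m - 1, m + 1]]. *)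
Definition plateau m x : R := 2^-1 + clip 2^-1 (m + 2^-1 - `|x|).

Lemma plateau_ge0 m x : 0 <= plateau m x.
Proof.
have := @clip_bound 2^-1 (m + 2^-1 - `|x|).
rewrite /plateau invr_ge0 ler0n => /(_ isT); rewrite ler_norml => /andP[]; lra.
Qed.

Lemma plateau_le1 m x : plateau m x <= 1.
Proof.
have := @clip_bound 2^-1 (m + 2^-1 - `|x|).
rewrite /plateau invr_ge0 ler0n => /(_ isT); rewrite ler_norml => /andP[]; lra.
Qed.

Lemma plateau1 m x : `|x| <= m -> plateau m x = 1.
Proof.
move=> xm; rewrite /plateau /clip; set t := `|x| in xm *.
by case: (ger0P (m + 2^-1 - t + 2^-1)) => ?; case: (ger0P (m + 2^-1 - t - 2^-1)) => ?; lra.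
Qed.

Lemma plateau0 m x : m + 1 <= `|x| -> plateau m x = 0.
Proof.
move=> xm; rewrite /plateau /clip; set t := `|x| in xm *.
by case: (ger0P (m + 2^-1 - t + 2^-1)) => ?; case: (ger0P (m + 2^-1 - t - 2^-1)) => ?; lra.
Qed.

Lemma continuous_plateau m : continuous (plateau m).
Proof.
move=> x; apply: cvgD; first exact: cvg_cst.
apply: (continuous_comp (f := fun x => m + 2^-1 - `|x|)).
  by apply: cvgB; [exact: cvg_cst|apply: cvg_norm; exact: cvg_id].
exact: continuous_clip.
Qed.

End cutoff.

Section translation_gap.
Context {R : realType}.
Local Notation leb := (@leb R).
Implicit Types (u g : R -> R) (h : R).

(** Gaussian average, over the shift, of the squared [L^2] distance between
    [u] and its translates of order [h]. *)
Definition gap u h : \bar R := (\int[leb \X leb]_z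
  ((u z.1 - u (z.1 - h * z.2)) ^+ 2 * expR (- z.2 ^+ 2))%:E)%E.

Lemma gap_ge0 u h : (0 <= gap u h)%E.
Proof.
by apply: integral_ge0 => z _; rewrite lee_fin mulr_ge0 ?sqr_ge0 ?expR_ge0.
Qed.

Lemma measurable_shift h : measurable_fun setT
  (fun z : measurableTypeR R * measurableTypeR R => z.1 - h * z.2 : measurableTypeR R).
Proof.
apply: measurable_funB => //; apply: measurable_funM => //; exact: measurable_cst.
Qed.

Lemma measurable_expRN2 : measurable_fun setT
  (fun z : measurableTypeR R * measurableTypeR R => expR (- z.2 ^+ 2)).
Proof.
apply: measurableT_comp => //; apply: measurableT_comp => //.
by apply: measurable_funX; exact: measurable_snd.
Qed.

Section measurability.
Variables (u : R -> R) (h : R).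
Hypothesis mu : measurable_fun setT u.

Lemma measurable_fst_sq : measurable_fun setT
  (fun z : measurableTypeR R * measurableTypeR R => u z.1 ^+ 2 * expR (- z.2 ^+ 2)).
Proof.
apply: measurable_funM measurable_expRN2; apply: measurable_funX.
exact: (measurableT_comp mu measurable_fst).
Qed.

Lemma measurable_shift_sq : measurable_fun setT
  (fun z : measurableTypeR R * measurableTypeR R =>
    u (z.1 - h * z.2) ^+ 2 * expR (- z.2 ^+ 2)).
Proof.
apply: measurable_funM measurable_expRN2; apply: measurable_funX.
exact: (measurableT_comp mu (measurable_shift h)).
Qed.

Lemma measurable_gap : measurable_fun setT
  (fun z : measurableTypeR R * measurableTypeR R =>
    (u z.1 - u (z.1 - h * z.2)) ^+ 2 * expR (- z.2 ^+ 2)).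
Proof.
apply: measurable_funM measurable_expRN2; apply: measurable_funX.
apply: measurable_funB; first exact: (measurableT_comp mu measurable_fst).
exact: (measurableT_comp mu (measurable_shift h)).
Qed.

Lemma integral_gauss1 : (\int[leb]_x (expR (- x ^+ 2))%:E = (Num.sqrt pi)%:E)%E.
Proof.
have := @gauss_integral R 1 ltr01; rewrite divr1 => <-.
by apply: eq_integral => x _; rewrite mul1r.
Qed.

Let msq : measurable_fun setT (fun x => (u x ^+ 2)%:E).
Proof. by apply/measurable_EFinP; exact: measurable_funX. Qed.

Let mexp : measurable_fun setT (fun x : measurableTypeR R => (expR (- x ^+ 2))%:E).
Proof.
by apply/measurable_EFinP; apply: measurableT_comp => //; apply: measurableT_comp.
Qed.

Lemma integral_fst_sq : (\int[leb \X leb]_z (u z.1 ^+ 2 * expR (- z.2 ^+ 2))%:E =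
  (Num.sqrt pi)%:E * \int[leb]_x (u x ^+ 2)%:E)%E.
Proof.
rewrite tonelli1; last 2 first.
- by apply/measurable_EFinP; exact: measurable_fst_sq.
- by move=> z; rewrite lee_fin mulr_ge0 ?sqr_ge0 ?expR_ge0.
rewrite -ge0_integralZl//; last by move=> x _; rewrite lee_fin sqr_ge0.
apply: eq_integral => x _ /=.
under eq_integral do rewrite EFinM.
rewrite ge0_integralZl ?lee_fin ?sqr_ge0//.
by rewrite integral_gauss1 muleC.
Qed.

Lemma integral_shift_sq :
  (\int[leb \X leb]_z (u (z.1 - h * z.2)%R ^+ 2 * expR (- z.2 ^+ 2))%:E =
  (Num.sqrt pi)%:E * \int[leb]_x (u x ^+ 2)%:E)%E.
Proof.
rewrite tonelli2; last 2 first.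
- by apply/measurable_EFinP; exact: measurable_shift_sq.
- by move=> z; rewrite lee_fin mulr_ge0 ?sqr_ge0 ?expR_ge0.
rewrite -integral_gauss1 muleC -ge0_integralZl//; last first.
  by apply: integral_ge0 => x _; rewrite lee_fin sqr_ge0.
apply: eq_integral => y _ /=.
under eq_integral do rewrite mulrC EFinM.
have mv : measurable_fun setT (fun x : measurableTypeR R => (u (x - h * y) ^+ 2)%:E).
  have := @measurable_affine R 1 (- (h * y)); under eq_fun do rewrite mul1r.
  by move=> m1; exact: (measurableT_comp msq m1).
rewrite ge0_integralZl ?lee_fin ?expR_ge0//; last first.
  by move=> x _; rewrite lee_fin sqr_ge0.
rewrite muleC; congr (_ * _)%E.
rewrite -(@lebesgue_affine _ 1 (- (h * y)) (fun x => (u x ^+ 2)%:E)) ?oner_neq0//.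
  by rewrite normr1 mul1e; apply: eq_integral => x _; rewrite mul1r.
by move=> x; rewrite lee_fin sqr_ge0.
Qed.

Lemma gap_le : (gap u h <= (4 * Num.sqrt pi)%:E * \int[leb]_x (u x ^+ 2)%:E)%E.
Proof.
have p0 (x y : R) : (0 <= (x ^+ 2 * expR y)%:E)%E.
  by rewrite lee_fin mulr_ge0 ?sqr_ge0 ?expR_ge0.
apply: (@le_trans _ _ (\int[leb \X leb]_z ((2%:E * (u z.1 ^+ 2 * expR (- z.2 ^+ 2))%:E) +
   (2%:E * (u (z.1 - h * z.2)%R ^+ 2 * expR (- z.2 ^+ 2))%:E)))%E).
  apply: ge0_le_integral => //.
  - by apply/measurable_EFinP; exact: measurable_gap.
  - apply: emeasurable_funD; apply: measurable_funeM; apply/measurable_EFinP.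
      exact: measurable_fst_sq.
    exact: measurable_shift_sq.
  - move=> z _; rewrite -!EFinM -EFinD lee_fin !mulrA -mulrDl.
    rewrite ler_wpM2r ?expR_ge0//.
    by have := sqr_ge0 (u z.1 + u (z.1 - h * z.2)); rewrite !expr2; nra.
have m1 := measurable_fst_sq; have m2 := measurable_shift_sq.
rewrite ge0_integralD//; last 4 first.
- by move=> z _; rewrite mule_ge0// lee_fin.
- by apply: measurable_funeM; exact/measurable_EFinP.
- by move=> z _; rewrite mule_ge0// lee_fin.
- by apply: measurable_funeM; exact/measurable_EFinP.
rewrite !ge0_integralZl ?lee_fin//; [|exact/measurable_EFinP..].
rewrite integral_fst_sq integral_shift_sq.
rewrite !muleA -EFinM -ge0_muleDl; last 2 first.
- by rewrite lee_fin mulr_ge0// sqrtr_ge0.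
- by rewrite lee_fin mulr_ge0// sqrtr_ge0.
by rewrite -EFinD -mulrDl -natrD.
Qed.

End measurability.

Lemma gapD u g h : measurable_fun setT u -> measurable_fun setT g ->
  (gap u h <= 2%:E * gap g h + 2%:E * gap (fun x => u x - g x)%R h)%E.
Proof.
move=> mu mg.
have mug : measurable_fun setT (fun x => u x - g x) by exact: measurable_funB.
have m1 := measurable_gap h mg; have m2 := measurable_gap h mug.
rewrite -!ge0_integralZl ?lee_fin//; last 4 first.
- exact/measurable_EFinP.
- by move=> z _; rewrite lee_fin mulr_ge0 ?sqr_ge0 ?expR_ge0.
- exact/measurable_EFinP.
- by move=> z _; rewrite lee_fin mulr_ge0 ?sqr_ge0 ?expR_ge0.
rewrite -ge0_integralD//; last 4 first.
- by move=> z _; rewrite mule_ge0// lee_fin mulr_ge0 ?sqr_ge0 ?expR_ge0.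
- by apply: measurable_funeM; exact/measurable_EFinP.
- by move=> z _; rewrite mule_ge0// lee_fin mulr_ge0 ?sqr_ge0 ?expR_ge0.
- by apply: measurable_funeM; exact/measurable_EFinP.
apply: ge0_le_integral => //.
- by move=> z _; rewrite lee_fin mulr_ge0 ?sqr_ge0 ?expR_ge0.
- by apply/measurable_EFinP; exact: measurable_gap.
- by apply: emeasurable_funD; apply: measurable_funeM; exact/measurable_EFinP.
move=> z _; rewrite -!EFinM -EFinD lee_fin !mulrA -mulrDl ler_wpM2r ?expR_ge0//.
have := sqr_ge0 ((g z.1 - g (z.1 - h * z.2)) -
  ((u z.1 - g z.1) - (u (z.1 - h * z.2) - g (z.1 - h * z.2)))).
rewrite !expr2; nra.
Qed.

Let gauss2 (p q : R) : 0 < p -> 0 < q -> (leb \X leb).-integrable setT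
  (fun z => (expR (- (p * z.1 ^+ 2)) * expR (- (q * z.2 ^+ 2)))%:E).
Proof.
move=> p0 q0.
have cg (c : R) : 0 < c -> cintegrable leb (fun x : R => (expR (- (c * x ^+ 2)))%:C).
  by move=> c0; split; [exact: integrable_gauss|exact: integrable0].
have [+ _] := cintegrable_tensor (cg _ p0) (cg _ q0).
by under eq_fun do rewrite ReM /= mul0r subr0.
Qed.

Lemma gap_cvg_continuous g (m l : R) : continuous g -> (forall x, `|g x| <= m) ->
  (forall x, l <= `|x| -> g x = 0) -> 0 <= l ->
  gap g (harmonic n) @[n --> \oo] --> 0%E.
Proof.
move=> cg gm gl l0; have mg : measurable_fun setT g := continuous_measurable_fun cg.
pose f n (z : R * R) := ((g z.1 - g (z.1 - harmonic n * z.2)) ^+ 2 * expR (- z.2 ^+ 2))%:E.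
pose G (z : R * R) := (((2 * m) ^+ 2 * expR (l ^+ 2 / 2))%:E *
  (expR (- (4^-1 * z.1 ^+ 2)) * expR (- (2^-1 * z.2 ^+ 2)))%:E)%E.
have G0 z : (0 <= G z)%E.
  rewrite /G -EFinM lee_fin; apply: mulr_ge0; apply: mulr_ge0;
    by rewrite ?sqr_ge0 ?expR_ge0.
have lim := @dominated_cvg _ _ _ (leb \X leb) setT measurableT f (cst 0%E) G.
rewrite -[X in _ --> X](integral0 (leb \X leb) setT); apply: lim.
- by move=> n; apply/measurable_EFinP; exact: measurable_gap.
- move=> z _; rewrite /f; apply: cvg_EFin; first exact: nearW.
  rewrite -[X in _ --> X](mul0r (expR (- z.2 ^+ 2))); apply: cvgMl.
  suff a0 : g z.1 - g (z.1 - harmonic n * z.2) @[n --> \oo] --> (0 : R).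
    rewrite -[X in _ --> X](mulr0 (0 : R)); under eq_fun do rewrite expr2.
    exact: cvgM.
  rewrite -[X in _ --> X](subrr (g z.1)); apply: cvgB; first exact: cvg_cst.
  apply: continuous_cvg; first exact: cg.
  rewrite -[X in _ --> X]subr0; apply: cvgB; first exact: cvg_cst.
  by rewrite -[X in _ --> X](mul0r z.2); apply: cvgMl; exact: cvg_harmonic.
- by move=> z _; rewrite /G.
- by apply: integrableZl => //; apply: gauss2.
move=> n z _; rewrite /f gee0_abs; last first.
  by rewrite lee_fin; apply: mulr_ge0; [exact: sqr_ge0|exact: expR_ge0].
have h0 : 0 <= harmonic n :> R by rewrite /harmonic invr_ge0.
have h1 : harmonic n <= 1 :> R by rewrite /harmonic invf_le1 ?ltr0n// ler1n.
rewrite /G -EFinM lee_fin.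
have [far|close] := ltP (l + `|z.2|) `|z.1|.
  rewrite !gl.
  - rewrite subrr expr0n mul0r; apply: mulr_ge0; apply: mulr_ge0;
      by rewrite ?sqr_ge0 ?expR_ge0.
  - have : `|harmonic n * z.2| <= `|z.2| by rewrite normrM (ger0_norm h0) ler_piMl.
    have := lerB_dist z.1 (harmonic n * z.2); lra.
  - by have := normr_ge0 z.2; lra.
apply: (@le_trans _ _ ((2 * m) ^+ 2 * expR (- z.2 ^+ 2))).
  apply: ler_wpM2r; first exact: expR_ge0.
  rewrite -real_normK ?num_real// lerXn2r ?nnegrE//.
    by rewrite mulr_ge0// (le_trans _ (gm 0)).
  by rewrite (le_trans (ler_normB _ _))// mulr_natl mulr2n lerD.
rewrite -[leRHS]mulrA; apply: ler_wpM2l; first exact: sqr_ge0.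
rewrite -!expRD ler_expR.
have : z.1 ^+ 2 <= (l + `|z.2|) ^+ 2.
  by rewrite -real_normK ?num_real// lerXn2r ?nnegrE// addr_ge0.
have := sqr_ge0 (l - `|z.2|); rewrite -(real_normK (num_real z.2)) !expr2.
by set w := `|z.2|; nra.
Qed.

(** Truncate the argument and the values of [u], then approximate in [L^1] by
    continuous functions: between functions with values in [[-k, k]], the [L^1]
    distance controls the [L^2] distance. A plateau makes the support compact. *)
Lemma L2_dense u (e : R) : measurable_fun setT u ->
  (\int[leb]_x (u x ^+ 2)%:E < +oo)%E -> 0 < e ->
  exists (g : R -> R) (m l : R), [/\ continuous g, forall x, `|g x| <= m,
    forall x, l <= `|x| -> g x = 0, 0 <= l &
    (\int[leb]_x ((u x - g x) ^+ 2)%:E <= e%:E)%E].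
Proof.
move=> mu u2 e0.
pose v n x : R := if `|x| <= n%:R then clip n%:R (u x) else 0.
have mv n : measurable_fun setT (v n).
  apply: measurable_fun_ifT => //.
    by apply: measurable_fun_ler => //; exact: measurableT_comp.
  by apply: measurableT_comp => //; apply: continuous_measurable_fun; exact: continuous_clip.
have iu2 : leb.-integrable setT (fun x => (u x ^+ 2)%:E).
  apply/integrableP; split; first by apply/measurable_EFinP; exact: measurable_funX.
  by under eq_integral do rewrite gee0_abs ?lee_fin ?sqr_ge0//.
have : (\int[leb]_x ((u x - v n x) ^+ 2)%:E @[n --> \oo] --> 0)%E.
  have lim := @dominated_cvg _ _ _ leb setT measurableT
    (fun n x => ((u x - v n x) ^+ 2)%:E) (cst 0%E) (fun x => (u x ^+ 2)%:E).
  rewrite -[X in _ --> X](integral0 leb setT); apply: lim => //.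
  - move=> n; apply/measurable_EFinP; apply: measurable_funX.
    by apply: measurable_funB; [exact: mu|exact: mv].
  - move=> x _; apply: cvg_near_cst; near=> n.
    rewrite /v ifT; last first.
      near: n; exists (Num.trunc `|x|).+1 => // n /= xn.
      by rewrite ltW// (lt_le_trans (truncnS_gt _))// ler_nat.
    rewrite clip_id ?subrr ?expr0n//.
    near: n; exists (Num.trunc `|u x|).+1 => // n /= xn.
    by rewrite ltW// (lt_le_trans (truncnS_gt _))// ler_nat.
  - move=> n x _; rewrite gee0_abs ?lee_fin ?sqr_ge0//.
    rewrite -real_normK ?num_real// -[leRHS]real_normK ?num_real//.
    rewrite lerXn2r ?nnegrE// /v; case: ifPn => _; last by rewrite subr0.
    exact: clip_shrink.
move=> /(cvge0P _).1 H.
have [k _ kP] : \forall n \near \oo, (\int[leb]_x ((u x - v n x) ^+ 2)%:E <= (e / 4)%:E)%E.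
  apply: H; first by move=> n; apply: integral_ge0 => x _; rewrite lee_fin sqr_ge0.
  by rewrite divr_gt0.
have {kP}uv := kP k (leqnn k).
pose E := `[- (k%:R + 1), k%:R + 1]%classic : set R.
have mE : measurable E by exact: measurable_itv.
have Efin : (leb E < +oo)%E.
  rewrite [X in (X < _)%E](_ : _ = lebesgue_measure E)// lebesgue_measure_itv /=.
  by case: ifP => _; rewrite ?ltry// -EFinB ltry.
have ivE : leb.-integrable E (EFin \o v k).
  apply: measurable_bounded_integrable => //; first exact: (measurable_funTS (mv k)).
  exists k%:R; split; first exact: num_real.
  move=> y yk x _ /=; rewrite (le_trans _ (ltW yk))// /v; case: ifPn => _.
    exact: clip_bound.
  by rewrite normr0.
have [g_ [cg_ _]] := approximation_continuous_integrable mE Efin ivE.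
move=> /(cvge0P _).1 Hg.
have [j _ jP] : \forall n \near \oo,
    (\int[leb]_(z in E) `|(v k z - g_ n z)%:E| <= (e / (8 * (k%:R + 1)))%:E)%E.
  apply: Hg; first by move=> n; apply: integral_ge0.
  by rewrite divr_gt0// mulr_gt0// ltr_wpDl.
have {jP}vg := jP j (leqnn j).
pose g x := plateau k%:R x * clip k%:R (g_ j x).
have cg : continuous g.
  move=> x; apply: cvgM; first exact: continuous_plateau.
  apply: (continuous_comp (f := g_ j)); [exact: cg_|exact: continuous_clip].
have mg : measurable_fun setT g := continuous_measurable_fun cg.
have gk x : `|g x| <= k%:R.
  rewrite normrM -[leRHS]mul1r ler_pM//; last exact: clip_bound.
  by rewrite ger0_norm ?plateau_ge0// plateau_le1.
exists g, k%:R, (k%:R + 1); split => //.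
  by move=> x kx; rewrite /g plateau0// mul0r.
have vgE x : (v k x - g x) ^+ 2 <= 2 * k%:R * (\1_E x * `|v k x - g_ j x|).
  have [xE|xE] := boolP (x \in E); last first.
    have kx : k%:R + 1 < `|x|.
      by move: xE; rewrite notin_setE /E /= in_itv /= -ler_norml => /negP; rewrite -ltNge.
    rewrite /v ifN -?ltNge; last by lra.
    rewrite /g plateau0 ?mul0r ?subr0 ?expr0n /=; last exact: ltW.
    by apply: mulr_ge0; [exact: mulr_ge0|rewrite indicE mulr_ge0].
  rewrite indicE xE mul1r.
  have vk : `|v k x| <= k%:R.
    by rewrite /v; case: ifPn => _; [exact: clip_bound|rewrite normr0].
  have d1 : `|v k x - g x| <= `|v k x - g_ j x|.
    rewrite /g; have [xk|xk] := leP `|x| k%:R.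
      by rewrite plateau1// mul1r clip_dist.
    have v0 : v k x = 0 by rewrite /v ifN// -ltNge.
    rewrite v0 !sub0r !normrN normrM.
    have := @clip_dist _ k%:R 0 (g_ j x); rewrite !sub0r !normrN normr0.
    move=> /(_ (ler0n _ _) (ler0n _ _)) h.
    by rewrite -[leRHS]mul1r ler_pM// ger0_norm ?plateau_ge0// plateau_le1.
  rewrite -real_normK ?num_real// expr2 ler_pM//.
  by rewrite (le_trans (ler_normB _ _))// mulr_natl mulr2n lerD.
have mvg : measurable_fun setT (fun x => v k x - g_ j x).
  by apply: measurable_funB => //; exact: continuous_measurable_fun.
have vg2 : (\int[leb]_x ((v k x - g x) ^+ 2)%:E <= (e / 4)%:E)%E.
  apply: (@le_trans _ _ (\int[leb]_x ((2 * k%:R)%:E * (\1_E x * `|v k x - g_ j x|)%:E))%E).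
    apply: ge0_le_integral => //.
    - by move=> x _; rewrite lee_fin sqr_ge0.
    - apply/measurable_EFinP; apply: measurable_funX.
      by apply: measurable_funB; [exact: mv|exact: mg].
    - apply: measurable_funeM; apply/measurable_EFinP; apply: measurable_funM.
        exact: measurable_indic.
      exact: measurableT_comp.
    - by move=> x _; rewrite -EFinM lee_fin; exact: vgE.
  rewrite ge0_integralZl//; last first.
    apply/measurable_EFinP; apply: measurable_funM; first exact: measurable_indic.
    exact: measurableT_comp.
  rewrite (_ : (\int[leb]_x _)%E = (\int[leb]_(z in E) `|(v k z - g_ j z)%:E|)%E); last first.
    rewrite [RHS]integral_mkcond; apply: eq_integral => x _.
    by rewrite /patch indicE; case: ifPn => _; rewrite ?mul1r ?mul0r.
  apply: (@le_trans _ _ ((2 * k%:R)%:E * (e / (8 * (k%:R + 1)))%:E)%E).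
    by apply: lee_wpmul2l => //; rewrite lee_fin mulr_ge0.
  rewrite -EFinM lee_fin.
  rewrite mulrA ler_pdivrMr ?mulr_gt0 ?ltr_wpDl//.
  have k0 : 0 <= k%:R :> R by []; nra.
have m1 : measurable_fun setT (fun x => ((u x - v k x) ^+ 2)%:E).
  apply/measurable_EFinP; apply: measurable_funX.
  by apply: measurable_funB; [exact: mu|exact: mv].
have m2 : measurable_fun setT (fun x => ((v k x - g x) ^+ 2)%:E).
  apply/measurable_EFinP; apply: measurable_funX.
  by apply: measurable_funB; [exact: mv|exact: mg].
apply: (@le_trans _ _ (\int[leb]_x (2%:E * ((u x - v k x) ^+ 2)%:E +
    2%:E * ((v k x - g x) ^+ 2)%:E))%E).
  apply: ge0_le_integral => //.
  - by move=> x _; rewrite lee_fin sqr_ge0.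
  - apply/measurable_EFinP; apply: measurable_funX.
    by apply: measurable_funB; [exact: mu|exact: mg].
  - by apply: emeasurable_funD; exact: measurable_funeM.
  - move=> x _; rewrite -!EFinM -EFinD lee_fin.
    have := sqr_ge0 ((u x - v k x) - (v k x - g x)); rewrite !expr2; nra.
rewrite ge0_integralD//; last 4 first.
- by move=> x _; rewrite mule_ge0// lee_fin sqr_ge0.
- exact: measurable_funeM.
- by move=> x _; rewrite mule_ge0// lee_fin sqr_ge0.
- exact: measurable_funeM.
rewrite !ge0_integralZl//; last 2 first.
- by move=> x _; rewrite lee_fin sqr_ge0.
- by move=> x _; rewrite lee_fin sqr_ge0.
apply: (@le_trans _ _ (2%:E * (e / 4)%:E + 2%:E * (e / 4)%:E)%E).
  by apply: leeD; rewrite lee_pmul2l.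
by rewrite -!EFinM -EFinD lee_fin; lra.
Unshelve. all: end_near. Qed.

(** Averages of translates are controlled by the [L^2] norm, so that [u] can be
    replaced by a continuous function of compact support; for such a function,
    convergence is dominated. *)
Lemma gap_cvg u : measurable_fun setT u -> (\int[leb]_x (u x ^+ 2)%:E < +oo)%E ->
  gap u (harmonic n) @[n --> \oo] --> 0%E.
Proof.
move=> mu u2; apply/cvge0P => [n|e e0]; first exact: gap_ge0.
pose c : R := 16 * (Num.sqrt pi + 1).
have sp : 0 <= Num.sqrt pi :> R := sqrtr_ge0 _.
have c0 : 0 < c by rewrite /c; lra.
have [|g [m [l [cg gm gl l0 ug]]]] := @L2_dense u (e / c) mu u2; first by rewrite divr_gt0.
have mg : measurable_fun setT g := continuous_measurable_fun cg.
have /cvge0P lim := gap_cvg_continuous cg gm gl l0.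
have {}lim := lim (fun n => gap_ge0 g (harmonic n)) (e / 4).
have := lim ltac:(by rewrite divr_gt0); apply: filterS => n gn.
apply: (le_trans (gapD (harmonic n) mu mg)).
have mug : measurable_fun setT (fun x => u x - g x) by exact: measurable_funB.
apply: (@le_trans _ _ (2%:E * (e / 4)%:E + 2%:E * (4 * Num.sqrt pi * (e / c))%:E)%E).
  apply: leeD; rewrite lee_pmul2l//.
  apply: (le_trans (gap_le (harmonic n) mug)); rewrite [leRHS]EFinM.
  exact: lee_wpmul2l.
rewrite -!EFinM -EFinD lee_fin.
have ec : 0 < e / c by rewrite divr_gt0.
have -> : e = c * (e / c) by rewrite mulrC divfK ?gt_eqF.
set t := (c * (e / c) / c); have -> : t = e / c by rewrite /t mulrAC divff ?mul1r ?gt_eqF.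
rewrite /c; set s := Num.sqrt pi in sp *; set w := e / _ in ec *; nra.
Qed.

End translation_gap.

(** * Plancherel's theorem on the line *)

Section conjugate.
Context {R : realType}.

Lemma Re_conjc (z : R[i]) : complex.Re (conjc z) = complex.Re z.
Proof. by case: z. Qed.

Lemma Im_conjc (z : R[i]) : complex.Im (conjc z) = - complex.Im z.
Proof. by case: z. Qed.

Lemma conjc_mul (x y : R[i]) : conjc (x * y) = conjc x * conjc y.
Proof. by apply: complex_ext; rewrite ?Re_conjc ?Im_conjc !ReImE !Re_conjc !Im_conjc; ring. Qed.

Lemma normc_conjc (z : R[i]) :
  ComplexField.Normc.normc (conjc z) = ComplexField.Normc.normc z.
Proof. by rewrite !normcE /sqn Re_conjc Im_conjc sqrrN. Qed.

Lemma mulcJ_sqn (z : R[i]) : z * conjc z = (sqn z)%:C.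
Proof. by case: z => a b; apply: complex_ext; rewrite !ReImE /sqn /=; ring. Qed.

Lemma conjc_chi (t : R) : conjc (chi t) = chi (- t).
Proof.
by rewrite !chiE cosN sinN; apply: complex_ext => /=.
Qed.

Lemma cmeas_conjc d (T : measurableType d) (f : T -> R[i]) :
  cmeas f -> cmeas (fun x => conjc (f x)).
Proof.
move=> [f1 f2]; split; first by under eq_fun do rewrite Re_conjc.
by under eq_fun do rewrite Im_conjc; exact: measurableT_comp.
Qed.

Lemma cintegrable_conjc d (T : measurableType d) (mu : {measure set T -> \bar R})
  (f : T -> R[i]) : cintegrable mu f -> cintegrable mu (fun x => conjc (f x)).
Proof.
move=> intf; apply: (cintegrable_dominated _ intf).
  exact/cmeas_conjc/(cintegrable_cmeas intf).
by move=> x; rewrite normc_conjc.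
Qed.

Lemma cint_conjc d (T : measurableType d) (mu : {measure set T -> \bar R})
  (f : T -> R[i]) : cintegrable mu f ->
  cint mu (fun x => conjc (f x)) = conjc (cint mu f).
Proof.
move=> [f1 f2]; apply: complex_ext; rewrite ?Re_conjc ?Im_conjc /=.
  by apply: eq_Rintegral => x _; rewrite Re_conjc.
rewrite -[RHS]mulN1r -RintegralZl//.
by apply: eq_Rintegral => x _; rewrite Im_conjc mulN1r.
Qed.

Lemma qexp_real (a x : R) : qexp a%:C 0 x = (expR (a * x ^+ 2))%:C.
Proof.
rewrite qexp.unlock (_ : _ + _ = (a * x ^+ 2)%:C); last by rewrite rmorphM; ring.
by rewrite /cexp /= cos0 sin0; apply: complex_ext; rewrite !ReImE /=; ring.
Qed.

End conjugate.

Section plancherel.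
Context {R : realType}.
Local Notation leb := (@leb R).

Definition fourier (f : R -> R[i]) (s : R) : R[i] :=
  cint leb (fun x => f x * chi (s * x)).

Lemma shift_integral (h : R) (F : measurableTypeR R * measurableTypeR R -> \bar R) :
  0 < h -> measurable_fun setT F -> (forall z, 0 <= F z)%E ->
  (\int[leb \X leb]_z F z = h%:E * \int[leb \X leb]_z F (z.1, z.1 - h * z.2)%R)%E.
Proof.
move=> h0 mF F0.
have m : measurable_fun setT (fun z : measurableTypeR R * measurableTypeR R =>
    (z.1, z.1 - h * z.2 : measurableTypeR R)).
  by apply: measurable_fun_pair => //; exact: measurable_shift.
have mG := measurableT_comp mF m.
rewrite !tonelli1// -ge0_integralZl//; last 3 first.
- exact: (measurable_tonelli1 leb mG (fun=> F0 _)).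
- by move=> x _; apply: integral_ge0 => y _.
- by rewrite lee_fin ltW.
apply: eq_integral => x _.
rewrite -(@lebesgue_affine _ (- h) x (fun y => F (x, y)))//; last 2 first.
- by rewrite oppr_eq0 gt_eqF.
- exact: (measurableT_comp mF (measurable_pair1 x)).
rewrite normrN gtr0_norm//; congr (_ * _)%E; apply: eq_integral => y _ /=.
by congr (F (_, _)); ring.
Qed.

Variable f : R -> R[i].
Hypothesis intf : cintegrable leb f.
Hypothesis Ef : (energy leb f < +oo)%E.

Let mf : cmeas f := cintegrable_cmeas intf.

Lemma cmeas_fourier : cmeas (fourier f).
Proof.
apply: (@cmeas_cint R _ _ (measurableTypeR R) (measurableTypeR R) leb
  (fun z => f z.2 * chi (z.1 * z.2))).
apply: cmeasM; first exact: cmeas_comp.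
by apply: cmeas_chi_comp; exact: measurable_funM.
Qed.

Section regularization.
Variables (h : R) (h0 : 0 < h).

Let e : R := h ^+ 2 / 4.
Let e0 : 0 < e. Proof. by rewrite divr_gt0// exprn_gt0. Qed.
Let q : R -> R[i] := qexp (- e)%:C 0.
(** The Fourier transform of [q], an approximation of unity as [h] tends to 0. *)
Let K (t : R) : R := 2 * Num.sqrt pi / h * expR (- (t / h) ^+ 2).

Let intq : cintegrable leb q.
Proof. by apply: cintegrable_qexp; rewrite /= oppr_lt0. Qed.

Let cintq : cint leb q = (2 * Num.sqrt pi / h)%:C.
Proof.
have -> : q = fun x => (expR (- (e * x ^+ 2)))%:C.
  by apply/funext => x; rewrite /q qexp_real mulNr.
rewrite cint_real /Rintegral gauss_integral//=; congr _%:C.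
rewrite sqrtrM ?pi_ge0// /e invf_div.
rewrite sqrtrM// (_ : 4 = 2 ^+ 2 :> R); last by rewrite expr2; ring.
rewrite sqrtr_sqr ger0_norm// sqrtrV ?sqr_ge0// sqrtr_sqr ger0_norm ?ltW//.
by field; rewrite gt_eqF.
Qed.

Let fourierq (t : R) : cint leb (fun s => q s * chi (s * t)) = (K t)%:C.
Proof.
under eq_fun do rewrite [_ * t]mulrC.
rewrite fourier_qexp; last by rewrite /= oppr_lt0.
rewrite cintq mulr0 mul0r.
have -> : (4%:R * (- e)%:C)^-1 = (- (h ^- 2))%:C :> R[i].
  rewrite -[4%:R in LHS]/(4%:R : R[i]).
  have -> : 4%:R = (4 : R)%:C :> R[i] by rewrite rmorph_nat.
  rewrite -rmorphM -fmorphV; congr _%:C; rewrite /e; field.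
  by rewrite gt_eqF.
rewrite qexp_real -rmorphM; congr _%:C; rewrite /K; congr (_ * expR _).
by field; rewrite gt_eqF.
Qed.

(* the integrand of [\int |f^|^2 q], written as a triple integral *)
Let G (z : R * (R * R)) : R[i] :=
  q z.1 * (f z.2.1 * conjc (f z.2.2) * chi (z.1 * (z.2.1 - z.2.2))).

Let intG : cintegrable (leb \X (leb \X leb)) G.
Proof.
have i1 := cintegrable_tensor intq (cintegrable_tensor intf (cintegrable_conjc intf)).
apply: (cintegrable_dominated _ i1).
  apply: cmeasM; first exact: (cmeas_comp (cintegrable_cmeas intq)).
  apply: cmeasM.
    apply: cmeasM; first exact: (cmeas_comp mf (measurableT_comp measurable_fst measurable_snd)).
    exact: (cmeas_comp (cmeas_conjc mf) (measurableT_comp measurable_snd measurable_snd)).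
  apply: cmeas_chi_comp.
  apply: measurable_funM => //; apply: measurable_funB; exact: measurableT_comp.
move=> z; have -> : G z = q z.1 * (f z.2.1 * conjc (f z.2.2)) *
  chi (z.1 * (z.2.1 - z.2.2)) by rewrite /G !mulrA.
by rewrite ComplexField.Normc.normcM normc_chi mulr1.
Qed.

Let fourier_sqn (s : R) : cint (leb \X leb) (fun w => f w.1 * conjc (f w.2) * chi (s * (w.1 - w.2))) =
  (sqn (fourier f s))%:C.
Proof.
have intfs := cintegrable_chi intf (@measurable_id _ _ _) s.
rewrite -mulcJ_sqn /fourier -cint_conjc//.
rewrite -(cint_tensor intfs (cintegrable_conjc intfs)).
congr (cint _ _); apply/funext => w /=.
rewrite mulrBr chiD conjc_mul conjc_chi; ring.
Qed.

Let integral_xi_inner s : cint (leb \X leb) (fun w => G (s, w)) =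
  (expR (- (e * s ^+ 2)) * sqn (fourier f s))%:C.
Proof.
rewrite rmorphM /= -fourier_sqn -mulNr -qexp_real -/q -cintZ//.
have i1 := cintegrable_tensor intf (cintegrable_conjc intf).
apply: (cintegrable_dominated _ i1).
  apply: cmeasM; first exact: cintegrable_cmeas i1.
  apply: cmeas_chi_comp.
  by apply: measurable_funM => //; exact: measurable_funB.
by move=> z; rewrite !ComplexField.Normc.normcM normc_chi mulr1.
Qed.

Let integral_xi : cint (leb \X (leb \X leb)) G =
  (\int[leb]_s (expR (- (e * s ^+ 2)) * sqn (fourier f s)))%:C.
Proof.
rewrite cint_fubini// -(cint_real leb); congr (cint leb _); apply/funext => s.
exact: integral_xi_inner.
Qed.

Let Phi (z : R * R) : R := complex.Re (f z.1 * conjc (f z.2)) * K (z.1 - z.2).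

Let mK : measurable_fun setT (fun z : measurableTypeR R * measurableTypeR R => K (z.1 - z.2)).
Proof.
apply: measurable_funM; first exact: measurable_cst.
apply: measurableT_comp => //; apply: measurableT_comp => //; apply: measurable_funX.
by apply: measurable_funM; [exact: measurable_funB|exact: measurable_cst].
Qed.

Let integral_xy : (leb \X leb).-integrable setT (EFin \o Phi) /\
  cint (leb \X (leb \X leb)) G = cint (leb \X leb) (fun z => f z.1 * conjc (f z.2) * (K (z.1 - z.2))%:C).
Proof.
have sw := mpres_swap leb (leb \X leb).
have mGs := cintegrable_cmeas intG.
pose Gs (z : R * R * R) := G (z.2, z.1).
have mGs' : cmeas Gs.
  by apply: (cmeas_comp mGs); exact: measurable_fun_pair.
have intGs : cintegrable ((leb \X leb) \X leb) Gs.
  apply: (mpres_cintegrable sw mGs').1.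
  have -> : (fun x => Gs (x.2, x.1)) = G by apply/funext => -[].
  exact: intG.
have inner z : cint leb (fun s => Gs (z, s)) = f z.1 * conjc (f z.2) * (K (z.1 - z.2))%:C.
  rewrite -fourierq -cintZ.
    congr (cint leb _); apply/funext => s; rewrite /Gs /G /=; ring.
  apply: (cintegrable_dominated _ intq).
    apply: cmeasM; first exact: (cintegrable_cmeas intq).
    by apply: cmeas_chi_comp; apply: measurable_funM => //; exact: measurable_cst.
  by move=> s; rewrite !ComplexField.Normc.normcM normc_chi mulr1.
have E : (fun z => cint leb (fun s => Gs (z, s))) =
    (fun z => f z.1 * conjc (f z.2) * (K (z.1 - z.2))%:C).
  by apply/funext => z; exact: inner.
split.
  have [+ _] : cintegrable (leb \X leb) (fun z => f z.1 * conjc (f z.2) * (K (z.1 - z.2))%:C).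
    by rewrite -E; exact: cintegrable_fubini.
  by under eq_fun do rewrite ReM /= mulr0 subr0.
rewrite -E -(cint_fubini intGs) -(mpres_cint sw mGs').
by congr (cint _ _); apply/funext => -[].
Qed.

Let u x := complex.Re (f x).
Let v x := complex.Im (f x).
Let mu : measurable_fun setT u := mf.1.
Let mv : measurable_fun setT v := mf.2.

Let Q (z : R * R) : R := sqn (f z.1) * K (z.1 - z.2).
Let Q' (z : R * R) : R := sqn (f z.2) * K (z.1 - z.2).
Let Psi (z : R * R) : R := sqn (f z.1 - f z.2) * K (z.1 - z.2).

Lemma K_ge0 t : 0 <= K t.
Proof.
apply: mulr_ge0; last exact: expR_ge0.
by apply: divr_ge0; [exact: mulr_ge0|exact: ltW].
Qed.

Let K_shift (x y : R) : K (x - (x - h * y)) = 2 * Num.sqrt pi / h * expR (- y ^+ 2).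
Proof. by rewrite /K; congr (_ * expR (- _ ^+ 2)); field; rewrite gt_eqF. Qed.

(* the substitution [y := x - h k] turns integrals against [K] into Gaussian averages *)
Let average (F : R * R -> R) : measurable_fun setT F -> (forall z, 0 <= F z) ->
  (\int[leb \X leb]_z (F z * K (z.1 - z.2))%:E = (2 * Num.sqrt pi)%:E *
   \int[leb \X leb]_z (F (z.1, z.1 - h * z.2)%R * expR (- z.2 ^+ 2))%:E)%E.
Proof.
move=> mF F0; rewrite (shift_integral h0); last 2 first.
- by apply/measurable_EFinP; exact: measurable_funM.
- by move=> z; rewrite lee_fin mulr_ge0// K_ge0.
under eq_integral do rewrite /= K_shift mulrCA EFinM.
have mG : measurable_fun setT (fun z : measurableTypeR R * measurableTypeR R =>
    F (z.1, z.1 - h * z.2) * expR (- z.2 ^+ 2)).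
  apply: measurable_funM measurable_expRN2; apply: (measurableT_comp mF).
  by apply: measurable_fun_pair => //; exact: measurable_shift.
rewrite ge0_integralZl//; last 3 first.
- exact/measurable_EFinP.
- by move=> z _; rewrite lee_fin mulr_ge0// expR_ge0.
- by rewrite lee_fin; apply: divr_ge0; [exact: mulr_ge0|exact: ltW].
rewrite muleA -EFinM; congr (_%:E * _)%E.
by field; rewrite gt_eqF.
Qed.

Let energyE : energy leb f = (\int[leb]_x (u x ^+ 2)%:E + \int[leb]_x (v x ^+ 2)%:E)%E.
Proof.
rewrite -ge0_integralD//.
- by move=> x _; rewrite lee_fin sqr_ge0.
- by apply/measurable_EFinP; exact: measurable_funX.
- by move=> x _; rewrite lee_fin sqr_ge0.
- by apply/measurable_EFinP; exact: measurable_funX.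
Qed.

Let integral_Q : (\int[leb \X leb]_z (Q z)%:E = pi%:E * 2%:E * energy leb f)%E.
Proof.
rewrite average; last 2 first.
- by apply: measurable_sqn; apply: (cmeas_comp mf).
- by move=> z; exact: sqn_ge0.
rewrite /sqn /=; under eq_integral do rewrite mulrDl EFinD.
rewrite ge0_integralD//; last 4 first.
- by move=> z _; rewrite lee_fin mulr_ge0 ?sqr_ge0 ?expR_ge0.
- by apply/measurable_EFinP; exact: measurable_fst_sq mu.
- by move=> z _; rewrite lee_fin mulr_ge0 ?sqr_ge0 ?expR_ge0.
- by apply/measurable_EFinP; exact: measurable_fst_sq mv.
rewrite (integral_fst_sq mu) (integral_fst_sq mv) -ge0_muleDr; last 2 first.
- by apply: integral_ge0 => x _; rewrite lee_fin sqr_ge0.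
- by apply: integral_ge0 => x _; rewrite lee_fin sqr_ge0.
rewrite -energyE muleA -!EFinM; congr (_%:E * _)%E.
by rewrite -mulrA -expr2 sqr_sqrtr ?pi_ge0// mulrC.
Qed.

Let integral_Q' : (\int[leb \X leb]_z (Q' z)%:E = pi%:E * 2%:E * energy leb f)%E.
Proof.
rewrite (average (F := fun z => sqn (f z.2))); last 2 first.
- by apply: measurable_sqn; apply: (cmeas_comp mf).
- by move=> z; exact: sqn_ge0.
rewrite /sqn /=; under eq_integral do rewrite mulrDl EFinD.
rewrite ge0_integralD//; last 4 first.
- by move=> z _; rewrite lee_fin mulr_ge0 ?sqr_ge0 ?expR_ge0.
- by apply/measurable_EFinP; exact: (measurable_shift_sq h mu).
- by move=> z _; rewrite lee_fin mulr_ge0 ?sqr_ge0 ?expR_ge0.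
- by apply/measurable_EFinP; exact: (measurable_shift_sq h mv).
rewrite (integral_shift_sq h mu) (integral_shift_sq h mv) -ge0_muleDr; last 2 first.
- by apply: integral_ge0 => x _; rewrite lee_fin sqr_ge0.
- by apply: integral_ge0 => x _; rewrite lee_fin sqr_ge0.
rewrite -energyE muleA -!EFinM; congr (_%:E * _)%E.
by rewrite -mulrA -expr2 sqr_sqrtr ?pi_ge0// mulrC.
Qed.

Let integral_Psi : (\int[leb \X leb]_z (Psi z)%:E =
  (2 * Num.sqrt pi)%:E * (gap u h + gap v h))%E.
Proof.
rewrite (average (F := fun z => sqn (f z.1 - f z.2))); last 2 first.
- by apply: measurable_sqn; apply: cmeasB; apply: (cmeas_comp mf).
- by move=> z; exact: sqn_ge0.
congr (_ * _)%E; rewrite -ge0_integralD//; last 4 first.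
- by move=> z _; rewrite lee_fin mulr_ge0 ?sqr_ge0 ?expR_ge0.
- by apply/measurable_EFinP; exact: (measurable_gap h mu).
- by move=> z _; rewrite lee_fin mulr_ge0 ?sqr_ge0 ?expR_ge0.
- by apply/measurable_EFinP; exact: (measurable_gap h mv).
by apply: eq_integral => z _; rewrite -EFinD -mulrDl /sqn !ReImE.
Qed.

(** Both sides come from [2 Re (f x * conj (f y)) = |f x|^2 + |f y|^2 -
    |f x - f y|^2], integrated against the transform of the Gaussian weight. *)
Lemma regularized_plancherel :
  (\int[leb]_s (expR (- (e * s ^+ 2)) * sqn (fourier f s))%:E +
    (Num.sqrt pi)%:E * (gap u h + gap v h) = (2 * pi)%:E * energy leb f)%E.
Proof.
have [iPhi GE] := integral_xy.
have Efin : energy leb f \is a fin_num by rewrite ge0_fin_numE ?energy_ge0.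
have mQ : measurable_fun setT Q.
  by apply: measurable_funM => //; apply: measurable_sqn; apply: (cmeas_comp mf).
have mQ' : measurable_fun setT Q'.
  by apply: measurable_funM => //; apply: measurable_sqn; apply: (cmeas_comp mf).
have mPsi : measurable_fun setT Psi.
  apply: measurable_funM => //; apply: measurable_sqn.
  by apply: cmeasB; apply: (cmeas_comp mf).
have Q0 z : 0 <= Q z by apply: mulr_ge0; [exact: sqn_ge0|exact: K_ge0].
have Q'0 z : 0 <= Q' z by apply: mulr_ge0; [exact: sqn_ge0|exact: K_ge0].
have Psi0 z : 0 <= Psi z by apply: mulr_ge0; [exact: sqn_ge0|exact: K_ge0].
have iQ : (leb \X leb).-integrable setT (EFin \o Q).
  apply/integrableP; split; first exact/measurable_EFinP.
  under eq_integral do rewrite gee0_abs ?lee_fin//.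
  by rewrite [X in (X < _)%E]integral_Q -EFinM -(fineK Efin) -EFinM ltry.
have iQ' : (leb \X leb).-integrable setT (EFin \o Q').
  apply/integrableP; split; first exact/measurable_EFinP.
  under eq_integral do rewrite gee0_abs ?lee_fin//.
  by rewrite [X in (X < _)%E]integral_Q' -EFinM -(fineK Efin) -EFinM ltry.
have PsiE z : Psi z = Q z + Q' z - 2 * Phi z.
  rewrite /Psi /Q /Q' /Phi /sqn !ReImE Re_conjc Im_conjc; ring.
have I0 : (0 <= \int[leb]_s (expR (- (e * s ^+ 2)) * sqn (fourier f s))%:E)%E.
  by apply: integral_ge0 => s _; rewrite lee_fin mulr_ge0 ?sqn_ge0 ?expR_ge0.
have IE : \int[leb]_s (expR (- (e * s ^+ 2)) * sqn (fourier f s)) =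
    \int[leb \X leb]_z Phi z.
  have := integral_xi; rewrite GE => /(congr1 (@complex.Re R)) /= <-.
  by apply: eq_Rintegral => z _; rewrite ReM /= mulr0 subr0.
have rE s : cint (leb \X leb) (fun w => G (s, w)) =
    (expR (- (e * s ^+ 2)) * sqn (fourier f s))%:C.
  exact: integral_xi_inner.
have Ifin : (\int[leb]_s (expR (- (e * s ^+ 2)) * sqn (fourier f s))%:E)%E \is a fin_num.
  have [+ _] := cintegrable_fubini intG.
  under eq_fun do rewrite rE.
  by move=> /integrable_fin_num; exact.
have iPsi : (leb \X leb).-integrable setT (EFin \o Psi).
  have := integrableB measurableT (integrableD measurableT iQ iQ') (integrableZl measurableT 2 iPhi).
  by congr (_.-integrable _ _); apply/funext => z; rewrite /= PsiE.
have Q2 : (2%:E * \int[leb \X leb]_z (Phi z)%:E + \int[leb \X leb]_z (Psi z)%:E =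
    \int[leb \X leb]_z (Q z)%:E + \int[leb \X leb]_z (Q' z)%:E)%E.
  rewrite -integralZl// -!integralD//.
    by apply: eq_integral => z _; rewrite -EFinM -!EFinD PsiE; congr EFin; ring.
  exact: integrableZl.
have PhiE : (\int[leb \X leb]_z (Phi z)%:E)%E =
    (\int[leb]_s (expR (- (e * s ^+ 2)) * sqn (fourier f s))%:E)%E.
  rewrite -[RHS](fineK Ifin) -[LHS]fineK; first by congr EFin; rewrite -[LHS]IE.
  exact: integrable_fin_num.
move: Q2; rewrite PhiE integral_Q integral_Q' integral_Psi.
set I := (\int[leb]_s _)%E in I0 Ifin *.
have : (0 <= gap u h + gap v h)%E by rewrite adde_ge0 ?gap_ge0.
set g := (gap u h + gap v h)%E => g0.
have E0 := energy_ge0 leb f.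
rewrite -(fineK Ifin) -(fineK Efin).
case: g g0 => [r r0|_|//].
  rewrite -!EFinM -!EFinD => -[] H; congr EFin; lra.
by rewrite gt0_muley ?lte_fin ?mulr_gt0 ?sqrtr_gt0 ?pi_gt0// -!EFinM.
Qed.

End regularization.

(** The regularized identity as the width of the weight tends to infinity:
    the defect tends to 0 by continuity of translations in mean square. *)
Theorem plancherel : energy leb (fourier f) = ((2 * pi)%:E * energy leb f)%E.
Proof.
pose g n (s : R) := (expR (- (harmonic n ^+ 2 / 4 * s ^+ 2)) * sqn (fourier f s))%:E.
have hn n : 0 < harmonic n :> R by rewrite /harmonic invr_gt0.
have mE := measurable_sqn cmeas_fourier.
have mg n : measurable_fun setT (g n).
  apply/measurable_EFinP; apply: measurable_funM => //.
  apply: measurableT_comp => //; apply: measurableT_comp => //.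
  by apply: measurable_funM; [exact: measurable_cst|exact: measurable_funX].
have g0 n s : (0 <= g n s)%E by rewrite lee_fin mulr_ge0 ?sqn_ge0 ?expR_ge0.
have nd s : {homo g ^~ s : n m / (n <= m)%N >-> (n <= m)%E}.
  move=> n m nm; rewrite lee_fin ler_wpM2r ?sqn_ge0// ler_expR lerN2.
  rewrite ler_wpM2r ?sqr_ge0// ler_pM2r ?invr_gt0//.
  apply: lerXn2r; rewrite ?nnegrE; [exact: ltW|exact: ltW|].
  by rewrite /harmonic lef_pV2 ?posrE// ler_nat.
have lim1 : (\int[leb]_s g n s @[n --> \oo] --> energy leb (fourier f))%E.
  have := @cvg_monotone_convergence _ _ _ leb _ measurableT _ mg
    (fun n s _ => g0 n s) (fun s _ => nd s).
  rewrite [X in _ --> X -> _](_ : _ = energy leb (fourier f))//.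
  apply: eq_integral => s _; apply/cvg_lim => //.
  apply: cvg_EFin; first exact: nearW.
  rewrite -[X in _ --> X]mul1r; apply: cvgMl; rewrite -[X in _ --> X](@expR0 R).
  apply: continuous_cvg; first exact: continuous_expR.
  rewrite -[X in _ --> X]oppr0; apply: cvgN.
  rewrite -[X in _ --> X](mul0r (s ^+ 2)); apply: cvgMl.
  rewrite -[X in _ --> X](mul0r 4^-1); apply: cvgMl.
  rewrite -[X in _ --> X](mulr0 0); under eq_fun do rewrite expr2.
  by apply: cvgM; exact: cvg_harmonic.
pose b n := ((Num.sqrt pi)%:E * (gap (fun x => complex.Re (f x)) (harmonic n) +
  gap (fun x => complex.Im (f x)) (harmonic n)))%E.
have fin (r : R[i] -> R) : measurable_fun setT (fun x => r (f x)) ->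
    (forall z, r z ^+ 2 <= sqn z) -> (\int[leb]_x (r (f x) ^+ 2)%:E < +oo)%E.
  move=> mr rz; apply: le_lt_trans Ef; apply: ge0_le_integral => //.
  - by move=> x _; rewrite lee_fin sqr_ge0.
  - by apply/measurable_EFinP; exact: measurable_funX.
  - exact: measurable_sqn_EFin.
  - by move=> x _; rewrite lee_fin.
have lim2 : b n @[n --> \oo] --> 0%E.
  rewrite -(mule0 (Num.sqrt pi)%:E); apply: cvgeZl => //.
  rewrite -(adde0 0%E); apply: cvgeD => //; apply: gap_cvg.
  - exact: mf.1.
  - by apply: fin => [|z]; [exact: mf.1|rewrite /sqn lerDl sqr_ge0].
  - exact: mf.2.
  - by apply: fin => [|z]; [exact: mf.2|rewrite /sqn lerDr sqr_ge0].
have lim3 : (\int[leb]_s g n s + b n @[n --> \oo] --> energy leb (fourier f) + 0)%E.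
  by apply: cvgeD => //; rewrite fin_num_adde_defl.
move: lim3; rewrite adde0 (_ : (fun n => _) = cst ((2 * pi)%:E * energy leb f)%E).
  by move=> lim3; apply: (cvg_unique _ lim3); [exact: ereal_hausdorff|exact: cvg_cst].
by apply/funext => n; exact: regularized_plancherel.
Qed.

End plancherel.

(** * Plancherel pairs *)

Section plancherel_pair.
Context {R : realType}.

Lemma measurable_fun2 d1 d2 d3 (X : measurableType d1) (Y : measurableType d2)
    (Z : measurableType d3) (w : X -> Y -> R) (a : Z -> X) (b : Z -> Y) :
  measurable_fun setT (fun z : X * Y => w z.1 z.2) ->
  measurable_fun setT a -> measurable_fun setT b ->
  measurable_fun setT (fun z => w (a z) (b z)).
Proof.
by move=> mw ma mb; exact: (measurableT_comp mw (measurable_fun_pair ma mb)).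
Qed.

(** [th] is the phase of a Fourier transform from functions on [S] to
    functions on [S'], which multiplies squared [L^2] norms by [c]. *)
Definition plancherel_pair d d' (S : measurableType d) (S' : measurableType d')
    (mu : {measure set S -> \bar R}) (mu' : {measure set S' -> \bar R})
    (th : S' -> S -> R) (c : R) :=
  measurable_fun setT (fun z : S' * S => th z.1 z.2) /\
  forall f : S -> R[i], cintegrable mu f -> (energy mu f < +oo)%E ->
    energy mu' (fun x => cint mu (fun s => f s * chi (th x s))) =
    (c%:E * energy mu f)%E.

Section facts.
Context d d' (S : measurableType d) (S' : measurableType d').
Variables (mu : {measure set S -> \bar R}) (mu' : {measure set S' -> \bar R}).
Variables (th : S' -> S -> R) (c : R).
Hypothesis pp : plancherel_pair mu mu' th c.

Lemma measurable_phase x : measurable_fun setT (th x).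
Proof. exact: (measurableT_comp pp.1 (measurable_pair1 x)). Qed.

Lemma cintegrable_phase (f : S -> R[i]) x : cintegrable mu f ->
  cintegrable mu (fun s => f s * chi (th x s)).
Proof.
by move=> intf; apply: cintegrable_mul_chi => //; exact: measurable_phase.
Qed.

Lemma plancherel_injective (f : S -> R[i]) : c != 0 -> cintegrable mu f ->
  (energy mu f < +oo)%E -> (forall x, cint mu (fun s => f s * chi (th x s)) = 0) ->
  {ae mu, forall s, f s = 0}.
Proof.
move=> c0 intf Ef f0; apply: energy0_ae; first exact: cintegrable_cmeas intf.
have := pp.2 f intf Ef; rewrite (_ : (fun x => _) = cst 0); last exact/funext.
rewrite {1}/energy; under eq_integral do rewrite sqn0.
rewrite integral0 => /esym/eqP; rewrite mule_eq0 => /orP[|/eqP//].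
by rewrite eqe (negbTE c0).
Qed.

End facts.

Lemma plancherel_scaled (a : R) : a != 0 ->
  plancherel_pair leb leb (fun x s => a * x * s) (2 * pi / `|a|).
Proof.
move=> a0; split.
  apply: measurable_funM => //; apply: measurable_funM => //; exact: measurable_cst.
move=> f intf Ef; have na0 : `|a| != 0 by rewrite normr_eq0.
have := plancherel intf Ef.
rewrite -[energy leb (fourier f)](@lebesgue_affine _ a 0) //; last 2 first.
- by apply: measurable_sqn_EFin; exact: cmeas_fourier.
- by move=> x; rewrite lee_fin sqn_ge0.
set I := (\int[leb]_x _)%E => E.
have -> : energy leb (fun x => cint leb (fun s => f s * chi (a * x * s))) = I.
  by apply: eq_integral => x _; rewrite /fourier addr0.
have -> : I = ((`|a|^-1)%:E * (`|a|%:E * I))%E by rewrite muleA -EFinM mulVf// mul1e.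
by rewrite E muleA -EFinM mulrC.
Qed.

Section twisted_product.
Context d1 d1' d2 d2' (S1 : measurableType d1) (S1' : measurableType d1')
  (S2 : measurableType d2) (S2' : measurableType d2').
Variables (m1 : {sigma_finite_measure set S1 -> \bar R})
  (m1' : {sigma_finite_measure set S1' -> \bar R})
  (m2 : {sigma_finite_measure set S2 -> \bar R})
  (m2' : {sigma_finite_measure set S2' -> \bar R}).
Variables (th1 : S1' -> S1 -> R) (th2 : S2' -> S2 -> R) (c1 c2 : R).
Hypothesis pp1 : plancherel_pair m1 m1' th1 c1.
Hypothesis pp2 : plancherel_pair m2 m2' th2 c2.
Hypotheses (c1_ge0 : 0 <= c1) (c2_ge0 : 0 <= c2).
Variable w : S2' -> S1 -> R.
Hypothesis mw : measurable_fun setT (fun z : S2' * S1 => w z.1 z.2).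

(** Transform first the second variable, then the first one. Between the two
    steps, multiplication by the unimodular function [chi (w x2 s1)] changes
    no norm. *)
Lemma plancherel_twist :
  plancherel_pair (m1 \X m2) (m2' \X m1')
    (fun x s => th1 x.2 s.1 + th2 x.1 s.2 + w x.1 s.1) (c1 * c2).
Proof.
have mth : measurable_fun setT (fun z : (S2' * S1') * (S1 * S2) =>
    th1 z.1.2 z.2.1 + th2 z.1.1 z.2.2 + w z.1.1 z.2.1).
  by apply: measurable_funD; first apply: measurable_funD;
    apply: measurable_fun2; (exact: pp1.1 || exact: pp2.1 || exact: mw ||
      apply: measurableT_comp).
split=> // f intf Ef; have mf := cintegrable_cmeas intf.
pose g x2 s1 := cint m2 (fun s2 => f (s1, s2) * chi (th2 x2 s2)).
have mg : cmeas (fun z : S2' * S1 => g z.1 z.2).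
  apply: (@cmeas_cint R _ _ _ _ m2 (fun y : (S2' * S1) * S2 =>
    f (y.1.2, y.2) * chi (th2 y.1.1 y.2))).
  apply: cmeasM.
    apply: (cmeas_comp mf); apply: measurable_fun_pair => //; exact: measurableT_comp.
  apply: cmeas_chi_comp; apply: measurable_fun2 => //; first exact: pp2.1.
  exact: measurableT_comp.
pose h x2 s1 := g x2 s1 * chi (w x2 s1).
have mh : cmeas (fun z : S2' * S1 => h z.1 z.2).
  by apply: cmeasM => //; exact: cmeas_chi_comp.
pose F (z : S2' * S1') := cint (m1 \X m2)
  (fun s => f s * chi (th1 z.2 s.1 + th2 z.1 s.2 + w z.1 s.1)).
have mF : cmeas F.
  apply: (@cmeas_cint R _ _ _ _ (m1 \X m2) (fun y : (S2' * S1') * (S1 * S2) =>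
    f y.2 * chi (th1 y.1.2 y.2.1 + th2 y.1.1 y.2.2 + w y.1.1 y.2.1))).
  by apply: cmeasM; [exact: cmeas_comp|exact: cmeas_chi_comp].
have intf2 x2 : cintegrable (m1 \X m2) (fun s => f s * chi (th2 x2 s.2)).
  apply: cintegrable_mul_chi => //.
  exact: (measurableT_comp (measurable_phase pp2 x2) measurable_snd).
have inth x2 : cintegrable m1 (h x2).
  apply: (cintegrable_dominated _ (cintegrable_fubini (intf2 x2))).
    exact: (cmeas_pair1 x2 mh).
  by move=> s; rewrite ComplexField.Normc.normcM normc_chi mulr1.
have intF x : cintegrable (m1 \X m2)
    (fun s => f s * chi (th1 x.2 s.1 + th2 x.1 s.2 + w x.1 s.1)).
  apply: cintegrable_mul_chi => //.
  exact: (measurableT_comp mth (measurable_pair1 x)).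
have FE x2 x1 : F (x2, x1) = cint m1 (fun s1 => h x2 s1 * chi (th1 x1 s1)).
  rewrite /F cint_fubini//; apply: ae_eq_cint.
  - exact: cintegrable_cmeas (cintegrable_fubini (intF (x2, x1))).
  - exact: cintegrable_cmeas (cintegrable_phase pp1 x1 (inth x2)).
  have := ae_cintegrable intf; apply: filterS => s1 is1 /=.
  rewrite /h -mulrA mulrC -cintZ; last exact: (cintegrable_phase pp2).
  by congr (cint m2 _); apply/funext => s2 /=; rewrite !chiD; ring.
have Ehg x2 : energy m1 (h x2) = energy m1 (g x2).
  by apply: eq_integral => s _; rewrite sqnM sqn_chi mulr1.
(* Plancherel in the second variable, for almost every value of the first *)
have Eg : (\int[m2']_x2 energy m1 (g x2) = c2%:E * energy (m1 \X m2) f)%E.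
  have mgs : cmeas (fun z : S1 * S2' => g z.2 z.1).
    exact: (cmeas_comp mg (measurable_fun_pair measurable_snd measurable_fst)).
  transitivity (\int[m1]_s1 energy m2' (g ^~ s1))%E.
    have G0 (z : S1 * S2') : (0 <= (sqn (g z.2 z.1))%:E)%E by rewrite lee_fin sqn_ge0.
    have /= H := @fubini_tonelli _ _ _ _ _ m1 m2' _ (measurable_sqn_EFin mgs) G0.
    by rewrite /energy -H.
  rewrite (energy_fubini _ _ mf) -ge0_integralZl//; last 2 first.
  - exact: measurable_energy.
  - by move=> x _; exact: energy_ge0.
  apply: ae_eq_integral => //.
  - exact: (measurable_energy m2' mgs).
  - by apply: measurable_funeM; exact: measurable_energy.
  have := ae_energy_fin mf Ef; have := ae_cintegrable intf.
  by apply: filterS2 => s1 is1 Es1 _; exact: pp2.2.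
have Egfin : (\int[m2']_x2 energy m1 (g x2) < +oo)%E.
  by rewrite Eg lte_mul_pinfty.
have mEg : measurable_fun setT (fun x2 => energy m1 (g x2)) := measurable_energy m1 mg.
have aeg : {ae m2', forall x2, (energy m1 (h x2) < +oo)%E}.
  have : m2'.-integrable setT (fun x2 => energy m1 (g x2)).
    apply/integrableP; split => //.
    by under eq_integral do rewrite gee0_abs ?energy_ge0//.
  move=> /(integrable_ae measurableT); apply: filterS => x2 /(_ I).
  by rewrite Ehg ge0_fin_numE// energy_ge0.
rewrite (energy_fubini _ _ mF) EFinM -muleA -Eg -ge0_integralZl//; last first.
  by move=> x _; exact: energy_ge0.
apply: ae_eq_integral => //.
- exact: measurable_energy.
- exact: measurable_funeM.
move: aeg; apply: filterS => x2 Ex2 _.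
rewrite -Ehg -pp1.2//; congr (energy _ _); apply/funext => x1; exact: FE.
Qed.

End twisted_product.

Lemma plancherel_product d1 d1' d2 d2' (S1 : measurableType d1) (S1' : measurableType d1')
  (S2 : measurableType d2) (S2' : measurableType d2')
  (m1 : {sigma_finite_measure set S1 -> \bar R})
  (m1' : {sigma_finite_measure set S1' -> \bar R})
  (m2 : {sigma_finite_measure set S2 -> \bar R})
  (m2' : {sigma_finite_measure set S2' -> \bar R})
  (th1 : S1' -> S1 -> R) (th2 : S2' -> S2 -> R) (c1 c2 : R) :
  plancherel_pair m1 m1' th1 c1 -> plancherel_pair m2 m2' th2 c2 ->
  0 <= c1 -> 0 <= c2 ->
  plancherel_pair (m1 \X m2) (m1' \X m2')
    (fun x s => th1 x.1 s.1 + th2 x.2 s.2) (c1 * c2).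
Proof.
move=> pp1 pp2 c10 c20.
have [mth H] := plancherel_twist pp1 pp2 c10 c20 (w := fun _ _ => 0) (measurable_cst _).
split.
  by apply: measurable_funD; apply: measurable_fun2;
    (exact: pp1.1 || exact: pp2.1 || apply: measurableT_comp).
move=> f intf Ef; rewrite -H// -(mpres_energy (mpres_swap m2' m1')).
  by apply: eq_integral => x _; congr (sqn _)%:E; congr (cint _ _);
    apply/funext => s; rewrite addr0.
apply: (@cmeas_cint R _ _ _ _ (m1 \X m2) (fun y : (S1' * S2') * (S1 * S2) =>
    f y.2 * chi (th1 y.1.1 y.2.1 + th2 y.1.2 y.2.2))).
apply: cmeasM; first exact: (cmeas_comp (cintegrable_cmeas intf)).
apply: cmeas_chi_comp; by apply: measurable_funD; apply: measurable_fun2;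
    (exact: pp1.1 || exact: pp2.1 || apply: measurableT_comp).
Qed.

End plancherel_pair.

(** * Polar coordinates in the plane *)

Section restriction.
Context {R : realType} d (T : measurableType d).
Variables (mu : {sigma_finite_measure set T -> \bar R}) (D : set T).

Definition restrm (mD : measurable D) : set T -> \bar R := mrestr mu mD.

Variable mD : measurable D.

HB.instance Definition _ := Measure.on (restrm mD).

Let restrm_sigma_finite : sigma_finite setT (restrm mD).
Proof.
have [F TF Ffin] := sigma_finiteT mu; exists F => // i.
have [mF Foo] := Ffin i; split => //.
apply: le_lt_trans Foo; rewrite /restrm /mrestr; apply: le_measure; rewrite ?inE//.
exact: measurableI.
Qed.

HB.instance Definition _ := Measure_isSigmaFinite.Build _ _ _ (restrm mD)
  restrm_sigma_finite.

Let ge0_integral_restrm (F : T -> \bar R) : measurable_fun setT F ->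
  (forall x, 0 <= F x)%E -> (\int[restrm mD]_x F x = \int[mu]_(x in D) F x)%E.
Proof.
move=> mF F0; have mDC := measurableC mD.
have UD : D `|` ~` D = setT := setUv D.
rewrite -[in LHS]UD ge0_integral_setU ?UD//; last first.
  by apply/disj_set2P; rewrite setICr.
rewrite [X in (_ + X)%E]null_set_integral ?adde0.
- apply: eq_measure_integral => A mA AD; rewrite /= /restrm /mrestr.
  by rewrite (setIidl AD).
- exact: mDC.
- exact: measurable_funTS.
- by rewrite /= /restrm /mrestr setICl measure0.
Qed.

Lemma integral_restrm (F : T -> \bar R) : measurable_fun setT F ->
  (\int[restrm mD]_x F x = \int[mu]_(x in D) F x)%E.
Proof.
move=> mF; rewrite integralE [RHS]integralE.
by congr (_ - _)%E; apply: ge0_integral_restrm => //;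
  [exact: measurable_funepos|exact: measurable_funeneg].
Qed.

Lemma cint_restrm (f : T -> R[i]) : cmeas f ->
  cint (restrm mD) f = cint mu (fun x => (\1_D x)%:C * f x).
Proof.
move=> [f1 f2]; apply: complex_ext; rewrite /= /Rintegral.
  rewrite integral_restrm; last exact/measurable_EFinP.
  rewrite [in LHS]integral_mkcond; congr fine; apply: eq_integral => x _.
  by rewrite ReM /= mul0r subr0 /patch indicE; case: ifPn => _; rewrite ?mul1r ?mul0r.
rewrite integral_restrm; last exact/measurable_EFinP.
rewrite [in LHS]integral_mkcond; congr fine; apply: eq_integral => x _.
by rewrite ImM /= mul0r addr0 /patch indicE; case: ifPn => _; rewrite ?mul1r ?mul0r.
Qed.

Lemma energy_restrm (f : T -> R[i]) : cmeas f ->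
  energy (restrm mD) f = energy mu (fun x => (\1_D x)%:C * f x).
Proof.
move=> mf; rewrite /energy integral_restrm; last exact: measurable_sqn_EFin.
rewrite [LHS]integral_mkcond; apply: eq_integral => x _.
by rewrite sqnM sqnR /patch indicE; case: ifPn => _; rewrite ?expr1n ?mul1r ?expr0n ?mul0r.
Qed.

Lemma cintegrable_restrm (f : T -> R[i]) : cintegrable (restrm mD) f ->
  cintegrable mu (fun x => (\1_D x)%:C * f x).
Proof.
move=> intf; have mf := cintegrable_cmeas intf.
have m1 : cmeas (fun x => (\1_D x)%:C * f x).
  by apply: cmeasM => //; apply: cmeas_real; exact: measurable_indic.
have mn := measurable_normc mf.
apply: (@cintegrable_le _ _ _ _ _ (fun x => \1_D x * ComplexField.Normc.normc (f x))) => //.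
  have /integrableP[_] := integrable_normc intf.
  under eq_integral do rewrite gee0_abs ?lee_fin ?normc_ge0//.
  rewrite integral_restrm; last exact/measurable_EFinP.
  rewrite integral_mkcond => fin; apply/integrableP; split.
    by apply/measurable_EFinP; apply: measurable_funM => //; exact: measurable_indic.
  apply: le_lt_trans fin; rewrite le_eqVlt; apply/orP; left; apply/eqP.
  apply: eq_integral => x _; rewrite gee0_abs ?lee_fin ?mulr_ge0 ?normc_ge0//.
  by rewrite /= /patch indicE; case: ifPn => _; rewrite ?mul1r ?mul0r.
by move=> x; rewrite ComplexField.Normc.normcM normcE sqnR sqrtr_sqr ger0_norm.
Qed.

End restriction.

Section half_line.
Context {R : realType}.

Definition leb_pos : set (measurableTypeR R) -> \bar R :=
  restrm leb (measurable_itv `]0, +oo[ : measurable (`]0, +oo[%classic : set (measurableTypeR R))).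

HB.instance Definition _ := SigmaFiniteMeasure.on leb_pos.

(** Extend by 0 to the whole line. *)
Lemma plancherel_half_line :
  plancherel_pair leb_pos leb (fun t r => t * r) (2 * pi).
Proof.
split; first exact: measurable_funM.
move=> f intf Ef; have mf := cintegrable_cmeas intf.
rewrite energy_restrm//; rewrite energy_restrm// in Ef.
have [mth pp] := plancherel_scaled (oner_neq0 R).
have := pp _ (cintegrable_restrm intf) Ef; rewrite normr1 divr1 => <-.
apply: eq_integral => t _; congr (sqn _)%:E.
rewrite cint_restrm.
  by congr (cint leb _); apply/funext => x; rewrite mul1r mulrA.
apply: cmeasM => //; apply: cmeas_chi_comp.
by apply: measurable_funM => //; exact: measurable_cst.
Qed.

Lemma leb_pos_ray (y : R) : leb_pos `]-oo, y[ = (Num.max y 0)%:E.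
Proof.
rewrite /leb_pos /restrm /mrestr /=.
rewrite (_ : _ `&` _ = `]0, y[%classic); last first.
  apply/seteqP; split => x /=; rewrite !in_itv /= ?andbT.
    by move=> [-> ->].
  by move=> /andP[-> ->].
rewrite [LHS](_ : _ = lebesgue_measure `]0, y[%classic)// lebesgue_measure_itv /= lte_fin.
by rewrite oppr0 adde0; case: ltP => // y0.
Qed.

Lemma integral_leb_pos_expN : (\int[leb_pos]_x (expR (- x))%:E = 1)%E.
Proof.
have m : measurable_fun setT (fun x : measurableTypeR R => (expR (- x))%:E).
  by apply/measurable_EFinP; apply: measurableT_comp => //; exact: measurableT_comp.
rewrite integral_restrm// -(@integral_exponential_pdf R 1 ltr01).
rewrite integral_itv_obnd_cbnd; last exact: measurable_funTS.
rewrite [LHS]integral_mkcond; apply: eq_integral => x _.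
rewrite /exponential_pdf !patchE; case: ifP => // _.
by rewrite mul1r mulN1r.
Qed.

End half_line.

Section polar.
Context {R : realType}.
Notation plane := (measurableTypeR R * measurableTypeR R)%type.
Notation pl := (leb \X leb).

(** The squared radius, rather than the radius, serves as radial coordinate:
    phases are linear in it, and area is a product measure in it. *)
Definition rho (d : plane) : R := d.1 ^+ 2 + d.2 ^+ 2.

Definition dir (d : plane) : plane :=
  (d.1 / Num.sqrt (rho d), d.2 / Num.sqrt (rho d)).

Lemma rho_ge0 d : 0 <= rho d.
Proof. by rewrite addr_ge0 ?sqr_ge0. Qed.

Lemma measurable_rho : measurable_fun setT (rho : plane -> measurableTypeR R).
Proof.
by apply: measurable_funD; apply: measurable_funX;
  [exact: measurable_fst|exact: measurable_snd].
Qed.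

Lemma measurable_dir : measurable_fun setT dir.
Proof.
have m : measurable_fun setT (fun d : plane => (Num.sqrt (rho d))^-1).
  under eq_fun do rewrite -powR12_sqrt ?rho_ge0// -powRN.
  exact: (measurableT_comp (measurable_powR (- 2^-1)) measurable_rho).
by apply: measurable_fun_pair; exact: measurable_funM.
Qed.

Lemma plane_scale (a : R) (F : plane -> \bar R) : 0 < a ->
  measurable_fun setT F -> (forall z, 0 <= F z)%E ->
  (\int[pl]_z F z = (a ^+ 2)%:E * \int[pl]_z F (a * z.1, a * z.2)%R)%E.
Proof.
move=> a0 mF F0.
have a0' : a != 0 by rewrite gt_eqF.
have na : `|a| = a by rewrite gtr0_norm.
have mm : measurable_fun setT (fun z : plane => (a * z.1, a * z.2) : plane).
  by apply: measurable_fun_pair; apply: measurable_funM => //; exact: measurable_cst.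
have mF' := measurableT_comp mF mm.
have mH : measurable_fun setT (fun z : plane => F (z.1, a * z.2)).
  apply: (measurableT_comp mF); apply: measurable_fun_pair => //.
  by apply: measurable_funM => //; exact: measurable_cst.
rewrite !tonelli1// expr2 EFinM -muleA.
have m1 : measurable_fun setT (fun x => \int[leb]_y F (x, a * y)%R)%E.
  exact: (measurable_tonelli1 leb mH (fun=> F0 _)).
have := @lebesgue_affine R a 0 (fun x => \int[leb]_y F (x, a * y)%R)%E a0' m1
  (fun x => integral_ge0 _ (fun y _ => F0 _)).
rewrite na; under eq_integral do rewrite addr0.
move=> ->; rewrite -ge0_integralZl//; last 2 first.
- by move=> x _; apply: integral_ge0.
- by rewrite lee_fin ltW.
apply: eq_integral => x _.
have mFx : measurable_fun setT (fun y => F (x, y)) := measurableT_comp mF (measurable_pair1 x).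
rewrite -(@lebesgue_affine R a 0 (fun y => F (x, y)))// na.
by congr (_ * _)%E; apply: eq_integral => y _; rewrite addr0.
Qed.

Definition cone (y : R) (B : set plane) : set plane := [set d | rho d < y /\ B (dir d)].

Lemma measurable_cone y B : measurable B -> measurable (cone y B).
Proof.
move=> mB; apply: measurableI.
  rewrite -[X in measurable X]setTI.
  rewrite (_ : _ `&` _ = setT `&` rho @^-1` `]-oo, y[%classic).
    by apply: measurable_rho => //; exact: measurable_itv.
  by apply/seteqP; split => z /=; rewrite in_itv.
by rewrite -[X in measurable X]setTI; exact: measurable_dir.
Qed.

Lemma measurable_disk : measurable (cone 1 setT).
Proof. exact: measurable_cone. Qed.

(** Arc length on the unit circle, halved: the measure of a set of directions
    is the area of the sector of the unit disk that it spans. *)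
Definition arc : set plane -> \bar R :=
  image_measure (restrm pl measurable_disk) measurable_dir.

HB.instance Definition _ := Measure.on arc.

Lemma arcE (B : set plane) : measurable B -> arc B = pl (cone 1 B).
Proof.
move=> mB; rewrite /arc /image_measure /pushforward /restrm /mrestr.
congr (pl _); apply/seteqP; split => z; first by move=> [/= h [? _]].
by move=> [/= h1 h2]; split.
Qed.

Lemma arc_fin (B : set plane) : measurable B -> (arc B < +oo)%E.
Proof.
move=> mB; rewrite arcE//.
apply: (@le_lt_trans _ _ (pl (`]-1, 1[%classic `*` `]-1, 1[%classic))).
  apply: le_measure; rewrite ?inE//.
  - exact: measurable_cone.
  - by apply: measurableX; exact: measurable_itv.
  move=> [x y] [/= r1 _]; rewrite /rho /= in r1.
  have := sqr_ge0 x; have := sqr_ge0 y => y0 x0.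
  by split => /=; rewrite in_itv /=; apply/andP; split; nra.
rewrite /prodm product_measure1E; [|exact: measurable_itv..].
rewrite [X in (X * X < _)%E](_ : _ = lebesgue_measure (`]-1, 1[%classic : set R))//.
by rewrite lebesgue_measure_itv /= lte_fin ifT ?ltrN1// -EFinD -EFinM ltry.
Qed.

Let arc_sigma_finite : sigma_finite setT arc.
Proof.
exists (fun=> setT); first by rewrite bigcup_const.
by move=> _; split => //; exact: arc_fin.
Qed.

HB.instance Definition _ := Measure_isSigmaFinite.Build _ _ _ arc arc_sigma_finite.

Lemma rho_scale (a : R) d : rho (a * d.1, a * d.2) = a ^+ 2 * rho d.
Proof. by rewrite /rho /=; ring. Qed.

Lemma dir_scale (a : R) d : 0 < a -> dir (a * d.1, a * d.2) = dir d.
Proof.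
move=> a0; rewrite /dir rho_scale sqrtrM ?sqr_ge0// sqrtr_sqr gtr0_norm//=.
have [s0|s0] := eqVneq (Num.sqrt (rho d)) 0.
  by rewrite s0 mulr0 invr0 !mulr0.
by congr (_, _); field; rewrite s0 gt_eqF.
Qed.

Lemma cone_arc (y : R) (B : set plane) : measurable B ->
  pl (cone y B) = ((Num.max y 0)%:E * arc B)%E.
Proof.
move=> mB; case: (ltP y 0) => [y0|]; last rewrite le_eqVlt => /predU1P[<-|y0].
- rewrite mul0e (_ : cone y B = set0) ?measure0//.
  apply/seteqP; split => // d [/= h _].
  by have := lt_trans h y0; rewrite ltNge rho_ge0.
- rewrite mul0e (_ : cone 0 B = set0) ?measure0//.
  by apply/seteqP; split => // d [/= h _]; move: h; rewrite ltNge rho_ge0.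
rewrite arcE//; have mc := measurable_cone y mB; have mc1 := measurable_cone 1 mB.
rewrite -[cone y B]setIT -integral_indic// -[cone 1 B]setIT -integral_indic//.
have a0 : 0 < Num.sqrt y by rewrite sqrtr_gt0.
rewrite (plane_scale a0); last 2 first.
- by apply/measurable_EFinP; exact: measurable_indic.
- by move=> z; rewrite lee_fin.
rewrite sqr_sqrtr ?ltW//; congr (_ * _)%E; apply: eq_integral => d _.
rewrite !indicE; have -> // : (Num.sqrt y * d.1, Num.sqrt y * d.2) \in cone y B =
  (d \in cone 1 B).
have E : rho (Num.sqrt y * d.1, Num.sqrt y * d.2) < y <-> rho d < 1.
  by rewrite rho_scale sqr_sqrtr ?ltW// -[X in _ < X]mulr1 ltr_pM2l.
by apply/idP/idP; rewrite !inE /cone /= dir_scale// => -[/E ? ?].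
Qed.

Definition polar (d : plane) : measurableTypeR R * plane := (rho d, dir d).

Lemma measurable_polar : measurable_fun setT polar.
Proof. exact: measurable_fun_pair measurable_rho measurable_dir. Qed.

(** By homogeneity, the cone of height [y] over a set of directions has area
    [y] times that of the cone of height 1, which is a product formula. *)
Lemma mpres_polar : mpres pl (leb_pos \X arc) polar.
Proof.
pose m' : {measure set (measurableTypeR R * plane) -> \bar R} :=
  image_measure pl measurable_polar.
have H : forall (A : set (measurableTypeR R)) (B : set plane), measurable A -> measurable B ->
    m' (A `*` B) = (leb_pos A * arc B)%E.
  move=> A B mA mB.
  have mdB : measurable (dir @^-1` B).
    by rewrite -[X in measurable X]setTI; exact: measurable_dir.
  pose m1 : {measure set (measurableTypeR R) -> \bar R} :=
    image_measure (restrm pl mdB) measurable_rho.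
  have fB : arc B \is a fin_num by rewrite ge0_fin_numE// arc_fin.
  pose m2 : {measure set (measurableTypeR R) -> \bar R} :=
    mscale (NngNum (fine_ge0 (measure_ge0 arc B))) leb_pos.
  have -> : m' (A `*` B) = m1 A.
    rewrite /m' /m1 /= /image_measure /pushforward /restrm /mrestr.
    by congr (pl _); apply/seteqP; split.
  have -> : (leb_pos A * arc B = m2 A)%E by rewrite /m2 /= /mscale /= fineK// muleC.
  have m12 (y : R) : m1 `]-oo, y[%classic = m2 `]-oo, y[%classic.
    by rewrite /m2 /= /mscale /= leb_pos_ray fineK// muleC -cone_arc.
  apply: (@measure_unique _ _ (measurableTypeR R) (@RGenInftyO.G R)
    (fun n => `]-oo, n%:R[%classic) _ _ _ _ m1 m2) => //.
  - exact: RGenInftyO.measurableE.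
  - move=> _ _ [x ->] [y ->]; exists (Num.min x y); apply/seteqP; split => z /=.
      by rewrite !in_itv /= lt_min => -[-> ->].
    by rewrite !in_itv /= lt_min => /andP[].
  - by move=> n; exists n%:R.
  - apply/seteqP; split => // z _; exists (Num.trunc `|z|).+1 => //=.
    by rewrite in_itv /= (le_lt_trans (ler_norm _))// truncnS_gt.
  - by move=> _ [y ->]; exact: m12.
  - move=> n; rewrite m12 /m2 /= /mscale /= leb_pos_ray fineK//.
    by rewrite -(fineK fB) -EFinM ltry.
have E X : measurable X -> (leb_pos \X arc) X = m' X.
  by move=> mX; apply: product_measure_unique.
split; first exact: measurable_polar.
move=> F mF F0; rewrite ((mpres_image pl measurable_polar).2 F mF F0).
by apply/esym/eq_measure_integral => X mX _; exact: E.
Qed.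

Definition cart (z : measurableTypeR R * plane) : plane :=
  (Num.sqrt z.1 * z.2.1, Num.sqrt z.1 * z.2.2).

Lemma measurable_cart : measurable_fun setT cart.
Proof.
have ms : measurable_fun setT (fun z : measurableTypeR R * plane => Num.sqrt z.1).
  apply: (measurableT_comp _ measurable_fst); apply: continuous_measurable_fun.
  exact: sqrt_continuous.
apply: measurable_fun_pair; apply: measurable_funM => //;
  exact: measurableT_comp.
Qed.

Lemma polarK (d : plane) : cart (polar d) = d.
Proof.
rewrite /cart /polar /dir /=; have [s0|s0] := eqVneq (Num.sqrt (rho d)) 0; last first.
  by case: d s0 => x y /= s0; congr (_, _); field.
have : rho d = 0 by rewrite -(sqr_sqrtr (rho_ge0 d)) s0 expr0n.
case: d s0 => x y s0 /eqP; rewrite /rho /= paddr_eq0 ?sqr_ge0// !sqrf_eq0.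
by move=> /andP[/eqP -> /eqP ->]; rewrite !(mul0r, mulr0).
Qed.

(** Integrate [exp (- |d|^2)] over the plane, in Cartesian and in polar
    coordinates. *)
Lemma arcT : arc setT = pi%:E.
Proof.
have m : measurable_fun setT (fun x : measurableTypeR R => (expR (- x))%:E).
  by apply/measurable_EFinP; apply: measurableT_comp => //; exact: measurableT_comp.
have me : measurable_fun setT (fun z : measurableTypeR R * plane => (expR (- z.1))%:E).
  exact: (measurableT_comp m measurable_fst).
have e0 z : (0 <= (expR (- z))%:E :> \bar R)%E by rewrite lee_fin expR_ge0.
have := mpres_polar.2 _ me (fun z => e0 z.1); rewrite /polar /=.
have -> : (\int[leb_pos \X arc]_z (expR (- z.1))%:E = arc setT)%E.
  rewrite tonelli1//=; under eq_integral do rewrite integral_cst// muleC.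
  by rewrite ge0_integralZl ?integral_leb_pos_expN ?mule1.
move=> <-; rewrite tonelli1//; last first.
  exact: (measurableT_comp m measurable_rho).
rewrite /rho /=.
have mg : measurable_fun setT (fun y : measurableTypeR R => (expR (- y ^+ 2))%:E).
  apply/measurable_EFinP.
  exact: (measurableT_comp measurable_expRN2 (@measurable_pair1 _ _ _ (measurableTypeR R) (0 : measurableTypeR R))).
have inner (x : R) : (\int[leb]_y (expR (- (x ^+ 2 + y ^+ 2)))%:E =
    (Num.sqrt pi)%:E * (expR (- x ^+ 2))%:E)%E.
  under eq_integral do rewrite opprD expRD EFinM.
  rewrite ge0_integralZl ?lee_fin ?expR_ge0//.
  by rewrite integral_gauss1 muleC.
under eq_integral do rewrite inner.
rewrite ge0_integralZl ?lee_fin ?sqrtr_ge0//.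
by rewrite integral_gauss1 -EFinM -expr2 sqr_sqrtr ?pi_ge0.
Qed.

End polar.

(** * Norms and completeness of Lebesgue spaces of complex functions *)

Section complex_Lp.
Context d (T : measurableType d) {R : realType} (mu : {measure set T -> \bar R}).
Implicit Types (f g : T -> R[i]).
Local Notation normc := ComplexField.Normc.normc.

Lemma normcD_le (x y : R[i]) : normc (x + y) <= normc x + normc y.
Proof. exact: le_normcD. Qed.

Lemma normcN (x : R[i]) : normc (- x) = normc x.
Proof. by rewrite !normcE sqnN. Qed.

Lemma normcB_sym (x y : R[i]) : normc (x - y) = normc (y - x).
Proof. by rewrite -normcN opprB. Qed.

Definition pint (m : nat) f : \bar R := (\int[mu]_x (normc (f x) ^+ m)%:E)%E.

Lemma pint_ge0 m f : (0 <= pint m f)%E.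
Proof. by apply: integral_ge0 => x _; rewrite lee_fin exprn_ge0// normc_ge0. Qed.

Lemma pint2 f : pint 2 f = energy mu f.
Proof. by apply: eq_integral => x _; rewrite normcX2. Qed.

Lemma measurable_normcX m f : cmeas f ->
  measurable_fun setT (fun x => (normc (f x) ^+ m)%:E).
Proof.
by move=> mf; apply/measurable_EFinP; apply: measurable_funX; exact: measurable_normc.
Qed.

Lemma cLnormT p f :
  cLnorm mu setT p f = Lnorm mu p%:E (fun x => (normc (f x))%:E).
Proof. by rewrite /cLnorm patch_setT. Qed.

Lemma cLnorm_ge0 D p f : (0 <= cLnorm mu D p f)%E.
Proof. exact: Lnorm_ge0. Qed.

Let absnX m (x : R[i]) : (`|(normc x)%:E| `^ m%:R)%E = (normc x ^+ m)%:E.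
Proof. by rewrite abse_EFin ger0_norm ?normc_ge0// poweR_EFin powR_mulrn// normc_ge0. Qed.

Lemma cLnormE m f : cLnorm mu setT m%:R f = (pint m f `^ m%:R^-1)%E.
Proof.
rewrite cLnormT unlock; congr (_ `^ _)%E.
by apply: eq_integral => x _; rewrite absnX.
Qed.

Lemma pintE m f : (0 < m)%N -> pint m f = (cLnorm mu setT m%:R f `^ m%:R)%E.
Proof.
move=> m0; rewrite cLnormE -poweRrM mulVf ?poweRe1 ?pint_ge0//.
by rewrite pnatr_eq0 -lt0n.
Qed.

Lemma le_cLnorm m f g : (pint m f <= pint m g)%E ->
  (cLnorm mu setT m%:R f <= cLnorm mu setT m%:R g)%E.
Proof.
move=> fg; rewrite !cLnormE.
by apply: gt0_ler_poweR; rewrite ?invr_ge0 ?in_itv ?andbT /= ?leey ?pint_ge0.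
Qed.

Lemma pint_fin m f : (0 < m)%N ->
  (pint m f < +oo)%E <-> (cLnorm mu setT m%:R f < +oo)%E.
Proof.
move=> m0; split; first by rewrite cLnormE; exact: poweR_lty.
by rewrite (pintE f m0); exact: poweR_lty.
Qed.

Lemma pint_le_cLnorm m f (c : R) : (0 < m)%N -> 0 <= c ->
  (cLnorm mu setT m%:R f <= c%:E)%E <-> (pint m f <= (c ^+ m)%:E)%E.
Proof.
move=> m0 c0; split => h.
  rewrite (pintE f m0) -(powR_mulrn m c0) -poweR_EFin.
  by apply: gt0_ler_poweR; rewrite ?in_itv ?andbT /= ?leey ?cLnorm_ge0 ?lee_fin ?c0.
have -> : c%:E = ((c ^+ m)%:E `^ m%:R^-1)%E.
  rewrite -(powR_mulrn m c0) -poweR_EFin -poweRrM mulfV ?poweRe1//.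
  by rewrite pnatr_eq0 -lt0n.
rewrite cLnormE.
by apply: gt0_ler_poweR; rewrite ?invr_ge0 ?in_itv ?andbT /= ?leey ?pint_ge0 ?lee_fin ?exprn_ge0.
Qed.

Lemma ae_eq_pint m f g : cmeas f -> cmeas g ->
  {ae mu, forall x, f x = g x} -> pint m f = pint m g.
Proof.
move=> mf mg fg; apply: ae_eq_integral => //; [exact: measurable_normcX..|].
by apply: filterS fg => x /= ->.
Qed.

Lemma ae_eq_cLnorm m f g : cmeas f -> cmeas g ->
  {ae mu, forall x, f x = g x} -> cLnorm mu setT m%:R f = cLnorm mu setT m%:R g.
Proof. by move=> mf mg fg; rewrite !cLnormE (ae_eq_pint m mf mg fg). Qed.

Lemma cLnormB_sym p f g :
  cLnorm mu setT p (fun x => f x - g x) = cLnorm mu setT p (fun x => g x - f x).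
Proof. by rewrite !cLnormT; apply: eq_Lnorm => x; rewrite normcB_sym. Qed.

Lemma cLnormD m f g : (0 < m)%N -> cmeas f -> cmeas g ->
  (cLnorm mu setT m%:R (fun x => f x + g x)%R <=
   cLnorm mu setT m%:R f + cLnorm mu setT m%:R g)%E.
Proof.
move=> m0 mf mg; have m1 : 1 <= m%:R :> R by rewrite ler1n.
have := minkowski_EFin mu (measurable_normc mf) (measurable_normc mg) m1.
rewrite !cLnormT; apply: le_trans.
have mfg := cmeasD mf mg.
have mS := measurable_funD (measurable_normc mf) (measurable_normc mg).
have H : cmeas (fun x => (normc (f x) + normc (g x))%:C) by exact: cmeas_real.
have := @le_cLnorm m (fun x => f x + g x) (fun x => (normc (f x) + normc (g x))%:C).
have nE x : normc (normc (f x) + normc (g x))%:C = normc (f x) + normc (g x).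
  by rewrite normcE sqnR sqrtr_sqr ger0_norm// addr_ge0 ?normc_ge0.
rewrite !cLnormT; under [X in (_ <= X)%E -> _]eq_integral do rewrite nE.
rewrite (@eq_Lnorm _ _ _ mu m%:R%:E (fun x => (normc (normc (f x) + normc (g x))%:C)%:E)
  (fun x => (normc (f x) + normc (g x))%:E) (fun x => congr1 EFin (nE x))).
apply; apply: ge0_le_integral => //.
- by move=> x _; rewrite lee_fin exprn_ge0// normc_ge0.
- exact: measurable_normcX.
- by apply/measurable_EFinP; apply: measurable_funX.
- move=> x _; rewrite lee_fin lerXn2r ?nnegrE ?normc_ge0//; last exact: normcD_le.
  by rewrite addr_ge0 ?normc_ge0.
Qed.

Lemma cLnormB_le m f g h : (0 < m)%N -> cmeas f -> cmeas g -> cmeas h ->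
  (cLnorm mu setT m%:R (fun x => f x - h x)%R <=
   cLnorm mu setT m%:R (fun x => f x - g x)%R + cLnorm mu setT m%:R (fun x => g x - h x)%R)%E.
Proof.
move=> m0 mf mg mh.
have := cLnormD m0 (cmeasB mf mg) (cmeasB mg mh).
by under eq_fun do rewrite addrA subrK.
Qed.

Lemma cLnorm_triangle m f g : (0 < m)%N -> cmeas f -> cmeas g ->
  (cLnorm mu setT m%:R f <=
   cLnorm mu setT m%:R g + cLnorm mu setT m%:R (fun x => f x - g x)%R)%E.
Proof.
move=> m0 mf mg; have := cLnormD m0 mg (cmeasB mf mg).
by under eq_fun do rewrite addrC subrK.
Qed.

Lemma energyB_fin f g : cmeas f -> cmeas g -> (energy mu f < +oo)%E ->
  (energy mu g < +oo)%E -> (energy mu (fun x => f x - g x)%R < +oo)%E.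
Proof.
move=> mf mg Ef Eg; rewrite -pint2; apply/(pint_fin _ (ltn0Sn 1)).
apply: le_lt_trans (cLnormD (ltn0Sn 1) mf (cmeasN mg)) _.
have -> : cLnorm mu setT 2 (fun z => - g z) = cLnorm mu setT 2 g.
  by rewrite !cLnormT; apply: eq_Lnorm => z; rewrite normcN.
by apply: lte_add_pinfty; apply/(pint_fin _ (ltn0Sn 1)); rewrite pint2.
Qed.

Lemma cLnorm_cvg m (h : nat -> T -> R[i]) g : (0 < m)%N ->
  (forall k, cmeas (h k)) -> cmeas g ->
  (forall k, (cLnorm mu setT m%:R (h k) < +oo)%E) ->
  (fun k => cLnorm mu setT m%:R (fun x => h k x - g x)) @ \oo --> 0%E ->
  (fun k => cLnorm mu setT m%:R (h k)) @ \oo --> cLnorm mu setT m%:R g /\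
  (cLnorm mu setT m%:R g < +oo)%E.
Proof.
move=> m0 mh mg hfin hg.
set N := cLnorm mu setT m%:R; set e := (fun k => _) in hg.
have e0 k : (0 <= e k)%E by exact: cLnorm_ge0.
have up k : (N (h k) <= N g + e k)%E by exact: cLnorm_triangle.
have dn k : (N g <= N (h k) + e k)%E.
  by rewrite /e /= cLnormB_sym; exact: cLnorm_triangle.
have [k ek] : exists k, (e k < +oo)%E.
  have [k _ /(_ k (leqnn k)) /= ek] := ((cvge0P e0).1 hg) 1 ltr01.
  by exists k; exact: le_lt_trans ek (ltry _).
have gfin : (N g < +oo)%E.
  apply: (le_lt_trans (dn k)); apply: lte_add_pinfty => //.
split=> //.
have gF : N g \is a fin_num by rewrite ge0_fin_numE// cLnorm_ge0.
apply: (@squeeze_cvge _ _ _ _ (fun k => N g - e k)%E _ (fun k => N g + e k)%E).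
- near=> j.
  rewrite up andbT.
  have ef : e j \is a fin_num.
    rewrite ge0_fin_numE ?cLnorm_ge0//.
    apply: (le_lt_trans _ (ltry 1)); near: j; exact: ((cvge0P e0).1 hg).
  by rewrite leeBlDr.
- rewrite -[X in _ --> X]sube0; apply: cvgeB => //; [exact: fin_num_adde_defr|exact: cvg_cst].
- rewrite -[X in _ --> X]adde0; apply: cvgeD => //; [exact: fin_num_adde_defr|exact: cvg_cst].
Unshelve. all: by end_near. Qed.

Lemma pint_cvg0P m (f : nat -> T -> R[i]) : (0 < m)%N ->
  (fun k => pint m (f k)) @ \oo --> 0%E <->
  (fun k => cLnorm mu setT m%:R (f k)) @ \oo --> 0%E.
Proof.
move=> m0; have n0 k : (0 <= cLnorm mu setT m%:R (f k))%E by exact: cLnorm_ge0.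
have p0 k : (0 <= pint m (f k))%E by exact: pint_ge0.
split => [/(cvge0P p0)|/(cvge0P n0)] h; [apply/(cvge0P n0)|apply/(cvge0P p0)] => e e0.
  have /h : 0 < e ^+ m by rewrite exprn_gt0.
  apply: filterS => k.
  by apply: (pint_le_cLnorm _ _ _).2 => //; exact: ltW.
have e1 : 0 < Num.min e 1 by rewrite lt_min e0 ltr01.
have := h _ e1; apply: filterS => k.
move=> /(pint_le_cLnorm _ m0 (ltW e1)) /le_trans; apply; rewrite lee_fin.
apply: le_trans (_ : Num.min e 1 <= _); last by rewrite ge_min lexx.
by apply: ler_iXnr => //; [exact: ltW|rewrite ge_min lexx orbT].
Qed.

Lemma pint_fine m f : (0 < m)%N -> (cLnorm mu setT m%:R f < +oo)%E ->
  pint m f = (fine (cLnorm mu setT m%:R f) ^+ m)%:E.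
Proof.
move=> m0 fin; rewrite (pintE f m0) -{1}(@fineK _ (cLnorm mu setT m%:R f)).
  by rewrite poweR_EFin powR_mulrn// fine_ge0// cLnorm_ge0.
by rewrite ge0_fin_numE// cLnorm_ge0.
Qed.

Lemma pint_cvg m (h : nat -> T -> R[i]) g : (0 < m)%N ->
  (forall k, cmeas (h k)) -> cmeas g ->
  (forall k, (pint m (h k) < +oo)%E) ->
  (fun k => pint m (fun x => h k x - g x)) @ \oo --> 0%E ->
  (fun k => pint m (h k)) @ \oo --> pint m g.
Proof.
move=> m0 mh mg hfin /(pint_cvg0P _ m0) hg.
have fin k : (cLnorm mu setT m%:R (h k) < +oo)%E by apply/(pint_fin _ m0).
have [c gfin] := cLnorm_cvg m0 mh mg fin hg.
rewrite (pint_fine m0 gfin); under eq_fun do rewrite (pint_fine m0 (fin _)).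
apply: cvg_EFin; first exact: nearW.
apply: (@continuous_cvg _ R R _ _ _ (fun t : R => t ^+ m)).
  exact: exprn_continuous.
by apply: fine_cvg; rewrite fineK// ge0_fin_numE// cLnorm_ge0.
Qed.

End complex_Lp.

Section riesz_fischer.
Context d (T : measurableType d) {R : realType} (mu : {measure set T -> \bar R}).
Local Notation normc := ComplexField.Normc.normc.

Let limn_einf_le (u : nat -> \bar R) c : (forall n, u n <= c)%E -> (limn_einf u <= c)%E.
Proof.
move=> uc; rewrite limn_einf_lim; apply: lime_le; first exact: is_cvg_einfs.
apply: nearW => n; apply: ge_ereal_inf; exists (u n); last exact: uc.
by exists n => /=.
Qed.

Let measurable_einf (g : nat -> T -> \bar R) : (forall n, measurable_fun setT (g n)) ->
  measurable_fun setT (fun x => limn_einf (g ^~ x)).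
Proof.
move=> mg; apply: (@emeasurable_fun_cvg _ _ _ _ (fun n x => einfs (g ^~ x) n)).
  exact: measurable_fun_einfs.
move=> x _.
by rewrite limn_einf_lim; exact: is_cvg_einfs.
Qed.

Lemma fatou_ae (g : nat -> T -> R) (G : T -> R) (C : \bar R) :
  (forall n, measurable_fun setT (g n)) -> (forall n x, 0 <= g n x) ->
  measurable_fun setT G ->
  {ae mu, forall x, g n x @[n --> \oo] --> G x} ->
  (forall n, \int[mu]_x (g n x)%:E <= C)%E -> (\int[mu]_x (G x)%:E <= C)%E.
Proof.
move=> mg g0 mG gG gC; have mEg n : measurable_fun setT (EFin \o g n) by exact/measurable_EFinP.
have -> : (\int[mu]_x (G x)%:E = \int[mu]_x limn_einf (fun n => (g n x)%:E))%E.
  apply: ae_eq_integral => //; [exact/measurable_EFinP|exact: measurable_einf|].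
  apply: filterS gG => x gx _; apply/esym.
  have gE : (fun n => (g n x)%:E) @ \oo --> (G x)%:E by apply: cvg_EFin => //; exact: nearW.
  exact: (cvg_limn_einf_sup gE).1.
apply: le_trans (limn_einf_le gC).
by apply: fatou => // n x _; rewrite lee_fin.
Qed.

Variables (m : nat) (m_gt0 : (0 < m)%N) (u : nat -> T -> R[i]).
Hypothesis mu_ : forall n, cmeas (u n).
Hypothesis fast : forall n,
  (cLnorm mu setT m%:R (fun x => u n.+1 x - u n x)%R <= ((2^-1) ^+ n)%:E)%E.

Let S (x : T) n := \sum_(k < n) normc (u k.+1 x - u k x).

Let S_ge0 x n : 0 <= S x n.
Proof. by apply: sumr_ge0 => i _; exact: normc_ge0. Qed.

Let mS n : measurable_fun setT (S ^~ n).
Proof.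
apply: measurable_sum => k; apply: measurable_normc.
exact: cmeasB.
Qed.

Let half_sum n : \sum_(k < n) (2^-1 : R) ^+ k <= 2.
Proof.
suff : \sum_(k < n) (2^-1 : R) ^+ k = 2 - 2 * (2^-1) ^+ n.
  by move=> ->; rewrite gerBl mulr_ge0// exprn_ge0.
elim: n => [|n IH]; first by rewrite big_ord0 expr0 mulr1 subrr.
by rewrite big_ord_recr /= IH exprS; field.
Qed.

Let S_bound n : (\int[mu]_x (S x n ^+ m)%:E <= (2 ^+ m)%:E)%E.
Proof.
have nS x k : normc (S x k)%:C = S x k by rewrite normcE sqnR sqrtr_sqr ger0_norm.
have -> : (\int[mu]_x (S x n ^+ m)%:E = pint mu m (fun x => (S x n)%:C))%E.
  by apply: eq_integral => x _; rewrite nS.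
apply/(pint_le_cLnorm _ _ m_gt0) => //.
apply: le_trans (_ : (\sum_(k < n) (2^-1 : R) ^+ k)%:E <= _)%E; last by rewrite lee_fin.
elim: n => [|n IH].
  rewrite big_ord0 cLnormE.
  have -> : pint mu m (fun x => (S x 0)%:C) = 0%E.
    apply: integral0_eq => x _; rewrite nS /S big_ord0 expr0n.
    by rewrite gtn_eqF.
  by rewrite poweR0r// invr_eq0 pnatr_eq0 -lt0n.
have E x : (S x n.+1)%:C = (S x n)%:C + (normc (u n.+1 x - u n x))%:C.
  by rewrite /S big_ord_recr /= rmorphD.
under eq_fun do rewrite E.
have m1 : cmeas (fun x => (S x n)%:C) by exact: cmeas_real.
have m2 : cmeas (fun x => (normc (u n.+1 x - u n x))%:C).
  by apply: cmeas_real; apply: measurable_normc; exact: cmeasB.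
apply: le_trans (cLnormD _ m_gt0 m1 m2) _.
rewrite big_ord_recr /= EFinD; apply: leeD; first exact: IH.
apply: le_trans (fast n); apply: le_cLnorm; rewrite /pint.
by under eq_integral do rewrite normcE sqnR sqrtr_sqr ger0_norm ?normc_ge0//.
Qed.

(** The partial sums increase, so that this lower limit is a supremum. It is
    finite almost everywhere by Fatou's lemma. *)
Let W x := limn_einf (fun n => (S x n ^+ m)%:E).

Let mSm n : measurable_fun setT (fun x => (S x n ^+ m)%:E).
Proof. by apply/measurable_EFinP; apply: measurable_funX. Qed.

Let mW : measurable_fun setT W.
Proof. exact: measurable_einf. Qed.

Let W_ge0 x : (0 <= W x)%E.
Proof.
rewrite /W limn_einf_lim; apply: lime_ge; first exact: is_cvg_einfs.
apply: nearW => n; apply: le_ereal_inf_tmp => _ [k _ <-].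
by rewrite lee_fin exprn_ge0.
Qed.

Let W_fin : {ae mu, forall x, (W x < +oo)%E}.
Proof.
have : mu.-integrable setT W.
  apply/integrableP; split => //; under eq_integral do rewrite gee0_abs//.
  apply: le_lt_trans (ltry (2 ^+ m)).
  apply: le_trans (limn_einf_le S_bound).
  by apply: fatou => // n x _; rewrite lee_fin exprn_ge0.
move=> /(integrable_ae measurableT); apply: filterS => x /(_ I).
by rewrite ge0_fin_numE.
Qed.

Let S_nd x : nondecreasing_seq (S x).
Proof.
apply/nondecreasing_seqP => n; rewrite /S big_ord_recr /= lerDl.
exact: normc_ge0.
Qed.

Let S_le x n : (W x < +oo)%E -> S x n <= 1 + fine (W x).
Proof.
move=> Wx; have WF : W x \is a fin_num by rewrite ge0_fin_numE.
have : S x n ^+ m <= fine (W x).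
  rewrite -lee_fin fineK// /W limn_einf_lim.
  apply: lime_ge; first exact: is_cvg_einfs.
  exists n => // k /= nk; apply: le_ereal_inf_tmp => _ [j kj <-].
  by rewrite lee_fin lerXn2r ?nnegrE//; apply: S_nd; exact: leq_trans nk kj.
have [s1|s1] := leP (S x n) 1.
  by move=> _; rewrite (le_trans s1)// lerDl fine_ge0.
move=> h; have : S x n <= S x n ^+ m by rewrite ler_eXnr// ltW.
by move=> h1; rewrite (le_trans h1)// (le_trans h)// lerDr.
Qed.

Let cvgS (f : R[i] -> R) (x : T) : (forall a b, f (a - b) = f a - f b) ->
  (forall a, `|f a| <= normc a) ->
  (W x < +oo)%E -> cvgn (fun n => f (u n x)).
Proof.
move=> fB fn Wx.
have c : cvgn (series (telescope (fun n => f (u n x)))).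
  apply: normed_cvg; rewrite /normed_series_of.
  apply: (@series_le_cvg _ _ (fun n => normc (u n.+1 x - u n x))) => [n|n|n|].
  - exact: normr_ge0.
  - exact: normc_ge0.
  - by rewrite /= /telescope /= -fB.
  apply: nondecreasing_is_cvgn.
    by move=> a b ab; rewrite /series /= !big_mkord; exact: S_nd.
  exists (1 + fine (W x)) => _ [n _ <-]; rewrite /series /= big_mkord.
  exact: S_le.
have -> : (fun n => f (u n x)) = (fun n => f (u 0 x) + series (telescope (fun n => f (u n x))) n).
  by apply/funext => n; rewrite -(eq_sum_telescope (fun n => f (u n x))).
by apply: is_cvgD => //; exact: is_cvg_cst.
Qed.

Let D : set T := [set x | (W x < +oo)%E].

Let mD : measurable D.
Proof. by rewrite -[D]setTI; exact: emeasurable_fun_infty_o. Qed.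

(** The sequence is replaced by 0 where it may diverge, so that it has a
    measurable limit everywhere. *)
Let v n x : R[i] := (\1_D x)%:C * u n x.

Let v_cvg (f : R[i] -> R) x : (forall a b, f (a - b) = f a - f b) ->
  (forall a, `|f a| <= normc a) -> cvgn (fun n => f (v n x)).
Proof.
move=> fB fn; rewrite /v indicE; have [|] := boolP (x \in D).
  by rewrite inE => Dx; under eq_fun do rewrite mul1r; exact: cvgS.
by move=> _; under eq_fun do rewrite mul0r; exact: is_cvg_cst.
Qed.

Let ReB (a b : R[i]) : complex.Re (a - b) = complex.Re a - complex.Re b.
Proof. by rewrite ReD ReN. Qed.

Let ImB (a b : R[i]) : complex.Im (a - b) = complex.Im a - complex.Im b.
Proof. by rewrite ImD ImN. Qed.

Let F x : R[i] := limn (fun n => complex.Re (v n x)) +i* limn (fun n => complex.Im (v n x)).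

Let mv n : cmeas (v n).
Proof. by apply: cmeasM => //; apply: cmeas_real; exact: measurable_indic. Qed.

Let mF : cmeas F.
Proof.
split => /=.
  apply: (@measurable_fun_cvg _ _ _ _ (fun n x => complex.Re (v n x))).
    by move=> n; exact: (mv n).1.
  by move=> x _; apply: v_cvg => //; exact: normr_Re_le.
apply: (@measurable_fun_cvg _ _ _ _ (fun n x => complex.Im (v n x))).
  by move=> n; exact: (mv n).2.
by move=> x _; apply: v_cvg => //; exact: normr_Im_le.
Qed.

Let normcX_cvg n x : (fun k => normc (v n x - v (n + k)%N x) ^+ m) @ \oo --> normc (v n x - F x) ^+ m.
Proof.
have shift (f : nat -> R) (l : R) : f @ \oo --> l -> (fun k => f (n + k)%N) @ \oo --> l.
  by move=> fl; move: (fl); rewrite -(cvg_shiftn n); under eq_fun do rewrite addnC.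
have cRe := shift _ _ (@v_cvg _ x ReB (@normr_Re_le R)).
have cIm := shift _ _ (@v_cvg _ x ImB (@normr_Im_le R)).
suff c : (fun k => normc (v n x - v (n + k)%N x)) @ \oo --> normc (v n x - F x).
  by apply: (@continuous_cvg _ R R _ _ _ (fun t : R => t ^+ m)) => //; exact: exprn_continuous.
rewrite normcE; under eq_fun do rewrite normcE.
apply: (@continuous_cvg _ R R _ _ _ (@Num.sqrt R)); first exact: sqrt_continuous.
rewrite /sqn ReB ImB; under eq_fun do rewrite ReB ImB.
by apply: cvgD; (apply: (@continuous_cvg _ R R _ _ _ (fun t : R => t ^+ 2));
  [exact: exprn_continuous|apply: cvgB => //; exact: cvg_cst]).
Qed.

Let tail n k : (cLnorm mu setT m%:R (fun x => u n x - u (n + k)%N x)%R <=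
  (2 * (2^-1) ^+ n)%:E)%E.
Proof.
apply: (@le_trans _ _ (((2^-1) ^+ n * \sum_(j < k) (2^-1) ^+ j)%:E)); last first.
  by rewrite lee_fin mulrC ler_wpM2r// exprn_ge0.
elim: k => [|k IH].
  rewrite addn0 big_ord0 mulr0 cLnormE (_ : pint _ _ _ = 0%E).
    by rewrite poweR0r// invr_eq0 pnatr_eq0 -lt0n.
  apply: integral0_eq => x _; rewrite subrr ComplexField.Normc.normc0 expr0n.
  by rewrite gtn_eqF.
apply: le_trans (cLnormB_le _ m_gt0 (mu_ n) (mu_ (n + k)%N) (mu_ _)) _.
rewrite big_ord_recr /= mulrDr EFinD; apply: leeD; first exact: IH.
by rewrite cLnormB_sym addnS -exprD; exact: fast.
Qed.

(** The partial sums of the moduli of the increments are bounded in [L^m], hence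
    at almost every point; so the sequence converges almost everywhere, and
    Fatou's lemma bounds its distance to the limit. *)
Lemma riesz_fischer : exists F : T -> R[i], cmeas F /\
  forall n, (cLnorm mu setT m%:R (fun x => u n x - F x)%R <= (2 * (2^-1) ^+ n)%:E)%E.
Proof.
exists F; split=> // n.
have uv j : {ae mu, forall x, u j x = v j x}.
  apply: filterS W_fin => x Wx; rewrite /v indicE mem_set ?mul1r//.
have c0 : 0 <= 2 * (2^-1 : R) ^+ n by rewrite mulr_ge0// exprn_ge0.
have mvF := cmeasB (mv n) mF.
rewrite (@ae_eq_cLnorm _ _ _ _ _ _ (fun x => v n x - F x)) //; last 2 first.
- exact: cmeasB.
- by apply: filterS (uv n) => x ->.
apply/(pint_le_cLnorm _ _ m_gt0 c0).
apply: (@fatou_ae (fun k x => normc (v n x - v (n + k)%N x) ^+ m)).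
- by move=> k; apply: measurable_funX; apply: measurable_normc; exact: cmeasB.
- by move=> k x; rewrite exprn_ge0// normc_ge0.
- by apply: measurable_funX; exact: measurable_normc.
- by apply: aeW => x; exact: normcX_cvg.
move=> k; apply/(pint_le_cLnorm _ _ m_gt0 c0).
rewrite -(@ae_eq_cLnorm _ _ _ mu m (fun x => u n x - u (n + k)%N x)); first exact: tail.
- exact: cmeasB.
- exact: cmeasB.
- by apply: filterS2 (uv n) (uv (n + k)%N) => x -> ->.
Qed.

End riesz_fischer.

(** * Averages over circles and the space-time norm *)

Section variance.
Context {R : realType}.
Notation plane := (measurableTypeR R * measurableTypeR R)%type.

Lemma integral_arc_cst (k : R) : (\int[arc]_(w in [set: plane]) k%:E = (k * pi)%:E)%E.
Proof. by rewrite integral_cst// EFinM; congr (_ * _)%E; exact: arcT. Qed.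

Lemma cintegrable_arc (f : plane -> R[i]) : cmeas f -> (energy arc f < +oo)%E ->
  cintegrable arc f.
Proof.
move=> mf Ef; have m1 := cmeas_cst plane (1 : R[i]).
have E1 : (energy (@arc R) (fun=> 1%R) < +oo)%E.
  rewrite /energy; under eq_integral do rewrite (_ : sqn _ = 1) ?(sqnR 1) ?expr1n//.
  by rewrite integral_arc_cst ltry.
by have := cintegrable_mulL2 mf m1 Ef E1; under eq_fun do rewrite mulr1.
Qed.

Lemma pi_neq0 : pi != 0 :> R. Proof. by rewrite gt_eqF// pi_gt0. Qed.

(** On a space of total mass [pi], the mean square is the square of the mean
    plus the variance. *)
Lemma arc_variance (f : plane -> R[i]) : cmeas f -> (energy arc f < +oo)%E ->
  (pi%:E * energy arc f = (sqn (cint arc f))%:E +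
   pi%:E * energy arc (fun w => f w - cint arc f * (pi^-1)%:C)%R)%E.
Proof.
move=> mf Ef; have [f1 f2] := cintegrable_arc mf Ef.
have iE := energy_integrable mf Ef.
pose u w := complex.Re (f w); pose v w := complex.Im (f w).
set A := \int[arc]_w u w; set B := \int[arc]_w v w.
have -> : cint arc f = A +i* B by [].
pose e := \int[arc]_w sqn (f w).
have eE : energy arc f = e%:E by rewrite /e /Rintegral fineK// (integrable_fin_num measurableT iE).
have ic (k : R) : arc.-integrable setT (cst k%:E : plane -> \bar R).
  apply/integrableP; split => //; under eq_integral do rewrite abse_EFin.
  by rewrite integral_arc_cst ltry.
have iu (k : R) : arc.-integrable setT (fun w => (k * u w)%:E).
  by under eq_fun do rewrite EFinM; exact: integrableZl.
have iv (k : R) : arc.-integrable setT (fun w => (k * v w)%:E).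
  by under eq_fun do rewrite EFinM; exact: integrableZl.
pose a := A / pi; pose b := B / pi.
have -> : energy arc (fun w => f w - (A +i* B) * (pi^-1)%:C) =
    (e - 2 * a * A - 2 * b * B + (a ^+ 2 + b ^+ 2) * pi)%:E.
  have E w : sqn (f w - (A +i* B) * (pi^-1)%:C) =
      (sqn (f w) + (- (2 * a)) * u w) + ((- (2 * b)) * v w + (a ^+ 2 + b ^+ 2)).
    by rewrite /sqn !ReImE /= /u /v /a /b; ring.
  rewrite /energy; under eq_integral do rewrite E.
  have iS : arc.-integrable setT (fun w => (sqn (f w) + (- (2 * a)) * u w)%:E).
    by under eq_fun do rewrite EFinD; exact: integrableD.
  have iT : arc.-integrable setT (fun w => ((- (2 * b)) * v w + (a ^+ 2 + b ^+ 2))%:E).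
    by under eq_fun do rewrite EFinD; apply: integrableD => //; exact: ic.
  have iall : arc.-integrable setT (fun w =>
      ((sqn (f w) + (- (2 * a)) * u w) + ((- (2 * b)) * v w + (a ^+ 2 + b ^+ 2)))%:E).
    by under eq_fun do rewrite EFinD; exact: integrableD.
  rewrite -[LHS](fineK (integrable_fin_num measurableT iall)); congr EFin.
  transitivity (\int[arc]_w ((sqn (f w) + (- (2 * a)) * u w) +
    ((- (2 * b)) * v w + (a ^+ 2 + b ^+ 2)))) => //.
  have -> := @RintegralD _ _ _ arc setT
    (fun w => sqn (f w) + (- (2 * a)) * u w) (fun w => (- (2 * b)) * v w + (a ^+ 2 + b ^+ 2))
    measurableT iS iT.
  have -> := @RintegralD _ _ _ arc setT
    (fun w => sqn (f w)) (fun w => (- (2 * a)) * u w) measurableT iE (iu _).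
  have -> := @RintegralD _ _ _ arc setT
    (fun w => (- (2 * b)) * v w) (fun w => a ^+ 2 + b ^+ 2) measurableT (iv _) (ic _).
  rewrite RintegralZl// RintegralZl// -/A -/B -/e.
  rewrite (_ : \int[arc]_ _ (a ^+ 2 + b ^+ 2) = (a ^+ 2 + b ^+ 2) * pi); first ring.
  by rewrite /Rintegral integral_arc_cst.
rewrite eE -!EFinM -EFinD; congr EFin; rewrite /sqn /= /a /b.
move: (@pi R) pi_neq0 => p p0.
by field; rewrite p0.
Qed.

End variance.

Section core.
Context {R : realType}.
Notation plane := (measurableTypeR R * measurableTypeR R)%type.
Notation pl := (leb \X leb : {sigma_finite_measure set plane -> \bar R}).
Context d (S : measurableType d) (sig : {sigma_finite_measure set S -> \bar R}).
Implicit Types H : S * plane -> R[i].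

Definition pol (z : S * plane) : S * measurableTypeR R * plane :=
  ((z.1, rho z.2), dir z.2).

Lemma mpres_pol : mpres (sig \X pl) ((sig \X leb_pos) \X arc) pol.
Proof.
exact: (mpres_comp (mpres_prod (mpres_id sig) mpres_polar) (mpres_assocV _ _ _)).
Qed.

Definition unroll (z : S * measurableTypeR R * plane) : S * plane :=
  (z.1.1, cart (z.1.2, z.2)).

Lemma measurable_unroll : measurable_fun setT unroll.
Proof.
apply: measurable_fun_pair; first exact: measurableT_comp.
apply: (measurableT_comp measurable_cart); apply: measurable_fun_pair => //.
exact: measurableT_comp.
Qed.

Lemma polK : cancel pol unroll.
Proof. by move=> [s p]; rewrite /unroll /pol /=; congr (_, _); exact: polarK. Qed.

(** Not normalised: the mean of [H] over a circle is this integral divided by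
    [pi]. *)
Definition angular H (y : S * measurableTypeR R) : R[i] :=
  cint arc (fun w => H (unroll (y, w))).

Lemma cmeas_unroll H : cmeas H -> cmeas (fun z => H (unroll z)).
Proof. by move=> mH; exact: (cmeas_comp mH measurable_unroll). Qed.

Lemma cmeas_angular H : cmeas H -> cmeas (angular H).
Proof. by move=> mH; exact: (cmeas_cint arc (cmeas_unroll mH)). Qed.

Lemma energy_unroll H : cmeas H ->
  energy ((sig \X leb_pos) \X arc) (fun z => H (unroll z)) = energy (sig \X pl) H.
Proof.
move=> mH; rewrite -(mpres_energy mpres_pol (cmeas_unroll mH)).
by apply: eq_integral => z _; rewrite polK.
Qed.

Lemma cintegrable_unroll H : cintegrable (sig \X pl) H ->
  cintegrable ((sig \X leb_pos) \X arc) (fun z => H (unroll z)).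
Proof.
move=> iH; apply/(mpres_cintegrable mpres_pol).
  exact: cmeas_unroll (cintegrable_cmeas iH).
by under eq_fun do rewrite polK.
Qed.

(** This is [arc_variance], integrated over all circles. *)
Lemma energy_angular H : cmeas H -> (energy (sig \X pl) H < +oo)%E ->
  (pi%:E * energy (sig \X pl) H = energy (sig \X leb_pos) (angular H) +
   pi%:E * energy ((sig \X leb_pos) \X arc)
     (fun z => H (unroll z) - angular H z.1 * (pi^-1)%:C)%R)%E.
Proof.
move=> mH; rewrite -energy_unroll// => EH.
have mU := cmeas_unroll mH; have mA := cmeas_angular mH.
have mB : cmeas (fun z : S * measurableTypeR R * plane =>
    H (unroll z) - angular H z.1 * (pi^-1)%:C).
  apply: cmeasB => //; apply: cmeasM; last exact: cmeas_cst.
  exact: (cmeas_comp mA measurable_fst).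
have eU := measurable_energy arc mU; have eB := measurable_energy arc mB.
rewrite (energy_fubini _ _ mU) (energy_fubini _ _ mB).
rewrite -!ge0_integralZl ?lee_fin ?pi_ge0//; last 2 first.
- by move=> y _; exact: energy_ge0.
- by move=> y _; exact: energy_ge0.
rewrite -ge0_integralD//; last 4 first.
- by move=> y _; rewrite lee_fin sqn_ge0.
- exact: measurable_sqn_EFin.
- by move=> y _; rewrite mule_ge0 ?lee_fin ?pi_ge0 ?energy_ge0.
- by apply: measurable_funeM; exact: eB.
apply: ae_eq_integral => //.
- by apply: measurable_funeM; exact: eU.
- apply: emeasurable_funD; first exact: measurable_sqn_EFin.
  by apply: measurable_funeM; exact: eB.
have := ae_energy_fin mU EH; apply: filterS => y Ey _.
exact: (arc_variance (cmeas_pair1 y mU) Ey).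
Qed.

Lemma energy_angular_le H : cmeas H -> (energy (sig \X pl) H < +oo)%E ->
  (energy (sig \X leb_pos) (angular H) <= pi%:E * energy (sig \X pl) H)%E.
Proof.
move=> mH EH; rewrite energy_angular// leeDl// mule_ge0 ?lee_fin ?pi_ge0//.
exact: energy_ge0.
Qed.

Lemma energy_angular_fin H : cmeas H -> (energy (sig \X pl) H < +oo)%E ->
  (energy (sig \X leb_pos) (angular H) < +oo)%E.
Proof.
move=> mH EH; apply: le_lt_trans (energy_angular_le mH EH) _.
by rewrite lte_mul_pinfty ?lee_fin ?pi_ge0.
Qed.

(** Equality in [energy_angular_le] leaves no variance on almost every circle. *)
Lemma angular_eq_radial H : cmeas H -> (energy (sig \X pl) H < +oo)%E ->
  energy (sig \X leb_pos) (angular H) = (pi%:E * energy (sig \X pl) H)%E ->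
  {ae sig \X pl, forall z, H z = angular H (z.1, rho z.2) * (pi^-1)%:C}.
Proof.
move=> mH EH E.
have mB : cmeas (fun z : S * measurableTypeR R * plane =>
    H (unroll z) - angular H z.1 * (pi^-1)%:C).
  apply: cmeasB; first exact: cmeas_unroll.
  apply: cmeasM; last exact: cmeas_cst.
  exact: (cmeas_comp (cmeas_angular mH) measurable_fst).
have fin : energy (sig \X leb_pos) (angular H) \is a fin_num.
  by rewrite ge0_fin_numE ?energy_ge0// energy_angular_fin.
have := energy_angular mH EH; rewrite -E.
set V := energy (sig \X leb_pos) _ in fin *.
move=> /(congr1 (fun t => t - V)%E).
have VV : (V - V = 0)%E by exact: subee.
rewrite [in RHS]addeAC VV add0e => /esym/eqP.
rewrite mule_eq0 eqe (negbTE pi_neq0) /= => /eqP.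
rewrite -(mpres_energy mpres_pol mB) => E0.
have := energy0_ae (cmeas_comp mB mpres_pol.1) E0.
by apply: filterS => z /=; rewrite polK => /eqP; rewrite subr_eq0 => /eqP.
Qed.

(** A radial function has no variance on almost every circle. *)
Lemma radial_eq_angular H (Phi : S * measurableTypeR R -> R[i]) : cmeas Phi ->
  (forall z, H z = Phi (z.1, rho z.2)) -> cmeas H ->
  energy (sig \X leb_pos) (angular H) = (pi%:E * energy (sig \X pl) H)%E.
Proof.
move=> mPhi HP mH.
have mU := cmeas_unroll mH.
have mP : cmeas (fun z : S * measurableTypeR R * plane => Phi z.1).
  exact: (cmeas_comp mPhi measurable_fst).
have mB := cmeasB mU mP.
have E0 : energy ((sig \X leb_pos) \X arc) (fun z => H (unroll z) - Phi z.1) = 0%E.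
  rewrite -(mpres_energy mpres_pol mB); rewrite /energy.
  under eq_integral do rewrite polK HP subrr sqn0.
  by rewrite integral0.
have ae0 : {ae sig \X leb_pos, forall y, energy arc (fun w => H (unroll (y, w)) - Phi y) = 0%E}.
  rewrite energy_fubini// in E0.
  have [+ _] := ae_eq_integral_abs (sig \X leb_pos) measurableT (measurable_energy arc mB).
  have -> : (\int[sig \X leb_pos]_y `|energy arc (fun w => (H (unroll (y, w)) - Phi y)%R)|)%E = 0%E.
    by rewrite -[RHS]E0; apply: eq_integral => y _; rewrite gee0_abs ?energy_ge0.
  by move=> /(_ erefl); apply: filterS => y /= /(_ I).
have aeH : {ae sig \X leb_pos, forall y, {ae arc, forall w, H (unroll (y, w)) = Phi y}}.
  apply: filterS ae0 => y /(energy0_ae (cmeas_pair1 y mB)).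
  by apply: filterS => w /= /eqP; rewrite subr_eq0 => /eqP.
rewrite -energy_unroll// [in RHS](energy_fubini _ _ mU).
have eU := measurable_energy arc mU.
rewrite -ge0_integralZl ?lee_fin ?pi_ge0//; last first.
  by move=> y _; exact: energy_ge0.
apply: ae_eq_integral => //.
- by apply: measurable_sqn_EFin; exact: cmeas_angular.
- by apply: measurable_funeM; exact: eU.
apply: filterS aeH => y Hy _.
have mc : cmeas (fun _ : plane => Phi y) by exact: cmeas_cst.
rewrite (ae_eq_energy (cmeas_pair1 y mU) mc Hy) /angular.
rewrite (ae_eq_cint (cmeas_pair1 y mU) mc Hy) /energy integral_arc_cst.
rewrite (_ : cint arc (cst (Phi y)) = pi%:C * Phi y) ?sqnM ?sqnR.
  by rewrite -!EFinM; congr EFin; ring.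
apply: complex_ext; rewrite ReImE /= /Rintegral integral_arc_cst /=; ring.
Qed.

Lemma angularB H1 H2 : cmeas H1 -> cmeas H2 ->
  (energy (sig \X pl) H1 < +oo)%E -> (energy (sig \X pl) H2 < +oo)%E ->
  {ae sig \X leb_pos, forall y, angular (fun z => H1 z - H2 z) y = angular H1 y - angular H2 y}.
Proof.
move=> m1 m2; rewrite -energy_unroll// -energy_unroll// => E1 E2.
have a1 := ae_energy_fin (cmeas_unroll m1) E1.
have a2 := ae_energy_fin (cmeas_unroll m2) E2.
apply: filterS2 a1 a2 => y y1 y2; rewrite /angular cintB//.
  exact: cintegrable_arc (cmeas_pair1 y (cmeas_unroll m1)) y1.
exact: cintegrable_arc (cmeas_pair1 y (cmeas_unroll m2)) y2.
Qed.

(** Averaging over circles is continuous on square-integrable functions. *)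
Lemma angular_cvg (h : nat -> S * plane -> R[i]) H :
  (forall k, cmeas (h k)) -> cmeas H ->
  (forall k, (energy (sig \X pl) (h k) < +oo)%E) -> (energy (sig \X pl) H < +oo)%E ->
  (fun k => energy (sig \X pl) (fun z => h k z - H z)) @ \oo --> 0%E ->
  (fun k => energy (sig \X leb_pos) (angular (h k))) @ \oo -->
  energy (sig \X leb_pos) (angular H).
Proof.
move=> mh mH Eh EH hH.
have mD k : cmeas (fun z => h k z - H z) by exact: cmeasB.
rewrite -pint2; under eq_fun do rewrite -pint2.
apply: pint_cvg => //.
- by move=> k; exact: cmeas_angular.
- exact: cmeas_angular.
- by move=> k; rewrite pint2; exact: energy_angular_fin.
have E k : pint (sig \X leb_pos) 2 (fun y => angular (h k) y - angular H y) =
    energy (sig \X leb_pos) (angular (fun z => h k z - H z)).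
  rewrite pint2; apply: ae_eq_energy.
  - by apply: cmeasB; exact: cmeas_angular.
  - exact: cmeas_angular.
  - by apply: filterS (angularB (mh k) mH (Eh k) EH) => y ->.
have ED k := energyB_fin (mh k) mH (Eh k) EH.
under eq_fun do rewrite E.
have P0 : 0 < pi :> R := pi_gt0 R.
apply/cvge0P => [k|e e0]; first exact: energy_ge0.
have e1 : 0 < e / pi by rewrite divr_gt0.
have := (cvge0P (fun k => energy_ge0 _ _)).1 hH _ e1; apply: filterS => k hk.
apply: le_trans (energy_angular_le (mD k) (ED k)) _.
apply: le_trans (lee_pmul (y1 := pi%:E) _ (energy_ge0 _ _) (lexx _) hk) _.
  by rewrite lee_fin ltW.
by rewrite -EFinM lee_fin mulrC mulfVK// gt_eqF.
Qed.

Context d' (S' : measurableType d') (sig' : {sigma_finite_measure set S' -> \bar R}).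
Variables (th : S' -> S -> R) (c : R) (q : S -> R).
Hypothesis pp : plancherel_pair sig sig' th c.
Hypotheses (c_ge0 : 0 <= c) (mq : measurable_fun setT q).

(** The phase of a tensor power in orthogonal coordinates has this form: the
    plane variable enters through its squared length only. *)
Definition ext H (x : measurableTypeR R * S') : R[i] :=
  cint (sig \X pl) (fun z => H z * chi (th x.2 z.1 + x.1 * (q z.1 + rho z.2))).

Lemma extension_angular H x : cintegrable (sig \X pl) H ->
  ext H x = cint (sig \X leb_pos) (fun y =>
    angular H y * chi (th x.2 y.1 + x.1 * y.2 + x.1 * q y.1)).
Proof.
move=> iH; have mH := cintegrable_cmeas iH.
have mph : measurable_fun setT (fun z : S * measurableTypeR R * plane =>
    th x.2 z.1.1 + x.1 * z.1.2 + x.1 * q z.1.1).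
  have m1 : measurable_fun setT (fun z : S * measurableTypeR R * plane => z.1.1).
    exact: measurableT_comp.
  apply: measurable_funD; first apply: measurable_funD.
  - exact: (measurableT_comp (measurable_phase pp x.2) m1).
  - by apply: measurable_funM; [exact: measurable_cst|exact: measurableT_comp].
  - by apply: measurable_funM; [exact: measurable_cst|exact: (measurableT_comp mq m1)].
pose f (z : S * measurableTypeR R * plane) :=
  H (unroll z) * chi (th x.2 z.1.1 + x.1 * z.1.2 + x.1 * q z.1.1).
have iU := cintegrable_unroll iH.
have if_ : cintegrable ((sig \X leb_pos) \X arc) f by exact: cintegrable_mul_chi.
have mf := cintegrable_cmeas if_.
transitivity (cint ((sig \X leb_pos) \X arc) f).
  rewrite -(mpres_cint mpres_pol mf); congr (cint _ _); apply/funext => z.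
  by rewrite /f polK /pol /=; congr (_ * chi _); ring.
rewrite cint_fubini//; apply: ae_eq_cint.
- exact: cmeas_cint.
- apply: cmeasM; first exact: cmeas_angular.
  apply: cmeas_chi_comp; apply: measurable_funD; first apply: measurable_funD.
  - exact: (measurableT_comp (measurable_phase pp x.2) measurable_fst).
  - by apply: measurable_funM; [exact: measurable_cst|exact: measurable_snd].
  - by apply: measurable_funM; [exact: measurable_cst|exact: (measurableT_comp mq measurable_fst)].
have := ae_cintegrable iU; apply: filterS => y iy /=.
by rewrite /f /= -[LHS](congr1 (cint arc) (funext (fun w => mulrC _ _))) cintZ// mulrC.
Qed.

(** The extension of [H] is the Fourier transform of its circular averages, in
    a twisted but norm-preserving form. *)
Lemma energy_extension H : cintegrable (sig \X pl) H -> (energy (sig \X pl) H < +oo)%E ->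
  energy (leb \X sig') (ext H) =
  ((c * (2 * pi))%:E * energy (sig \X leb_pos) (angular H))%E.
Proof.
move=> iH EH; have mH := cintegrable_cmeas iH.
have pi2 : 0 <= 2 * pi :> R by rewrite mulr_ge0 ?pi_ge0.
have mw : measurable_fun setT (fun z : measurableTypeR R * S => z.1 * q z.2).
  by apply: measurable_funM => //; exact: (measurableT_comp mq measurable_snd).
have [_ P] := plancherel_twist pp plancherel_half_line c_ge0 pi2 (w := fun t s => t * q s) mw.
rewrite -P; last 2 first.
- exact: (cintegrable_fubini (cintegrable_unroll iH)).
- exact: energy_angular_fin.
by congr (energy _ _); apply/funext => x; exact: extension_angular.
Qed.

End core.

(** * Products of copies of one function, in orthogonal coordinates *)

Section tensor_limits.
Context {R : realType}.

Lemma energy_cvg0D d (X : measurableType d) (mu : {measure set X -> \bar R})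
    (f g : nat -> X -> R[i]) :
  (forall k, cmeas (f k)) -> (forall k, cmeas (g k)) ->
  (fun k => energy mu (f k)) @ \oo --> 0%E ->
  (fun k => energy mu (g k)) @ \oo --> 0%E ->
  (fun k => energy mu (fun x => f k x + g k x)) @ \oo --> 0%E.
Proof.
move=> mf mg; under eq_fun do rewrite -pint2; under [in X in _ -> X -> _]eq_fun do rewrite -pint2.
under [in X in _ -> _ -> X]eq_fun do rewrite -pint2.
move=> /(pint_cvg0P _ _ (ltn0Sn 1)) f0 /(pint_cvg0P _ _ (ltn0Sn 1)) g0.
apply/(pint_cvg0P _ _ (ltn0Sn 1)).
apply: (@squeeze_cvge _ _ _ _ (fun=> 0%E) _
  (fun k => cLnorm mu setT 2 (f k) + cLnorm mu setT 2 (g k))%E).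
- by apply: nearW => k; rewrite cLnorm_ge0 /=; exact: (cLnormD _ (ltn0Sn 1)).
- exact: cvg_cst.
- by rewrite -[X in _ --> X]adde0; exact: cvgeD.
Qed.

Lemma energy_cvg d (X : measurableType d) (mu : {measure set X -> \bar R})
    (f : nat -> X -> R[i]) g :
  (forall k, cmeas (f k)) -> cmeas g -> (forall k, energy mu (f k) < +oo)%E ->
  (fun k => energy mu (fun x => f k x - g x)) @ \oo --> 0%E ->
  (fun k => energy mu (f k)) @ \oo --> energy mu g.
Proof.
move=> mf mg ffin; rewrite -pint2; under eq_fun do rewrite -pint2.
under [in X in _ -> X]eq_fun do rewrite -pint2.
by apply: pint_cvg => // k; rewrite pint2.
Qed.

Lemma energy_lim_fin d (X : measurableType d) (mu : {measure set X -> \bar R})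
    (f : nat -> X -> R[i]) g :
  (forall k, cmeas (f k)) -> cmeas g -> (forall k, energy mu (f k) < +oo)%E ->
  (fun k => energy mu (fun x => f k x - g x)) @ \oo --> 0%E ->
  (energy mu g < +oo)%E.
Proof.
move=> mf mg ffin; under eq_fun do rewrite -pint2.
move=> /(pint_cvg0P _ _ (ltn0Sn 1)) h; rewrite -pint2; apply/(pint_fin _ _ (ltn0Sn 1)).
apply: (cLnorm_cvg (ltn0Sn 1) mf mg _ h).2 => k.
by apply/(pint_fin _ _ (ltn0Sn 1)); rewrite pint2.
Qed.

Lemma tensor_cvg d1 d2 (X : measurableType d1) (Y : measurableType d2)
    (mu : {sigma_finite_measure set X -> \bar R})
    (nu : {sigma_finite_measure set Y -> \bar R})
    (f : nat -> X -> R[i]) (g : nat -> Y -> R[i]) f' g' :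
  (forall k, cmeas (f k)) -> (forall k, cmeas (g k)) -> cmeas f' -> cmeas g' ->
  (forall k, energy mu (f k) < +oo)%E -> (forall k, energy nu (g k) < +oo)%E ->
  (fun k => energy mu (fun x => f k x - f' x)) @ \oo --> 0%E ->
  (fun k => energy nu (fun x => g k x - g' x)) @ \oo --> 0%E ->
  (fun k => energy (mu \X nu) (fun z => f k z.1 * g k z.2 - f' z.1 * g' z.2)) @ \oo --> 0%E.
Proof.
move=> mf mg mf' mg' ff gf cf cg.
have E k : (fun z : X * Y => f k z.1 * g k z.2 - f' z.1 * g' z.2) =
    (fun z => (f k z.1 - f' z.1) * g k z.2 + f' z.1 * (g k z.2 - g' z.2)).
  by apply/funext => z; ring.
under eq_fun do rewrite E.
have m1 k : cmeas (fun x => f k x - f' x) by exact: cmeasB.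
have m2 k : cmeas (fun x => g k x - g' x) by exact: cmeasB.
have f'fin := energy_lim_fin mf mf' ff cf; have g'fin := energy_lim_fin mg mg' gf cg.
apply: energy_cvg0D.
- by move=> k; exact: (cmeas_tensor (m1 k) (mg k)).
- by move=> k; exact: (cmeas_tensor mf' (m2 k)).
- under eq_fun => k do rewrite (energy_tensor _ _ (m1 k) (mg k)).
  rewrite -(mul0e (energy nu g')); apply: cvgeM => //; last exact: energy_cvg.
  by rewrite mule_def_fin// ge0_fin_numE// energy_ge0.
- under eq_fun => k do rewrite (energy_tensor _ _ mf' (m2 k)).
  rewrite -(mule0 (energy mu f')); apply: cvgeM => //; last exact: cvg_cst.
  by rewrite mule_def_fin// ge0_fin_numE// energy_ge0.
Qed.

Lemma sqnX (z : R[i]) m : sqn (z ^+ m) = sqn z ^+ m.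
Proof.
elim: m => [|m IH]; first by rewrite !expr0 (sqnR 1) expr1n.
by rewrite !exprS sqnM IH.
Qed.

Lemma pint_energyX d (X : measurableType d) (mu : {measure set X -> \bar R}) m
    (f : X -> R[i]) : pint mu (2 * m) f = energy mu (fun x => f x ^+ m).
Proof. by apply: eq_integral => x _; rewrite exprM normcX2 sqnX. Qed.

End tensor_limits.

Section space_time_functional.
Context {R : realType}.
Notation plane := (measurableTypeR R * measurableTypeR R)%type.
Notation pl := (leb \X leb : {sigma_finite_measure set plane -> \bar R}).
Context d d' dW (S : measurableType d) (S' : measurableType d') (W : measurableType dW).
Variables (sig : {sigma_finite_measure set S -> \bar R})
  (sig' : {sigma_finite_measure set S' -> \bar R}) (om : {measure set W -> \bar R}).
Variables (th : S' -> S -> R) (c : R) (q : S -> R).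
Hypothesis pp : plancherel_pair sig sig' th c.
Hypotheses (c_ge0 : 0 <= c) (mq : measurable_fun setT q).
Variable tens : (W -> R[i]) -> S * plane -> R[i].
Hypothesis cmeas_tens : forall f, cmeas f -> cmeas (tens f).
Hypothesis energy_tens_fin : forall f, cmeas f -> (energy om f < +oo)%E ->
  (energy (sig \X pl) (tens f) < +oo)%E.

(** By [energy_extension], the energy of the extension of [tens f]. The formula
    makes sense, and is continuous, for every square-integrable [f], whereas
    the integral defining the extension requires integrability. *)
Definition spacetime_energy f : \bar R :=
  ((c * (2 * pi))%:E * energy (sig \X leb_pos) (angular (tens f)))%E.

Let C_ge0 : 0 <= c * (2 * pi). Proof. by rewrite mulr_ge0// mulr_ge0 ?pi_ge0. Qed.

Lemma spacetime_energyE f : cintegrable (sig \X pl) (tens f) -> cmeas f ->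
  (energy om f < +oo)%E ->
  energy (leb \X sig') (ext sig th q (tens f)) = spacetime_energy f.
Proof.
by move=> intf mf Ef; apply: (energy_extension pp c_ge0 mq intf); exact: energy_tens_fin.
Qed.

Lemma spacetime_energy_le f : cmeas f -> (energy om f < +oo)%E ->
  (spacetime_energy f <= (c * (2 * pi) * pi)%:E * energy (sig \X pl) (tens f))%E.
Proof.
move=> mf Ef; rewrite /spacetime_energy [(_ * pi)%:E]EFinM -[X in (_ <= X)%E]muleA.
apply: lee_wpmul2l; first by rewrite lee_fin.
by apply: energy_angular_le; [exact: cmeas_tens|exact: energy_tens_fin].
Qed.

Lemma spacetime_energy_eq f : c != 0 -> cmeas f -> (energy om f < +oo)%E ->
  spacetime_energy f = ((c * (2 * pi) * pi)%:E * energy (sig \X pl) (tens f))%E ->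
  {ae sig \X pl, forall z, tens f z = angular (tens f) (z.1, rho z.2) * (pi^-1)%:C}.
Proof.
move=> c0 mf Ef; rewrite /spacetime_energy [(_ * pi)%:E]EFinM -[X in _ = X -> _]muleA.
have k0 : (c * (2 * pi))^-1%:E \is a fin_num by [].
move=> /(congr1 (fun t => (c * (2 * pi))^-1%:E * t)%E); rewrite !muleA -!EFinM mulVf ?mul1e.
  by rewrite mul1r; apply: angular_eq_radial; [exact: cmeas_tens|exact: energy_tens_fin].
by rewrite !mulf_neq0// pi_neq0.
Qed.

Lemma spacetime_energy_radial f (Phi : S * measurableTypeR R -> R[i]) : cmeas Phi ->
  cmeas f -> (forall z, tens f z = Phi (z.1, rho z.2)) ->
  spacetime_energy f = ((c * (2 * pi) * pi)%:E * energy (sig \X pl) (tens f))%E.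
Proof.
move=> mPhi mf fP; rewrite /spacetime_energy (radial_eq_angular sig mPhi fP (cmeas_tens mf)).
by rewrite muleA -EFinM.
Qed.

Lemma spacetime_energy_cvg (h : nat -> W -> R[i]) f :
  (forall k, cmeas (h k)) -> cmeas f ->
  (forall k, energy om (h k) < +oo)%E -> (energy om f < +oo)%E ->
  (fun k => energy (sig \X pl) (fun z => tens (h k) z - tens f z)) @ \oo --> 0%E ->
  (fun k => spacetime_energy (h k)) @ \oo --> spacetime_energy f.
Proof.
move=> mh mf hfin Ef hf.
have mt := cmeas_tens mf; have mth k := cmeas_tens (mh k).
have et := energy_tens_fin mf Ef; have eth k := energy_tens_fin (mh k) (hfin k).
have c1 := angular_cvg mth mt eth et hf.
apply: (cvgeM _ (cvg_cst _) c1).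
by rewrite mule_def_fin// ge0_fin_numE ?energy_ge0// energy_angular_fin.
Qed.

End space_time_functional.

Section line.
Context {R : realType}.
Notation line := (measurableTypeR R).
Notation plane := (measurableTypeR R * measurableTypeR R)%type.

Lemma sqr_sqrt2 : Num.sqrt 2 ^+ 2 = 2 :> R. Proof. by rewrite sqr_sqrtr. Qed.
Lemma sqr_sqrt3 : Num.sqrt 3 ^+ 2 = 3 :> R. Proof. by rewrite sqr_sqrtr. Qed.
Lemma sqrt2_neq0 : Num.sqrt 2 != 0 :> R. Proof. by rewrite gt_eqF// sqrtr_gt0. Qed.
Lemma sqrt3_neq0 : Num.sqrt 3 != 0 :> R. Proof. by rewrite gt_eqF// sqrtr_gt0. Qed.

(** An isometry of three-space taking the first axis to the diagonal. *)
Definition coords1 (z : line * plane) : line * plane :=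
  let e := (Num.sqrt 2 * z.1 + z.2.2) / Num.sqrt 3 in
  ((z.1 - Num.sqrt 2 * z.2.2) / Num.sqrt 3,
   ((z.2.1 + e) / Num.sqrt 2, (e - z.2.1) / Num.sqrt 2)).

Lemma coords1_sum z : (coords1 z).1 + ((coords1 z).2.1 + (coords1 z).2.2) = Num.sqrt 3 * z.1.
Proof.
rewrite /coords1 /=; have := sqr_sqrt2; have := sqr_sqrt3.
have := sqrt2_neq0; have := sqrt3_neq0.
move: (Num.sqrt 2) (Num.sqrt 3) => a b b0 a0 b2 a2.
have h : (2 : R) / a = a by rewrite -a2; field.
have h3 : (3 : R) / b = b by rewrite -b2; field.
transitivity ((z.1 - a * z.2.2) / b + (2 / a) * ((a * z.1 + z.2.2) / b)).
  by field; rewrite a0 b0.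
rewrite h -[in RHS]h3; transitivity ((1 + a ^+ 2) * z.1 / b); first by field.
by rewrite a2; field.
Qed.

Lemma coords1_sqr z : (coords1 z).1 ^+ 2 + ((coords1 z).2.1 ^+ 2 + (coords1 z).2.2 ^+ 2) =
  z.1 ^+ 2 + rho z.2.
Proof.
rewrite /coords1 /rho /=; have := sqr_sqrt2; have := sqr_sqrt3.
move: (Num.sqrt 2) (Num.sqrt 3) => a b b2 a2.
rewrite !expr_div_n b2 a2; set e := (_ + _) / b.
transitivity ((z.1 - a * z.2.2) ^+ 2 / 3 + (z.2.1 ^+ 2 + e ^+ 2)); first by field.
rewrite /e expr_div_n b2.
transitivity ((1 + a ^+ 2) * (z.1 ^+ 2 + z.2.2 ^+ 2) / 3 + z.2.1 ^+ 2); first by field.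
by rewrite a2; field.
Qed.

(** A composition of two isometries of planes: one in the coordinates [z.1] and
    [z.2.2], and one in the last two coordinates of the result. *)
Lemma mpres_coords1 : mpres (leb \X (leb \X leb)) (leb \X (leb \X leb)) coords1.
Proof.
have := sqr_sqrt2; have := sqr_sqrt3; have := sqrt2_neq0; have := sqrt3_neq0.
rewrite /coords1; move: (Num.sqrt 2) (Num.sqrt 3) => a b b0 a0 b2 a2.
have d1 : `|b^-1 * b^-1 - - (a / b) * (a / b)| = 1.
  rewrite (_ : _ - _ = (1 + a ^+ 2) / b ^+ 2); last by field.
  by rewrite a2 b2 divff ?normr1// pnatr_eq0.
have d2 : `|a^-1 * - a^-1 - a^-1 * a^-1| = 1.
  rewrite (_ : _ - _ = - (2 / a ^+ 2)); last by field.
  by rewrite a2 divff ?normrN1// pnatr_eq0.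
have m1 := mpres_prod (mpres_id (@leb R)) (mpres_swap (@leb R) leb).
have m2 := mpres_prod (mpres_linear2 d1) (mpres_id (@leb R)).
have m3 := mpres_prod (mpres_id (@leb R)) (mpres_linear2 d2).
have := mpres_comp (mpres_comp (mpres_comp (mpres_comp m1 (mpres_assocV _ _ _)) m2) (mpres_assoc _ _ _)) m3.
set f := (fun x => _); set g := (fun z => _); suff -> : f = g by [].
apply/funext => z; rewrite /f /g /=.
by case: z => s [x y] /=; congr (_, (_, _)); ring.
Qed.

Section tensor1.
Implicit Type f : line -> R[i].

Definition triple f (w : line * plane) : R[i] := f w.1 * (f w.2.1 * f w.2.2).

Definition tens1 f (z : line * plane) : R[i] := triple f (coords1 z).

Lemma cmeas_triple f : cmeas f -> cmeas (triple f).
Proof.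
move=> mf; have m2 : cmeas (fun z : plane => f z.1 * f z.2) := cmeas_tensor mf mf.
exact: (cmeas_tensor mf m2).
Qed.

Lemma cmeas_tens1 f : cmeas f -> cmeas (tens1 f).
Proof. by move=> mf; exact: (cmeas_comp (cmeas_triple mf) mpres_coords1.1). Qed.

Lemma cintegrable_triple f : cintegrable leb f ->
  cintegrable (leb \X (leb \X leb)) (triple f).
Proof.
move=> mf; have m2 : cintegrable (leb \X leb) (fun z : plane => f z.1 * f z.2).
  exact: cintegrable_tensor.
exact: (cintegrable_tensor mf m2).
Qed.

Lemma cint_triple f : cintegrable leb f ->
  cint (leb \X (leb \X leb)) (triple f) = cint leb f ^+ 3.
Proof.
move=> mf; have m2 : cintegrable (leb \X leb) (fun z : plane => f z.1 * f z.2).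
  exact: cintegrable_tensor.
rewrite /triple (cint_tensor mf m2) (cint_tensor mf mf) exprS expr2.
by [].
Qed.

Lemma cintegrable_tens1 f : cintegrable leb f ->
  cintegrable (leb \X (leb \X leb)) (tens1 f).
Proof.
move=> mf; apply/(mpres_cintegrable mpres_coords1); last exact: cintegrable_triple.
exact: cmeas_triple (cintegrable_cmeas mf).
Qed.

Lemma energy_tens1 f : cmeas f ->
  energy (leb \X (leb \X leb)) (tens1 f) = (energy leb f * (energy leb f * energy leb f))%E.
Proof.
move=> mf; have m2 : cmeas (fun z : plane => f z.1 * f z.2) := cmeas_tensor mf mf.
rewrite (mpres_energy mpres_coords1 (cmeas_triple mf)).
by rewrite (energy_tensor _ _ mf m2) (energy_tensor _ _ mf mf).
Qed.

Lemma energy_mul_fin (a b : \bar R) : (0 <= a -> a < +oo -> 0 <= b -> b < +oo -> a * b < +oo)%E.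
Proof. by move=> a0 ay b0 bY; rewrite lte_mul_pinfty// ge0_fin_numE. Qed.

Lemma energy_tens1_fin f : cmeas f -> (energy leb f < +oo)%E ->
  (energy (leb \X (leb \X leb)) (tens1 f) < +oo)%E.
Proof.
move=> mf Ef; rewrite energy_tens1//.
by repeat (apply: energy_mul_fin; rewrite ?mule_ge0 ?energy_ge0//).
Qed.

Lemma tens1_cvg (h : nat -> line -> R[i]) f : (forall k, cmeas (h k)) -> cmeas f ->
  (forall k, energy leb (h k) < +oo)%E ->
  (fun k => energy leb (fun x => h k x - f x)) @ \oo --> 0%E ->
  (fun k => energy (leb \X (leb \X leb)) (fun z => tens1 (h k) z - tens1 f z)) @ \oo --> 0%E.
Proof.
move=> mh mf hfin hf.
have E k : energy (leb \X (leb \X leb)) (fun z => tens1 (h k) z - tens1 f z) =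
    energy (leb \X (leb \X leb)) (fun w => triple (h k) w - triple f w).
  have m := cmeasB (cmeas_triple (mh k)) (cmeas_triple mf).
  by rewrite -(mpres_energy mpres_coords1 m).
under eq_fun do rewrite E.
have m2 k : cmeas (fun z : plane => h k z.1 * h k z.2) := cmeas_tensor (mh k) (mh k).
have m2f : cmeas (fun z : plane => f z.1 * f z.2) := cmeas_tensor mf mf.
apply: (tensor_cvg mh m2 mf m2f hfin _ hf); last exact: tensor_cvg.
move=> k; rewrite (energy_tensor _ _ (mh k) (mh k)).
by apply: energy_mul_fin; rewrite ?energy_ge0//.
Qed.

(** The extension operator of the parabola, without normalisation. *)
Definition ext1 f (z : line * line) : R[i] :=
  cint leb (fun w => f w * chi (z.1 * w ^+ 2 + z.2 * w)).

(** The cube is an integral over three copies of the line, whose phase involves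
    only the sum of the three frequencies and the sum of their squares, that is,
    [coords1_sum] and [coords1_sqr]. *)
Lemma ext1_cube f z : cintegrable leb f ->
  ext1 f z ^+ 3 = ext leb (fun x s : line => Num.sqrt 3 * x * s) (fun s : line => s ^+ 2) (tens1 f) z.
Proof.
move=> intf; have mf := cintegrable_cmeas intf.
pose g w := f w * chi (z.1 * w ^+ 2 + z.2 * w).
have ig : cintegrable leb g.
  apply: cintegrable_mul_chi => //; apply: measurable_funD.
    by apply: measurable_funM; [exact: measurable_cst|exact: measurable_funX].
  by apply: measurable_funM => //; exact: measurable_cst.
have mg := cintegrable_cmeas ig.
rewrite -[LHS](cint_triple ig) -(mpres_cint mpres_coords1 (cmeas_triple mg)).
congr (cint _ _); apply/funext => y.
rewrite /ext /tens1 /triple /g.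
have -> : Num.sqrt 3 * z.2 * y.1 + z.1 * (y.1 ^+ 2 + rho y.2) =
    (z.1 * (coords1 y).1 ^+ 2 + z.2 * (coords1 y).1) +
    ((z.1 * (coords1 y).2.1 ^+ 2 + z.2 * (coords1 y).2.1) +
     (z.1 * (coords1 y).2.2 ^+ 2 + z.2 * (coords1 y).2.2)).
  by rewrite -coords1_sqr -mulrA (mulrCA _ z.2) -coords1_sum; ring.
by rewrite !chiD; ring.
Qed.

Lemma pint_ext1 f : cintegrable leb f -> (energy leb f < +oo)%E ->
  pint (leb \X leb) 6 (ext1 f) =
  spacetime_energy leb (2 * pi / Num.sqrt 3) tens1 f.
Proof.
move=> intf Ef; have mf := cintegrable_cmeas intf.
rewrite (pint_energyX _ 3).
under eq_fun do rewrite ext1_cube//.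
have pp := plancherel_scaled (@sqrt3_neq0).
rewrite ger0_norm ?sqrtr_ge0// in pp.
have mq : measurable_fun setT (fun s : line => s ^+ 2) by exact: measurable_funX.
apply: (spacetime_energyE pp _ mq _ (cintegrable_tens1 intf) mf Ef).
  by rewrite divr_ge0 ?sqrtr_ge0// mulr_ge0 ?pi_ge0.
exact: energy_tens1_fin.
Qed.

End tensor1.
End line.

Section plane.
Context {R : realType}.
Notation line := (measurableTypeR R).
Notation plane := (measurableTypeR R * measurableTypeR R)%type.
Notation pl := (leb \X leb : {sigma_finite_measure set plane -> \bar R}).

Lemma mpres_shuffle : mpres (pl \X pl) (pl \X pl)
  (fun z => ((z.1.1, z.2.1), (z.1.2, z.2.2))).
Proof.
have m2 := mpres_prod (mpres_id (@leb R)) (mpres_assocV (@leb R) leb leb).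
have m3 := mpres_prod (mpres_id (@leb R)) (mpres_prod (mpres_swap (@leb R) leb) (mpres_id (@leb R))).
have m4 := mpres_prod (mpres_id (@leb R)) (mpres_assoc (@leb R) leb leb).
exact: (mpres_comp (mpres_comp (mpres_comp (mpres_comp (mpres_assoc _ _ _) m2) m3) m4) (mpres_assocV _ _ _)).
Qed.

(** An isometry of four-space taking the first plane to the diagonal. *)
Definition coords2 (z : plane * plane) : plane * plane :=
  (((z.1.1 + z.2.1) / Num.sqrt 2, (z.1.2 + z.2.2) / Num.sqrt 2),
   ((z.1.1 - z.2.1) / Num.sqrt 2, (z.1.2 - z.2.2) / Num.sqrt 2)).

Lemma coords2_sum z :
  (coords2 z).1.1 + (coords2 z).2.1 = Num.sqrt 2 * z.1.1 /\
  (coords2 z).1.2 + (coords2 z).2.2 = Num.sqrt 2 * z.1.2.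
Proof.
rewrite /coords2 /=; have := sqr_sqrt2 (R := R); have := sqrt2_neq0 (R := R).
move: (Num.sqrt 2) => a a0 a2; have h : (2 : R) / a = a by rewrite -a2; field.
have k (s t : R) : (s + t) / a + (s - t) / a = a * s by rewrite -[in RHS]h; field.
by rewrite !k.
Qed.

Lemma coords2_sqr z : rho (coords2 z).1 + rho (coords2 z).2 = rho z.1 + rho z.2.
Proof.
rewrite /coords2 /rho /=; have := sqr_sqrt2 (R := R).
by move: (Num.sqrt 2) => a a2; rewrite !expr_div_n a2; field.
Qed.

Lemma mpres_coords2 : mpres (pl \X pl) (pl \X pl) coords2.
Proof.
have := sqr_sqrt2 (R := R); have := sqrt2_neq0 (R := R).
rewrite /coords2; move: (Num.sqrt 2) => a a0 a2.
have d2 : `|a^-1 * - a^-1 - a^-1 * a^-1| = 1.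
  rewrite (_ : _ - _ = - (2 / a ^+ 2)); last by field.
  by rewrite a2 divff ?normrN1// pnatr_eq0.
have l2 := mpres_linear2 d2.
have := mpres_comp (mpres_comp mpres_shuffle (mpres_prod l2 l2)) mpres_shuffle.
set f := (fun x => _); set g := (fun z => _); suff -> : f = g by [].
apply/funext => -[[s1 s2] [x y]]; rewrite /f /g /=.
by congr (_, _); congr (_, _); ring.
Qed.

Section tensor2.
Implicit Type f : plane -> R[i].

Definition double f (w : plane * plane) : R[i] := f w.1 * f w.2.

Definition tens2 f (z : plane * plane) : R[i] := double f (coords2 z).

Lemma cmeas_double f : cmeas f -> cmeas (double f).
Proof. by move=> mf; exact: (cmeas_tensor mf mf). Qed.

Lemma cmeas_tens2 f : cmeas f -> cmeas (tens2 f).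
Proof. by move=> mf; exact: (cmeas_comp (cmeas_double mf) mpres_coords2.1). Qed.

Lemma cintegrable_tens2 f : cintegrable pl f -> cintegrable (pl \X pl) (tens2 f).
Proof.
move=> mf; apply/(mpres_cintegrable mpres_coords2); last exact: cintegrable_tensor.
exact: cmeas_double (cintegrable_cmeas mf).
Qed.

Lemma energy_tens2 f : cmeas f ->
  energy (pl \X pl) (tens2 f) = (energy pl f * energy pl f)%E.
Proof.
move=> mf; rewrite (mpres_energy mpres_coords2 (cmeas_double mf)).
exact: (energy_tensor _ _ mf mf).
Qed.

Lemma energy_tens2_fin f : cmeas f -> (energy pl f < +oo)%E ->
  (energy (pl \X pl) (tens2 f) < +oo)%E.
Proof.
move=> mf Ef; rewrite energy_tens2//.
by apply: energy_mul_fin; rewrite ?energy_ge0.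
Qed.

Lemma tens2_cvg (h : nat -> plane -> R[i]) f : (forall k, cmeas (h k)) -> cmeas f ->
  (forall k, energy pl (h k) < +oo)%E ->
  (fun k => energy pl (fun x => h k x - f x)) @ \oo --> 0%E ->
  (fun k => energy (pl \X pl) (fun z => tens2 (h k) z - tens2 f z)) @ \oo --> 0%E.
Proof.
move=> mh mf hfin hf.
have E k : energy (pl \X pl) (fun z => tens2 (h k) z - tens2 f z) =
    energy (pl \X pl) (fun w => double (h k) w - double f w).
  have m := cmeasB (cmeas_double (mh k)) (cmeas_double mf).
  by rewrite -(mpres_energy mpres_coords2 m).
under eq_fun do rewrite E.
exact: (tensor_cvg mh mh mf mf hfin hfin hf hf).
Qed.

(** The extension operator of the paraboloid in three-space, without
    normalisation. *)
Definition ext2 f (z : line * plane) : R[i] :=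
  cint pl (fun w => f w * chi (z.1 * rho w + (z.2.1 * w.1 + z.2.2 * w.2))).

Definition phase2 (x s : plane) : R :=
  Num.sqrt 2 * x.1 * s.1 + Num.sqrt 2 * x.2 * s.2.

(** The phase of a product of two copies involves only the sum of the two
    frequencies and the sum of their squared lengths. *)
Lemma ext2_square f z : cintegrable pl f ->
  ext2 f z ^+ 2 = ext pl phase2 rho (tens2 f) z.
Proof.
move=> intf; have mf := cintegrable_cmeas intf.
pose g w := f w * chi (z.1 * rho w + (z.2.1 * w.1 + z.2.2 * w.2)).
have ig : cintegrable pl g.
  apply: cintegrable_mul_chi => //; apply: measurable_funD.
    by apply: measurable_funM; [exact: measurable_cst|exact: measurable_rho].
  by apply: measurable_funD; (apply: measurable_funM; first exact: measurable_cst);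
    [exact: measurable_fst|exact: measurable_snd].
have mg := cintegrable_cmeas ig.
rewrite expr2 -[LHS](cint_tensor ig ig) -(mpres_cint mpres_coords2 (cmeas_double mg)).
congr (cint _ _); apply/funext => y.
rewrite /tens2 /double /g /phase2.
have [s1 s2] := coords2_sum y.
have -> : Num.sqrt 2 * z.2.1 * y.1.1 + Num.sqrt 2 * z.2.2 * y.1.2 + z.1 * (rho y.1 + rho y.2) =
    (z.1 * rho (coords2 y).1 + (z.2.1 * (coords2 y).1.1 + z.2.2 * (coords2 y).1.2)) +
    (z.1 * rho (coords2 y).2 + (z.2.1 * (coords2 y).2.1 + z.2.2 * (coords2 y).2.2)).
  rewrite -coords2_sqr -!mulrA (mulrCA _ z.2.1) (mulrCA _ z.2.2) -s1 -s2; ring.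
by rewrite [in RHS]chiD; ring.
Qed.

Lemma plancherel_phase2 : plancherel_pair pl pl phase2
  (2 * pi / Num.sqrt 2 * (2 * pi / Num.sqrt 2)).
Proof.
have pp := plancherel_scaled (@sqrt2_neq0 R).
rewrite ger0_norm ?sqrtr_ge0// in pp.
have c0 : 0 <= 2 * pi / Num.sqrt 2 :> R.
  by rewrite divr_ge0 ?sqrtr_ge0// mulr_ge0 ?pi_ge0.
exact: (plancherel_product pp pp c0 c0).
Qed.

Lemma pint_ext2 f : cintegrable pl f -> (energy pl f < +oo)%E ->
  pint (leb \X pl) 4 (ext2 f) =
  spacetime_energy pl (2 * pi / Num.sqrt 2 * (2 * pi / Num.sqrt 2)) tens2 f.
Proof.
move=> intf Ef; have mf := cintegrable_cmeas intf.
rewrite (pint_energyX _ 2).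
under eq_fun do rewrite ext2_square//.
apply: (spacetime_energyE plancherel_phase2 _ measurable_rho _ (cintegrable_tens2 intf) mf Ef).
  have c0 : 0 <= 2 * pi / Num.sqrt 2 :> R.
    by rewrite divr_ge0 ?sqrtr_ge0// mulr_ge0 ?pi_ge0.
  exact: mulr_ge0.
exact: energy_tens2_fin.
Qed.

End tensor2.
End plane.

(** * The transform of a square-integrable density on the paraboloid *)

Section paraboloid_measure.
Context {R : realType} (n : nat).
Local Notation Rn := (n.-tuple (measurableTypeR R)).
Local Notation lift := (@lift_parab R n).
Local Notation P := (paraboloid R n).

Lemma measurable_lift : measurable_fun setT lift.
Proof. exact: (measurable_funPT lift). Qed.

Lemma measurable_dotp d (T : measurableType d) (a b : T -> Rn) :
  measurable_fun setT a -> measurable_fun setT b ->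
  measurable_fun setT (fun t => dotp (a t) (b t)).
Proof.
move=> ma mb; apply: measurable_sum => j; apply: measurable_funM.
  exact: (measurableT_comp (measurable_tnth j) ma).
exact: (measurableT_comp (measurable_tnth j) mb).
Qed.

Lemma measurable_paraboloid : measurable P.
Proof.
have m : measurable_fun setT (fun p : spacetime R n => p.1 - dotp p.2 p.2 : measurableTypeR R).
  apply: measurable_funB; first exact: measurable_fst.
  by apply: measurable_dotp; exact: measurable_snd.
rewrite -[P]setTI (_ : _ `&` _ = setT `&`
   (fun p : spacetime R n => p.1 - dotp p.2 p.2 : measurableTypeR R) @^-1` [set 0]).
  by apply: m => //; exact: measurable_set1.
apply/seteqP; split => p [_ /= h]; split => //=; first by rewrite h subrr.
by apply/eqP; rewrite -subr_eq0; apply/eqP.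
Qed.

Lemma mpres_lift : mpres (lebesgueRn R n) (dsigma R n) lift.
Proof.
split; first exact: measurable_lift.
by move=> F mF F0; rewrite [RHS]ge0_integral_pushforward.
Qed.

Lemma integral_dsigma (F : spacetime R n -> \bar R) : measurable_fun P F ->
  (\int[dsigma R n]_(p in P) F p = \int[lebesgueRn R n]_w F (lift w))%E.
Proof.
move=> mF; rewrite integral_mkcond -(mpres_integral mpres_lift).
  by apply: eq_integral => w _; rewrite patchE mem_set.
by apply/(measurable_restrictT _ measurable_paraboloid).
Qed.

Lemma measurable_on_lift d (T : measurableType d) (F : spacetime R n -> T) :
  measurable_fun P F -> measurable_fun setT (F \o lift).
Proof.
move=> mF; apply: (measurable_comp measurable_paraboloid _ mF measurable_lift).
by move=> _ [w _ <-].
Qed.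

Lemma cmeas_lift (g : spacetime R n -> R[i]) : cmeasurable P g -> cmeas (g \o lift).
Proof. by move=> [g1 g2]; split; [exact: measurable_on_lift g1|exact: measurable_on_lift g2]. Qed.

Lemma cint_dsigma (g : spacetime R n -> R[i]) : cmeasurable P g ->
  cintegral (dsigma R n) P g = cint (lebesgueRn R n) (g \o lift).
Proof.
move=> [/measurable_EFinP g1 /measurable_EFinP g2].
by rewrite /cintegral /Rintegral !integral_dsigma.
Qed.

Lemma cLnorm_dsigma m (g : spacetime R n -> R[i]) : (0 < m)%N -> cmeasurable P g ->
  cLnorm (dsigma R n) P m%:R g = cLnorm (lebesgueRn R n) setT m%:R (g \o lift).
Proof.
move=> m0 mg; rewrite cLnormE /cLnorm unlock; congr (_ `^ _)%E.
have mGr : measurable_fun P (fun p => (ComplexField.Normc.normc (g p) ^+ m)%:E).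
  apply/measurable_EFinP; apply: measurable_funX.
  under eq_fun do rewrite normcE.
  apply: measurableT_comp; first by apply: continuous_measurable_fun; exact: sqrt_continuous.
  by apply: measurable_funD; apply: measurable_funX; [exact: mg.1|exact: mg.2].
transitivity (\int[dsigma R n]_(p in P) (ComplexField.Normc.normc (g p) ^+ m)%:E)%E.
  rewrite [RHS]integral_mkcond; apply: eq_integral => p _; rewrite !patchE.
  case: ifPn => _; first by rewrite abse_EFin ger0_norm ?normc_ge0// poweR_EFin powR_mulrn ?normc_ge0.
  by rewrite abse0 poweR0r// pnatr_eq0 -lt0n.
by rewrite integral_dsigma.
Qed.

Lemma cmeas_paraboloid_snd (f : Rn -> R[i]) : cmeas f -> cmeasurable P (fun p => f p.2).
Proof.
move=> [f1 f2]; split; apply: measurable_funTS.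
  exact: (measurableT_comp f1 measurable_snd).
exact: (measurableT_comp f2 measurable_snd).
Qed.

(** The extension operator of the paraboloid, without normalisation. *)
Definition extn (f : Rn -> R[i]) (z : spacetime R n) : R[i] :=
  cint (lebesgueRn R n) (fun w => f w * chi (z.1 * dotp w w + dotp w z.2)).

Definition fourier_factor : R := (2 * pi) `^ (- (n.+1%:R / 2)).

Lemma fourier_dsigmaE (g : spacetime R n -> R[i]) z : cmeasurable P g ->
  fourier_dsigma g z = fourier_factor%:C * extn (g \o lift) z.
Proof.
move=> [g1 g2]; rewrite /fourier_dsigma cint_dsigma; last first.
  have mph : measurable_fun P (fun p : spacetime R n => z.1 * p.1 + dotp p.2 z.2).
    apply: measurable_funTS; apply: measurable_funD.
      by apply: measurable_funM; [exact: measurable_cst|exact: measurable_fst].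
    by apply: measurable_dotp; [exact: measurable_snd|exact: measurable_cst].
  have mc : measurable_fun P (fun p : spacetime R n => cos (z.1 * p.1 + dotp p.2 z.2)).
    by apply: measurableT_comp => //; apply: continuous_measurable_fun; exact: continuous_cos.
  have ms : measurable_fun P (fun p : spacetime R n => sin (z.1 * p.1 + dotp p.2 z.2)).
    by apply: measurableT_comp => //; apply: continuous_measurable_fun; exact: continuous_sin.
  split.
    under eq_fun do rewrite cexp_chi ReM Re_chi Im_chi mulrN opprK.
    by apply: measurable_funD; exact: measurable_funM.
  under eq_fun do rewrite cexp_chi ImM Re_chi Im_chi mulrN.
  apply: measurable_funD; last exact: measurable_funM.
  by apply: measurableT_comp => //; exact: measurable_funM.
rewrite /fourier_factor /extn; congr (_ * cint _ _); apply/funext => w /=.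
by rewrite cexp_chi.
Qed.

Lemma cmeas_extn f : cmeas f -> cmeas (extn f).
Proof.
move=> mf; apply: (@cmeas_cint R _ _ _ _ (lebesgueRn R n)
  (fun y : spacetime R n * Rn => f y.2 * chi (y.1.1 * dotp y.2 y.2 + dotp y.2 y.1.2))).
have m2 : measurable_fun setT (snd : spacetime R n * Rn -> Rn) by exact: measurable_snd.
apply: cmeasM; first exact: (cmeas_comp mf m2).
apply: cmeas_chi_comp; apply: measurable_funD.
  apply: measurable_funM; last exact: measurable_dotp.
  exact: (measurableT_comp measurable_fst measurable_fst).
apply: measurable_dotp => //.
exact: (measurableT_comp measurable_snd measurable_fst).
Qed.

Lemma extnB f h z : cintegrable (lebesgueRn R n) f -> cintegrable (lebesgueRn R n) h ->
  extn (fun w => f w - h w) z = extn f z - extn h z.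
Proof.
have mph : measurable_fun setT (fun w : Rn => z.1 * dotp w w + dotp w z.2).
  apply: measurable_funD; last by apply: measurable_dotp => //; exact: measurable_cst.
  by apply: measurable_funM; [exact: measurable_cst|exact: measurable_dotp].
have key u : cintegrable (lebesgueRn R n) u ->
    cintegrable (lebesgueRn R n) (fun w => u w * chi (z.1 * dotp w w + dotp w z.2)).
  by move=> iu; exact: cintegrable_mul_chi.
move=> /key jf /key jh; rewrite /extn -cintB//; congr (cint _ _).
by apply/funext => w; rewrite mulrBl.
Qed.

End paraboloid_measure.

Section truncation.
Context {R : realType} d (T : measurableType d).
Variable mu : {sigma_finite_measure set T -> \bar R}.

(** Restricting to sets of finite measure makes a square-integrable function
    integrable as well. *)
Lemma L2_approximation (g : T -> R[i]) : cmeas g -> (energy mu g < +oo)%E ->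
  exists f : nat -> T -> R[i],
    [/\ forall k, cintegrable mu (f k), forall k, (energy mu (f k) < +oo)%E &
        (fun k => energy mu (fun x => f k x - g x)) @ \oo --> 0%E].
Proof.
move=> mg Eg; have /sigma_finiteP[F [TF ndF Foo]] := sigma_finiteT mu.
have mF k : measurable (F k) by have [] := Foo k.
pose I k x : R[i] := (\1_(F k) x)%:C.
have mI k : cmeas (I k) by apply: cmeas_real; exact: measurable_indic.
have EI k : (energy mu (I k) < +oo)%E.
  rewrite /energy /I.
  have E x : sqn (\1_(F k) x : R)%:C = \1_(F k) x.
    by rewrite sqnR indicE; case: (x \in _); rewrite ?expr1n ?expr0n.
  under eq_integral do rewrite E.
  by rewrite integral_indic// setIT; have [] := Foo k.
exists (fun k x => g x * I k x); split.
- by move=> k; exact: cintegrable_mulL2.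
- move=> k; apply: le_lt_trans Eg; apply: ge0_le_integral => //.
  + by move=> x _; rewrite lee_fin sqn_ge0.
  + by apply: measurable_sqn_EFin; exact: cmeasM.
  + exact: measurable_sqn_EFin.
  + move=> x _; rewrite lee_fin sqnM sqnR indicE.
    by case: (x \in F k); rewrite ?expr1n ?mulr1// expr0n mulr0 sqn_ge0.
have iE := energy_integrable mg Eg.
have lim := @dominated_cvg _ _ _ mu setT measurableT
  (fun k x => (sqn (g x * I k x - g x))%:E) (cst 0%E) (fun x => (sqn (g x))%:E).
rewrite -(integral0 mu setT); apply: lim => //.
- move=> k; apply: measurable_sqn_EFin; apply: cmeasB => //; exact: cmeasM.
- move=> x _.
  have [k _ Fk] : (\bigcup_k F k) x by rewrite -TF.
  apply: cvg_near_cst; exists k => // j /= kj.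
  rewrite /I indicE mem_set ?mulr1 ?subrr ?sqn0//.
  by move: x Fk; apply/subsetPset; exact: ndF.
- move=> k x _; rewrite abse_EFin lee_fin ger0_norm ?sqn_ge0// /I indicE.
  by case: (x \in F k); rewrite ?mulr1 ?subrr ?sqn0 ?sqn_ge0// mulr0 sub0r sqnN.
Qed.

End truncation.

Section density.
Context {R : realType} (n m : nat) (m_gt0 : (0 < m)%N).
Local Notation Rn := (n.-tuple (measurableTypeR R)).
Local Notation mu := (lebesgueRn R n).
Local Notation lift := (@lift_parab R n).
Local Notation P := (paraboloid R n).
Local Notation normL2 := (cLnorm mu setT 2).
(** [V] stands for the [m]-th power of the space-time norm of the extension,
    computed from the density alone: unlike the integral defining the
    extension, it makes sense for every square-integrable density. *)
Variables (V : (Rn -> R[i]) -> \bar R) (K : R).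
Hypothesis K_ge0 : 0 <= K.
Hypothesis pint_extn : forall f, cintegrable mu f -> (energy mu f < +oo)%E ->
  pint (lebesgueST R n) m (extn f) = V f.
Hypothesis V_ge0 : forall f, (0 <= V f)%E.
Hypothesis V_le : forall f, cmeas f -> (energy mu f < +oo)%E ->
  (V f <= ((K * fine (normL2 f)) ^+ m)%:E)%E.
Hypothesis V_cvg : forall (h : nat -> Rn -> R[i]) f, (forall k, cmeas (h k)) -> cmeas f ->
  (forall k, energy mu (h k) < +oo)%E -> (energy mu f < +oo)%E ->
  (fun k => energy mu (fun x => h k x - f x)) @ \oo --> 0%E ->
  (fun k => V (h k)) @ \oo --> V f.

Local Notation kap := (fourier_factor n : R).

Let kap_ge0 : 0 <= kap. Proof. exact: powR_ge0. Qed.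

Lemma memL_lift (h : spacetime R n -> R[i]) :
  memL (dsigma R n) P 1 h -> memL (dsigma R n) P 2 h ->
  [/\ cmeas (h \o lift), cintegrable mu (h \o lift) & (energy mu (h \o lift) < +oo)%E].
Proof.
move=> [mh h1] [_ h2]; have mhl := cmeas_lift mh; split=> //.
- move: h1; rewrite (cLnorm_dsigma (ltn0Sn 0) mh) => /(pint_fin _ _ (ltn0Sn 0)) h1.
  apply: (@cintegrable_le _ _ _ _ _ (fun x => ComplexField.Normc.normc ((h \o lift) x))) => //.
  apply/integrableP; split; first by apply/measurable_EFinP; exact: measurable_normc.
  apply: le_lt_trans h1; rewrite le_eqVlt; apply/orP; left; apply/eqP.
  by apply: eq_integral => x _; rewrite abse_EFin ger0_norm ?normc_ge0// expr1.
- by move: h2; rewrite (cLnorm_dsigma (ltn0Sn 1) mh) => /(pint_fin _ _ (ltn0Sn 1)); rewrite pint2.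
Qed.

Lemma lift_memL (f : Rn -> R[i]) : cintegrable mu f -> (energy mu f < +oo)%E ->
  memL (dsigma R n) P 1 (fun p => f p.2) /\ memL (dsigma R n) P 2 (fun p => f p.2).
Proof.
move=> intf Ef; have mf := cmeas_paraboloid_snd (cintegrable_cmeas intf).
split; split => //.
  rewrite (cLnorm_dsigma (ltn0Sn 0) mf); apply/(pint_fin _ _ (ltn0Sn 0)).
  have /integrableP[_] := integrable_normc intf; apply: le_lt_trans.
  rewrite le_eqVlt; apply/orP; left; apply/eqP.
  by apply: eq_integral => x _; rewrite abse_EFin ger0_norm ?normc_ge0// expr1.
by rewrite (cLnorm_dsigma (ltn0Sn 1) mf); apply/(pint_fin _ _ (ltn0Sn 1)); rewrite pint2.
Qed.

Lemma pintZ (c : R) d (T : measurableType d) (nu : {measure set T -> \bar R}) (f : T -> R[i]) :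
  cmeas f -> 0 <= c -> pint nu m (fun x => c%:C * f x) = ((c ^+ m)%:E * pint nu m f)%E.
Proof.
move=> mf c0; rewrite /pint.
under eq_integral do rewrite ComplexField.Normc.normcM exprMn normcE sqnR sqrtr_sqr ger0_norm// EFinM.
rewrite ge0_integralZl//.
- exact: measurable_normcX.
- by move=> x _; rewrite lee_fin exprn_ge0// normc_ge0.
- by rewrite lee_fin exprn_ge0.
Qed.

Lemma pint_fourier_dsigma (h : spacetime R n -> R[i]) :
  memL (dsigma R n) P 1 h -> memL (dsigma R n) P 2 h ->
  pint (lebesgueST R n) m (fourier_dsigma h) = ((kap ^+ m)%:E * V (h \o lift))%E.
Proof.
move=> h1 h2; have [mh ih Eh] := memL_lift h1 h2.
rewrite -pint_extn// -pintZ//; last exact: cmeas_extn.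
by congr (pint _ _ _); apply/funext => z; rewrite fourier_dsigmaE//; case: h1.
Qed.

Lemma cmeas_fourier_dsigma (h : spacetime R n -> R[i]) : cmeasurable P h ->
  cmeas (fourier_dsigma h).
Proof.
move=> mh; rewrite (_ : fourier_dsigma h = fun z => kap%:C * extn (h \o lift) z); last first.
  by apply/funext => z; exact: fourier_dsigmaE.
apply: cmeasM; first exact: cmeas_cst.
by apply: cmeas_extn; exact: cmeas_lift.
Qed.

Let V_fin f : cmeas f -> (energy mu f < +oo)%E -> (V f < +oo)%E.
Proof. by move=> mf Ef; apply: le_lt_trans (V_le mf Ef) (ltry _). Qed.

Lemma energy_lift_sub (h g : spacetime R n -> R[i]) : cmeasurable P h -> cmeasurable P g ->
  cLnorm (dsigma R n) P 2 (fun p => h p - g p) =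
  cLnorm mu setT 2 (fun w => (h \o lift) w - (g \o lift) w).
Proof.
move=> [h1 h2] [g1 g2]; rewrite (cLnorm_dsigma (ltn0Sn 1))//; split.
  by under eq_fun do rewrite ReD ReN; exact: measurable_funB.
by under eq_fun do rewrite ImD ImN; exact: measurable_funB.
Qed.

(** Both sides are limits along the sequence of integrable densities that
    defines the transform, on which they agree by [pint_fourier_dsigma]. *)
Lemma pint_is_fourier_dsigma (g F : spacetime R n -> R[i]) :
  memL (dsigma R n) P 2 g -> is_fourier_dsigma m%:R g F ->
  pint (lebesgueST R n) m F = ((kap ^+ m)%:E * V (g \o lift))%E.
Proof.
move=> [mg gfin] [mF [h [hL hg hF]]].
have mgl := cmeas_lift mg.
have Eg : (energy mu (g \o lift) < +oo)%E.
  by move: gfin; rewrite (cLnorm_dsigma (ltn0Sn 1) mg) => /(pint_fin _ _ (ltn0Sn 1)); rewrite pint2.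
have H k := memL_lift (hL k).1 (hL k).2.
have hg0 : (fun k => energy mu (fun x => (h k \o lift) x - (g \o lift) x)) @ \oo --> 0%E.
  under eq_fun do rewrite -pint2; apply/(pint_cvg0P _ _ (ltn0Sn 1)).
  apply: cvg_trans hg; apply: near_eq_cvg; apply: nearW => k.
  by rewrite energy_lift_sub//; case: (hL k) => -[].
have cV : (fun k => pint (lebesgueST R n) m (fourier_dsigma (h k))) @ \oo -->
    ((kap ^+ m)%:E * V (g \o lift))%E.
  under eq_fun => k do rewrite (pint_fourier_dsigma (hL k).1 (hL k).2).
  have c1 : (fun k => V (h k \o lift)) @ \oo --> V (g \o lift).
    by apply: V_cvg => // k; have [] := H k.
  by apply: (cvgeM _ (cvg_cst _) c1); rewrite mule_def_fin// ge0_fin_numE ?V_fin.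
have cF : (fun k => pint (lebesgueST R n) m (fourier_dsigma (h k))) @ \oo -->
    pint (lebesgueST R n) m F.
  apply: pint_cvg => //.
  - by move=> k; apply: cmeas_fourier_dsigma; case: (hL k) => -[].
  - move=> k; rewrite (pint_fourier_dsigma (hL k).1 (hL k).2).
    have [a b c] := H k; apply: energy_mul_fin; rewrite ?lee_fin ?exprn_ge0 ?ltry ?V_fin//.
  - exact/(pint_cvg0P _ _ m_gt0).
exact: (cvg_unique (@ereal_hausdorff R) cF cV).
Qed.

Let kapK := kap * K.

Let kapK_ge0 : 0 <= kapK. Proof. exact: mulr_ge0. Qed.

Let norm_fin f : (energy mu f < +oo)%E -> normL2 f \is a fin_num.
Proof.
by move=> Ef; rewrite ge0_fin_numE ?cLnorm_ge0//; apply/(pint_fin _ _ (ltn0Sn 1)); rewrite pint2.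
Qed.

Let norm_fourier f : cintegrable mu f -> (energy mu f < +oo)%E ->
  (cLnorm (lebesgueST R n) setT m%:R (fun z => kap%:C * extn f z)%R <=
   kapK%:E * normL2 f)%E.
Proof.
move=> intf Ef; have mf := cintegrable_cmeas intf.
rewrite -(fineK (norm_fin Ef)) -EFinM.
have F0 : 0 <= fine (normL2 f) by rewrite fine_ge0// cLnorm_ge0.
apply/(pint_le_cLnorm _ _ m_gt0); first exact: mulr_ge0.
rewrite pintZ//; last exact: cmeas_extn.
rewrite pint_extn// /kapK -mulrA exprMn EFinM; apply: lee_wpmul2l.
  by rewrite lee_fin exprn_ge0.
exact: V_le.
Qed.

(** By the bound [V_le], the transforms of integrable approximations of [g] form
    a Cauchy sequence, which has a limit by [riesz_fischer]. *)
Lemma exists_fourier_dsigma (g : spacetime R n -> R[i]) :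
  memL (dsigma R n) P 2 g -> exists F, is_fourier_dsigma m%:R g F.
Proof.
move=> [mg gfin]; have mgl := cmeas_lift mg.
have Eg : (energy mu (g \o lift) < +oo)%E.
  by move: gfin; rewrite (cLnorm_dsigma (ltn0Sn 1) mg) => /(pint_fin _ _ (ltn0Sn 1)); rewrite pint2.
have [f [intf Ef fg]] := L2_approximation mgl Eg.
have mf k := cintegrable_cmeas (intf k).
have /(cvge0P (fun k => cLnorm_ge0 _ _ _ _)) f0 :
    (fun k => normL2 (fun x => f k x - (g \o lift) x)) @ \oo --> 0%E.
  by apply/(pint_cvg0P _ _ (ltn0Sn 1)); under eq_fun do rewrite pint2.
pose M := 2 * (kapK + 1).
have M0 : 0 < M by rewrite mulr_gt0// ltr_wpDl.
(* a subsequence along which the transforms converge geometrically *)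
have ex k : exists j, (normL2 (fun x => f j x - (g \o lift) x)%R <= ((2^-1) ^+ k / M)%:E)%E.
  have e0 : 0 < (2^-1 : R) ^+ k / M by rewrite divr_gt0// exprn_gt0.
  by have [j _ /(_ j (leqnn j))] := f0 _ e0; exists j.
have [phi Hphi] := choice ex.
pose u k z := kap%:C * extn (f (phi k)) z.
have mu_ k : cmeas (u k).
  by apply: cmeasM; [exact: cmeas_cst|exact: cmeas_extn].
have fast k : (cLnorm (lebesgueST R n) setT m%:R (fun z => u k.+1 z - u k z)%R <=
    ((2^-1) ^+ k)%:E)%E.
  have E : (fun z => u k.+1 z - u k z) =
      (fun z => kap%:C * extn (fun w => f (phi k.+1) w - f (phi k) w) z).
    by apply/funext => z; rewrite extnB// /u mulrBr.
  have intB : cintegrable mu (fun w => f (phi k.+1) w - f (phi k) w).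
    exact: cintegrableB.
  have nB : (normL2 (fun w => f (phi k.+1) w - f (phi k) w)%R <= (2 * ((2^-1) ^+ k / M))%:E)%E.
    apply: le_trans (cLnormB_le mu (ltn0Sn 1) (mf _) mgl (mf _)) _.
    have -> : (2 * ((2^-1) ^+ k / M))%:E = (((2^-1) ^+ k / M)%:E + ((2^-1) ^+ k / M)%:E)%E.
      by rewrite -EFinD; congr EFin; ring.
    apply: leeD.
      apply: le_trans (Hphi _) _; rewrite lee_fin ler_wpM2r ?invr_ge0 ?(ltW M0)//.
      by rewrite exprS ler_piMl ?exprn_ge0// invf_le1// ler1n.
    by rewrite cLnormB_sym; exact: Hphi.
  have EB : (energy mu (fun w => f (phi k.+1) w - f (phi k) w)%R < +oo)%E.
    by rewrite -pint2; apply/(pint_fin _ _ (ltn0Sn 1)); apply: le_lt_trans nB (ltry _).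
  rewrite E; apply: le_trans (norm_fourier intB EB) _.
  apply: le_trans (lee_wpmul2l _ nB) _; first by rewrite lee_fin.
  rewrite -EFinM lee_fin /M.
  have p0 : 0 <= (2^-1 : R) ^+ k by rewrite exprn_ge0.
  rewrite [leLHS](_ : _ = (2^-1) ^+ k * (kapK / (kapK + 1))).
    by rewrite ler_piMr// ler_pdivrMr ?mul1r ?lerDl// ltr_wpDl.
  by field; rewrite gt_eqF// ltr_wpDl.
have [F [mF FH]] := riesz_fischer m_gt0 mu_ fast.
have L k := lift_memL (intf (phi k)) (Ef (phi k)).
exists F; split=> //; exists (fun k p => f (phi k) p.2); split => //.
- have E k : cLnorm (dsigma R n) P 2 (fun p => f (phi k) p.2 - g p) =
      normL2 (fun x => f (phi k) x - (g \o lift) x).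
    by rewrite energy_lift_sub//; case: (L k) => -[].
  under eq_fun do rewrite E.
  apply: (@squeeze_cvge _ _ _ _ (fun=> 0%E) _ (fun k => ((2^-1) ^+ k / M)%:E)).
  + by apply: nearW => k; rewrite cLnorm_ge0 Hphi.
  + exact: cvg_cst.
  apply: cvg_EFin; first exact: nearW.
  rewrite -(mul0r M^-1); apply: cvgM; last exact: cvg_cst.
  by apply: cvg_expr; rewrite ger0_norm ?invr_ge0// invf_lt1// ltr1n.
- have E k : cLnorm (lebesgueST R n) setT m%:R
      (fun z => fourier_dsigma (fun p => f (phi k) p.2) z - F z) =
      cLnorm (lebesgueST R n) setT m%:R (fun z => u k z - F z).
    congr (cLnorm _ _ _ _); apply/funext => z; rewrite fourier_dsigmaE//.
    by case: (L k) => -[].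
  under eq_fun do rewrite E.
  apply: (@squeeze_cvge _ _ _ _ (fun=> 0%E) _ (fun k => (2 * (2^-1) ^+ k)%:E)).
  + by apply: nearW => k; rewrite cLnorm_ge0 FH.
  + exact: cvg_cst.
  apply: cvg_EFin; first exact: nearW.
  rewrite -(mulr0 2); apply: cvgM; first exact: cvg_cst.
  by apply: cvg_expr; rewrite ger0_norm ?invr_ge0// invf_lt1// ltr1n.
Qed.

End density.

(** * Maximizers are Gaussian *)

Section gaussian_tools.
Context {R : realType}.
Notation line := (measurableTypeR R).
Notation plane := (measurableTypeR R * measurableTypeR R)%type.

Lemma complex_log (c : R[i]) : c != 0 -> exists C, cexp C = c.
Proof.
move=> c0; pose r := ComplexField.Normc.normc c.
have r0 : 0 < r.
  rewrite lt_neqAle normc_ge0 andbT eq_sym; apply: contraNneq c0 => r0.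
  by rewrite (ComplexField.Normc.eq0_normc r0).
have r2 : complex.Re c ^+ 2 + complex.Im c ^+ 2 = r ^+ 2 by rewrite normcX2.
pose x := complex.Re c / r; pose y := complex.Im c / r.
have xy : x ^+ 2 + y ^+ 2 = 1.
  by rewrite /x /y !expr_div_n -mulrDl r2 divff// expf_neq0// gt_eqF.
have x1 : -1 <= x <= 1.
  by have := sqr_ge0 y => y0; apply/andP; split; nra.
have [th [ct st]] : exists th : R, cos th = x /\ sin th = y.
  have sy : Num.sqrt (1 - x ^+ 2) = `|y| by rewrite -sqrtr_sqr; congr Num.sqrt; rewrite -xy; ring.
  have [y0|y0] := leP 0 y.
    by exists (acos x); rewrite acosK ?in_itv// sin_acos// sy ger0_norm.
  exists (- acos x); rewrite cosN sinN acosK ?in_itv// sin_acos// sy ltr0_norm//.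
  by rewrite opprK.
exists (ln r +i* th); rewrite /cexp /= lnK// ct st.
by apply: complex_ext; rewrite !ReImE /= /x /y; field; rewrite gt_eqF.
Qed.

(** If [a >= 0], the integrand is at least 1 on a half-line, where [b x >= 0]. *)
Lemma integral_exp_quadratic_lt0 (a b : R) :
  (\int[leb]_x (expR (a * x ^+ 2 + b * x))%:E < +oo)%E -> a < 0.
Proof.
move=> fin; rewrite ltNge; apply/negP => a0; move: fin; apply/negP; rewrite -leNgt.
have m : measurable_fun setT (fun x : line => (expR (a * x ^+ 2 + b * x))%:E).
  apply/measurable_EFinP; apply: measurableT_comp => //; apply: measurable_funD.
    by apply: measurable_funM; [exact: measurable_cst|exact: measurable_funX].
  by apply: measurable_funM => //; exact: measurable_cst.
have key (D : set line) : measurable D -> (forall x, D x -> 0 <= b * x) ->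
    leb D = +oo%E -> (+oo <= \int[leb]_x (expR (a * x ^+ 2 + b * x))%:E)%E.
  move=> mD Db Doo; rewrite -Doo -[X in leb X]setIT -integral_indic//.
  apply: ge0_le_integral => //.
  - by apply/measurable_EFinP; exact: measurable_indic.
  - move=> x _; rewrite lee_fin indicE; case: (boolP (x \in D)) => [|_]; last exact: expR_ge0.
    rewrite inE => Dx; rewrite -[X in X <= _](@expR0 R) ler_expR.
    by rewrite addr_ge0 ?Db// mulr_ge0// sqr_ge0.
have [b0|b0] := leP 0 b.
  apply: (key `]0, +oo[%classic).
  - exact: measurable_itv.
  - by move=> x /=; rewrite in_itv /= andbT => x0; rewrite mulr_ge0// ltW.
  - by rewrite [LHS](_ : _ = lebesgue_measure `]0, +oo[%classic)// lebesgue_measure_itv /= ?ltry ?ltNyr.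
apply: (key `]-oo, 0[%classic).
- exact: measurable_itv.
- by move=> x /=; rewrite in_itv /= => x0; rewrite mulr_le0// ltW.
- by rewrite [LHS](_ : _ = lebesgue_measure `]-oo, 0[%classic)// lebesgue_measure_itv /= ?ltry ?ltNyr.
Qed.

Lemma sqn_qexp (A B : R[i]) x :
  sqn (qexp A B x) = expR (2 * complex.Re A * x ^+ 2 + 2 * complex.Re B * x).
Proof. by rewrite -normcX2 normc_qexp -expRM_natl; congr expR; ring. Qed.

Lemma energy_qexp_lt0 (A B : R[i]) : (energy leb (qexp A B) < +oo)%E -> complex.Re A < 0.
Proof.
rewrite /energy; under eq_integral do rewrite sqn_qexp.
by move=> /integral_exp_quadratic_lt0; rewrite pmulr_rlt0.
Qed.

Lemma qexp_neq0 (A B : R[i]) x : qexp A B x != 0.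
Proof. by rewrite qexp.unlock; exact: cexp_neq0. Qed.

Lemma energy_qexp_gt0 (A B : R[i]) : (0 < energy leb (qexp A B))%E.
Proof.
rewrite lt_neqAle energy_ge0 andbT; apply/negP => /eqP /esym E.
have [N [mN N0 sub]] := energy0_ae (cmeas_qexp A B) E.
have : (lebesgue_measure (setT : set line) <= leb N)%E.
  by apply: le_measure; rewrite ?inE// => x _; apply: sub => /= /eqP; rewrite (negbTE (qexp_neq0 A B x)).
rewrite N0 (_ : setT = `]-oo, +oo[%classic); last by apply/seteqP; split.
by rewrite lebesgue_measure_itv.
Qed.

Lemma energy_qexp_fin (A B : R[i]) : complex.Re A < 0 -> (energy leb (qexp A B) < +oo)%E.
Proof.
move=> A0; have A20 : complex.Re (2%:R * A) < 0 by rewrite ReM /=; nra.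
have [+ _] := cintegrable_qexp (A := (complex.Re (2%:R * A))%:C) (2 * complex.Re B)%:C A20.
move=> /integrableP[_]; apply: le_lt_trans; rewrite le_eqVlt; apply/orP; left; apply/eqP.
apply: eq_integral => x _; rewrite sqn_qexp abse_EFin; congr EFin.
rewrite qexp.unlock /cexp !ReImE /= !(mulr0, mul0r, subr0, addr0, cos0, mulr1) ger0_norm ?expR_ge0//.
Qed.

(** By [fourier_qexp], the transform of a Gaussian of quadratic coefficient [A]
    has quadratic coefficient [(4 A)^-1]: an involution that preserves the left
    half-plane. *)
Lemma gaussian_fourier_inverse (p q : R[i]) : complex.Re p < 0 ->
  exists c B, [/\ c != 0, complex.Re (4%:R * p)^-1 < 0 &
    forall s, fourier (fun x => c * qexp (4%:R * p)^-1 B x) s = qexp p q s].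
Proof.
move=> p0; have pN0 : p != 0 by apply: contraTneq p0 => ->; rewrite /= ltxx.
pose A := (4%:R * p)^-1; pose B := - 'i * (2%:R * A * q).
have n4 : 4%:R != 0 :> R[i] by rewrite pnatr_eq0.
have n2 : 2%:R != 0 :> R[i] by rewrite pnatr_eq0.
have AN0 : A != 0 by rewrite invr_eq0 mulf_neq0.
have A0 : complex.Re A < 0.
  have E : A = (sqn (2%:R * p))^-1%:C * conjc p.
    apply: (mulIf (x := 4%:R * p)); first by rewrite mulf_neq0.
    rewrite mulVf ?mulf_neq0//.
    have -> : (sqn (2%:R * p))^-1%:C * conjc p * (4%:R * p) = (sqn (2%:R * p))^-1%:C * (4%:R * (p * conjc p)) by ring.
    rewrite mulcJ_sqn sqnM (_ : sqn 2%:R = 4); last by rewrite (_ : 2%:R = 2%:C) ?sqnR //; ring.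
    have s0 : sqn p != 0 by apply: contra_neq pN0; exact: sqn_eq0.
    have -> : (4%:R : R[i]) = (4%:R : R)%:C by rewrite rmorph_nat.
    by move: (sqn p) s0 => s s0; apply: complex_ext; rewrite !ReImE /=; [field|ring].
  rewrite E ReM /= mul0r subr0 Re_conjc pmulr_rlt0// invr_gt0 lt_neqAle sqn_ge0 andbT.
  rewrite eq_sym; apply: contraNneq pN0 => /sqn_eq0 /eqP.
  by rewrite mulf_eq0 (negbTE n2).
have qE : 'i * B / (2%:R * A) = q.
  rewrite /B mulrA mulrN -expr2 sqr_i opprK mul1r; field.
  by rewrite AN0.
have pE : (4%:R * A)^-1 = p by rewrite /A; field; rewrite pN0.
pose k := cint leb (qexp A B).
have F s : fourier (qexp A B) s = k * qexp p q s.
  by rewrite /fourier fourier_qexp// pE qE.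
have k0 : k != 0.
  apply/eqP => k0; have := plancherel (cintegrable_qexp B A0) (energy_qexp_fin B A0).
  rewrite (_ : fourier _ = fun=> 0); last by apply/funext => s; rewrite F k0 mul0r.
  rewrite energy0//; last by apply: aeW.
  move=> /esym/eqP; rewrite mule_eq0 eqe mulf_eq0 pnatr_eq0 (negbTE pi_neq0) /= => /eqP E.
  by have := energy_qexp_gt0 A B; rewrite E ltxx.
exists k^-1, B; split => //; first by rewrite invr_eq0.
move=> s; rewrite /fourier.
rewrite (_ : (fun x => _) = (fun x => k^-1 * (qexp A B x * chi (s * x)))); last first.
  by apply/funext => x; rewrite mulrA.
rewrite cintZ; first by rewrite -/(fourier _ s) F mulKf.
exact: (cintegrable_chi (cintegrable_qexp B A0) (@measurable_id _ _ _)).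
Qed.

End gaussian_tools.

Section reflection.
Context {R : realType}.
Notation plane := (measurableTypeR R * measurableTypeR R)%type.
Notation pl := (leb \X leb : {sigma_finite_measure set plane -> \bar R}).
Variables (a b : R).

(** Across the line spanned by [(a, b)]. *)
Definition reflection (d : plane) : plane :=
  ((a ^+ 2 - b ^+ 2) / (a ^+ 2 + b ^+ 2) * d.1 + 2 * a * b / (a ^+ 2 + b ^+ 2) * d.2,
   2 * a * b / (a ^+ 2 + b ^+ 2) * d.1 + - ((a ^+ 2 - b ^+ 2) / (a ^+ 2 + b ^+ 2)) * d.2).

Hypothesis ab0 : a ^+ 2 + b ^+ 2 != 0.

Lemma mpres_reflection : mpres pl pl reflection.
Proof.
apply: mpres_linear2; rewrite -[RHS](normrN1 R); congr (`|_|).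
by field.
Qed.

Lemma rho_reflection d : rho (reflection d) = rho d.
Proof. by rewrite /rho /reflection /=; field. Qed.

Lemma along_reflection d :
  a * (reflection d).1 + b * (reflection d).2 = a * d.1 + b * d.2.
Proof. by rewrite /reflection /=; field. Qed.

Lemma across_reflection d :
  b * (reflection d).1 - a * (reflection d).2 = - (b * d.1 - a * d.2).
Proof. by rewrite /reflection /=; field. Qed.

End reflection.

Section radial_orthogonality.
Context {R : realType} d (S : measurableType d).
Notation plane := (measurableTypeR R * measurableTypeR R)%type.
Notation pl := (leb \X leb : {sigma_finite_measure set plane -> \bar R}).
Variable sig : {sigma_finite_measure set S -> \bar R}.

(** Reflection across the line spanned by [(a, b)] preserves radial functions
    and the phase, and reverses the sign of the linear factor. *)
Lemma radial_orthogonal (H : S * plane -> R[i]) (K : S * measurableTypeR R -> R[i])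
    (u : S -> R) (a b : R) : cmeas H -> cmeas K -> measurable_fun setT u ->
  {ae sig \X pl, forall z, H z = K (z.1, rho z.2)} ->
  cintegrable (sig \X pl) (fun z => (b * z.2.1 - a * z.2.2)%:C * H z *
    chi (u z.1 + (a * z.2.1 + b * z.2.2))) ->
  cint (sig \X pl) (fun z => (b * z.2.1 - a * z.2.2)%:C * H z *
    chi (u z.1 + (a * z.2.1 + b * z.2.2))) = 0.
Proof.
move=> mH mK mu_ HK; set F := (fun z => _) => intF.
have [ab0|ab0] := eqVneq (a ^+ 2 + b ^+ 2) 0.
  move/eqP: ab0; rewrite paddr_eq0 ?sqr_ge0// !sqrf_eq0 => /andP[/eqP a0 /eqP b0].
  rewrite (_ : F = fun=> 0); first by apply: complex_ext; rewrite /= /Rintegral integral0.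
  by apply/funext => z; rewrite /F a0 b0 !mul0r subr0 !mul0r.
pose F' (z : S * plane) := (b * z.2.1 - a * z.2.2)%:C * K (z.1, rho z.2) *
    chi (u z.1 + (a * z.2.1 + b * z.2.2)).
have m21 : measurable_fun setT (fun z : S * plane => z.2.1).
  exact: (measurableT_comp measurable_fst measurable_snd).
have m22 : measurable_fun setT (fun z : S * plane => z.2.2).
  exact: (measurableT_comp measurable_snd measurable_snd).
have ml (x y : R) : measurable_fun setT (fun z : S * plane => x * z.2.1 + y * z.2.2).
  by apply: measurable_funD; apply: measurable_funM => //; exact: measurable_cst.
have mchi : cmeas (fun z : S * plane => chi (u z.1 + (a * z.2.1 + b * z.2.2))).
  apply: cmeas_chi_comp; apply: measurable_funD => //.
  exact: (measurableT_comp mu_ measurable_fst).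
have mlin : cmeas (fun z : S * plane => (b * z.2.1 - a * z.2.2)%:C).
  apply: cmeas_real; under eq_fun do rewrite -mulNr; exact: ml.
have mKr : cmeas (fun z : S * plane => K (z.1, rho z.2)).
  apply: (cmeas_comp mK (measurable_fun_pair measurable_fst _)).
  exact: (measurableT_comp measurable_rho measurable_snd).
have mF : cmeas F by apply: cmeasM => //; exact: cmeasM.
have mF' : cmeas F' by apply: cmeasM => //; exact: cmeasM.
have FF' : {ae sig \X pl, forall z, F z = F' z}.
  by apply: filterS HK => z; rewrite /F /F' => ->.
have T := mpres_prod (mpres_id sig) (mpres_reflection ab0).
have E : cint (sig \X pl) F = - cint (sig \X pl) F.
  rewrite [LHS](ae_eq_cint mF mF' FF') -(mpres_cint T mF').
  rewrite (_ : (fun x => _) = (fun z => -1 * F' z)); last first.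
    apply/funext => z; rewrite /F' /= rho_reflection// along_reflection//.
    by rewrite across_reflection// rmorphN; ring.
  rewrite -[RHS]mulN1r -cintZ//; apply/esym; apply: ae_eq_cint.
  - by apply: cmeasM => //; exact: cmeas_cst.
  - by apply: cmeasM => //; exact: cmeas_cst.
  - by apply: filterS FF' => z ->.
have /eqP : cint (sig \X pl) F *+ 2 = 0 by rewrite mulr2n {2}E subrr.
by rewrite mulrn_eq0 /= => /eqP.
Qed.

End radial_orthogonality.

(** * The functional equation on the line *)

Section functional_line.
Context {R : realType}.
Notation line := (measurableTypeR R).
Notation plane := (measurableTypeR R * measurableTypeR R)%type.
Notation pl := (leb \X leb : {sigma_finite_measure set plane -> \bar R}).

(** If [f] vanished at all other points, it would vanish at [x] by continuity. *)
Lemma cderiv_nonzero (f df : R -> R[i]) x : (forall y, cderiv f y (df y)) -> f x != 0 ->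
  exists h, h != 0 /\ f (x + h) != 0.
Proof.
move=> fP; apply: contra_neqP => H.
have h0 n : f (x + n.+1%:R^-1) = 0.
  apply/eqP/negPn/negP => hn; apply: H; exists n.+1%:R^-1; split; last exact: hn.
  by rewrite invr_eq0 pnatr_eq0.
have [cRe cIm] := cderiv_continuous fP.
have c1 : (fun n => x + n.+1%:R^-1 : R) @ \oo --> x.
  by rewrite -[X in _ --> X]addr0; apply: cvgD; [exact: cvg_cst|exact: cvg_harmonic].
have key (u : R -> R) : continuous u -> (forall n, u (x + n.+1%:R^-1) = 0) -> u x = 0.
  move=> cu u0; have := cvg_comp _ _ c1 (cu x).
  rewrite (_ : u \o _ = fun=> 0); last exact/funext.
  move=> h; exact: (cvg_unique (@norm_hausdorff _ R) h (cvg_cst _)).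
apply: complex_ext.
  by apply: (key (fun y => complex.Re (f y))) => // n; rewrite h0.
by apply: (key (fun y => complex.Im (f y))) => // n; rewrite h0.
Qed.

(** A Gaussian weight brings square-integrable functions, and their products
    with linear functions, into [L^1]. *)
Definition damp (x : line) : R[i] := (expR (- x ^+ 2))%:C.

Lemma dampE : damp = qexp (-1)%:C 0.
Proof. by apply/funext => x; rewrite qexp_real mulN1r. Qed.

Lemma cmeas_damp : cmeas damp.
Proof. by rewrite dampE; exact: cmeas_qexp. Qed.

Lemma cmeas_xdamp : cmeas (fun x : line => x%:C * damp x).
Proof. by apply: cmeasM; [exact: cmeas_real|exact: cmeas_damp]. Qed.

Lemma energy_damp : (energy leb damp < +oo)%E.
Proof. by rewrite dampE; apply: energy_qexp_fin; rewrite /= ltrN10. Qed.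

Lemma energy_xdamp : (energy leb (fun x : line => (x%:C * damp x)%R) < +oo)%E.
Proof.
have h0 : complex.Re (- 2^-1 : R)%:C < 0 by rewrite /= oppr_lt0 invr_gt0.
apply: le_lt_trans (energy_qexp_fin 0 h0).
apply: ge0_le_integral => //.
- by move=> x _; rewrite lee_fin sqn_ge0.
- by apply: measurable_sqn_EFin; exact: cmeas_xdamp.
- by apply: measurable_sqn_EFin; exact: cmeas_qexp.
move=> x _; rewrite lee_fin qexp_real sqnM !sqnR.
have -> : expR (- x ^+ 2) ^+ 2 = expR (- x ^+ 2) * expR (- x ^+ 2) by [].
have -> : expR (- 2^-1 * x ^+ 2) ^+ 2 = expR (- x ^+ 2).
  by rewrite expr2 -expRD; congr expR; field.
rewrite mulrA ler_piMl ?expR_ge0//.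
rewrite -(@ler_pM2r _ (expR (x ^+ 2))) ?expR_gt0// mul1r -mulrA -expRD addNr expR0 mulr1.
by apply: le_trans (expR_ge1Dx _); rewrite lerDr.
Qed.

Variables (f : line -> R[i]) (mf : cmeas f) (Ef : (energy leb f < +oo)%E).

Definition damped (x : line) : R[i] := damp x * f x.
Local Notation g := damped.

Lemma cintegrable_damped : cintegrable leb g.
Proof. by apply: cintegrable_mulL2 => //; [exact: cmeas_damp|exact: energy_damp]. Qed.

Let mg : cmeas g. Proof. exact: cintegrable_cmeas cintegrable_damped. Qed.

Lemma cintegrable_xdamped : cintegrable leb (fun x => x%:C * g x).
Proof.
rewrite /damped; under eq_fun do rewrite mulrA.
by apply: cintegrable_mulL2 => //; [exact: cmeas_xdamp|exact: energy_xdamp].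
Qed.

Lemma energy_damped : (energy leb g < +oo)%E.
Proof.
apply: le_lt_trans Ef; apply: ge0_le_integral => //.
- by move=> x _; rewrite lee_fin sqn_ge0.
- exact: measurable_sqn_EFin.
- exact: measurable_sqn_EFin.
move=> x _; rewrite lee_fin sqnM sqnR ler_piMl ?sqn_ge0// exprn_ile1 ?expR_ge0//.
by rewrite -expR0 ler_expR oppr_le0 sqr_ge0.
Qed.

Local Notation psi := (fourier g).

Definition moment (s : R) : R[i] := cint leb (fun x => x%:C * g x * chi (s * x)).

Lemma cderiv_psi s : cderiv psi s (- 'i * moment s).
Proof.
apply: (@cderiv_fourier _ _ _ leb g (fun x => x) cintegrable_damped _ cintegrable_xdamped).
exact: measurable_id.
Qed.

Let intchi (u : line -> R[i]) s : cintegrable leb u -> cintegrable leb (fun x => u x * chi (s * x)).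
Proof.
by move=> iu; exact: (cintegrable_chi iu (@measurable_id _ _ _)).
Qed.

Variable K : line * line -> R[i].
Hypotheses (mK : cmeas K)
  (fK : {ae leb \X pl, forall z, tens1 f z = K (z.1, rho z.2)}).

(** In the coordinates [coords1], the plane component of the frequency
    [(x0, x1, x2)] is a vector [(a, b)], and the left-hand side is a multiple of
    the transform, at this frequency, of the tensor cube of [damped], which is
    still radial, times a linear factor across [(a, b)]. It vanishes by
    [radial_orthogonal]. *)
Lemma functional_equation1 (x0 x1 x2 : R) :
  (x1 - x2)%:C * (moment x0 * (psi x1 * psi x2)) +
  ((x2 - x0)%:C * (psi x0 * (moment x1 * psi x2)) +
   (x0 - x1)%:C * (psi x0 * (psi x1 * moment x2))) = 0.
Proof.
pose P s (x : line) := g x * chi (s * x).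
pose Q s (x : line) := x%:C * g x * chi (s * x).
have iP s : cintegrable leb (P s) by apply: intchi; exact: cintegrable_damped.
have iQ s : cintegrable leb (Q s) by apply: intchi; exact: cintegrable_xdamped.
have iT (u v w : line -> R[i]) : cintegrable leb u -> cintegrable leb v -> cintegrable leb w ->
    cintegrable (leb \X pl) (fun z : line * plane => u z.1 * (v z.2.1 * w z.2.2)).
  by move=> iu iv iw; exact: (cintegrable_tensor iu (cintegrable_tensor iv iw)).
have cT (u v w : line -> R[i]) : cintegrable leb u -> cintegrable leb v -> cintegrable leb w ->
    cint (leb \X pl) (fun z : line * plane => u z.1 * (v z.2.1 * w z.2.2)) =
    cint leb u * (cint leb v * cint leb w).
  move=> iu iv iw; rewrite (cint_tensor iu (cintegrable_tensor iv iw)).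
  by rewrite (cint_tensor iv iw).
pose T0 (z : line * plane) := Q x0 z.1 * (P x1 z.2.1 * P x2 z.2.2).
pose T1 (z : line * plane) := P x0 z.1 * (Q x1 z.2.1 * P x2 z.2.2).
pose T2 (z : line * plane) := P x0 z.1 * (P x1 z.2.1 * Q x2 z.2.2).
have i0 : cintegrable (leb \X pl) T0 by exact: iT.
have i1 : cintegrable (leb \X pl) T1 by exact: iT.
have i2 : cintegrable (leb \X pl) T2 by exact: iT.
rewrite /moment /fourier.
rewrite -(cT _ _ _ (iQ x0) (iP x1) (iP x2)) -(cT _ _ _ (iP x0) (iQ x1) (iP x2)).
rewrite -(cT _ _ _ (iP x0) (iP x1) (iQ x2)) -/T0 -/T1 -/T2.
have j0 := cintegrableZ (x1 - x2)%:C i0.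
have j1 := cintegrableZ (x2 - x0)%:C i1.
have j2 := cintegrableZ (x0 - x1)%:C i2.
have j12 := cintegrableD j1 j2; have j := cintegrableD j0 j12.
rewrite -!cintZ// -!cintD//.
rewrite -(mpres_cint mpres_coords1 (cintegrable_cmeas j)).
have {}j := (mpres_cintegrable mpres_coords1 (cintegrable_cmeas j)).2 j.
pose r : R := Num.sqrt 2; pose t : R := Num.sqrt 3.
have r2 : r ^+ 2 = 2 := sqr_sqrt2; have t2 : t ^+ 2 = 3 := sqr_sqrt3.
have r0 : r != 0 := sqrt2_neq0; have t0 : t != 0 := sqrt3_neq0.
(* [u] is the phase along the diagonal, [(a, b)] the frequency in the plane *)
pose a := (x1 - x2) / r; pose b := (x1 + x2 - 2 * x0) / (t * r).
pose u (s : line) : R := s * (x0 + x1 + x2) / t.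
(* the weight of [damped] is radial in the new coordinates, by [coords1_sqr] *)
pose H z := (expR (- (z.1 ^+ 2 + rho z.2)))%:C * tens1 f z.
pose K' (y : line * line) := (expR (- (y.1 ^+ 2 + y.2)))%:C * K y.
have E : (fun z : line * plane => (x1 - x2)%:C * T0 (coords1 z) +
      ((x2 - x0)%:C * T1 (coords1 z) + (x0 - x1)%:C * T2 (coords1 z))) =
    (fun z => t%:C * ((b * z.2.1 - a * z.2.2)%:C * H z *
      chi (u z.1 + (a * z.2.1 + b * z.2.2)))).
  apply/funext => z.
  have lin : t * (b * z.2.1 - a * z.2.2) = (x1 - x2) * (coords1 z).1 +
      ((x2 - x0) * (coords1 z).2.1 + (x0 - x1) * (coords1 z).2.2).
    rewrite /coords1 /= -/r -/t /a /b.
    transitivity (z.2.1 * (x1 + x2 - 2 * x0) / r - z.2.2 * (x1 - x2) * (r ^+ 2 + 1) / (t * r)).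
      by rewrite r2 (_ : 2 + 1 = t ^+ 2); [field; rewrite r0 t0|rewrite t2; ring].
    by field; rewrite r0 t0.
  have ph : u z.1 + (a * z.2.1 + b * z.2.2) = x0 * (coords1 z).1 +
      (x1 * (coords1 z).2.1 + x2 * (coords1 z).2.2).
    rewrite /coords1 /= -/r -/t /a /b /u -r2.
    by field; rewrite r0 t0.
  have dm : (expR (- (z.1 ^+ 2 + rho z.2)))%:C = damp (coords1 z).1 *
      (damp (coords1 z).2.1 * damp (coords1 z).2.2).
    by rewrite /damp -coords1_sqr !opprD !expRD !rmorphM.
  rewrite [RHS]mulrA [t%:C * _]mulrA -rmorphM lin ph /H dm !chiD /T0 /T1 /T2 /P /Q.
  rewrite /tens1 /triple /damped !rmorphD !rmorphM; ring.
rewrite E in j *.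
have t0' : t%:C != 0 by rewrite (_ : 0 = 0%:C)// (inj_eq (@complexI _)).
have := cintegrableZ (t%:C)^-1 j.
under eq_fun do rewrite mulKf//.
move=> j'.
rewrite cintZ// (radial_orthogonal (K := K')) ?mulr0//.
- apply: cmeasM; last exact: cmeas_tens1.
  apply: cmeas_real; apply: measurableT_comp => //; apply: measurableT_comp => //.
  apply: measurable_funD; first by apply: measurable_funX; exact: measurable_fst.
  exact: (measurableT_comp measurable_rho measurable_snd).
- apply: cmeasM => //; apply: cmeas_real; apply: measurableT_comp => //; apply: measurableT_comp => //.
  apply: measurable_funD; last exact: measurable_snd.
  by apply: measurable_funX; exact: measurable_fst.
- rewrite /u; under eq_fun do rewrite -mulrA.
  by apply: measurable_funM => //; exact: measurable_cst.
- by apply: filterS fK => z; rewrite /H /K' /= => ->.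
Qed.

Hypothesis f_neq0 : ~ {ae leb, forall w, f w = 0}.

(** Fix two points where the transform [psi] of the damped function does not
    vanish. Then [functional_equation1] says that the derivative of [psi] is
    [psi] times an affine function. Hence [psi] is a Gaussian, and so is [f], as
    the transform is injective. *)
Lemma gaussian_of_radial1 : exists A B C : R[i], complex.Re A < 0 /\
  {ae leb, forall w : line, f w = cexp (A * (w ^+ 2)%:C + B * w%:C + C)}.
Proof.
have [x0 px0] : exists x, psi x != 0.
  apply/not_existsP => p0; apply: f_neq0.
  have z0 s : cint leb (fun x => g x * chi (1 * s * x)) = 0.
    by have /negP := p0 s; rewrite mul1r negbK => /eqP.
  have := plancherel_injective (plancherel_scaled (oner_neq0 R)) _ cintegrable_damped energy_damped z0.
  have c0 : 2 * pi / `|1| != 0 :> R by rewrite normr1 divr1 mulf_neq0 ?pi_neq0.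
  move=> /(_ c0); apply: filterS => x /eqP; rewrite /damped mulf_eq0 => /orP[|/eqP//].
  by rewrite dampE (negbTE (qexp_neq0 _ _ _)).
have [h [h0 px1]] := cderiv_nonzero cderiv_psi px0.
set x1 := x0 + h in px1.
have x10 : (x1 - x0)%:C != 0 :> R[i].
  by rewrite (_ : 0 = 0%:C)// (inj_eq (@complexI _)) /x1 addrC addKr.
pose r0 := moment x0 / psi x0; pose r1 := moment x1 / psi x1.
pose P := (r1 - r0) / (x1 - x0)%:C; pose Q := r0 - P * x0%:C.
have mE s : moment s = (P * s%:C + Q) * psi s.
  have := functional_equation1 s x1 x0.
  rewrite /Q /P /r0 /r1 !rmorphB => F; rewrite !rmorphB in x10.
  apply: (mulfI px1); apply: (mulfI px0); apply: (mulfI x10).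
  move/eqP: F; rewrite addr_eq0 => /eqP F.
  rewrite (_ : _ * (_ * (_ * _)) = (x1%:C - x0%:C) * (moment s * (psi x1 * psi x0))); last by ring.
  rewrite F; field; rewrite px0 px1 x10//.
pose p := - 'i * P / 2%:R; pose q := - 'i * Q.
have n2 : 2%:R != 0 :> R[i] by rewrite pnatr_eq0.
have psiE : forall s, psi s = psi 0 * qexp p q s.
  apply: linear_ode_qexp => s; apply: cderiv_eq (cderiv_psi s) _.
  by rewrite mE /p /q; field.
have psi00 : psi 0 != 0.
  by apply: contraNneq px0 => z; rewrite psiE z mul0r.
have p_lt0 : complex.Re p < 0.
  apply: (@energy_qexp_lt0 _ p q).
  have := energyZ leb (psi 0) (cmeas_qexp p q); rewrite -(funext psiE) => E.
  have fin : (energy leb psi < +oo)%E.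
    by rewrite (plancherel cintegrable_damped energy_damped) energy_mul_fin ?lee_fin ?mulr_ge0 ?pi_ge0 ?ltry ?energy_ge0 ?energy_damped.
  rewrite E in fin; case: (energy leb (qexp p q)) (energy_ge0 leb (qexp p q)) fin => [r| |]//= _.
    by move=> _; rewrite ltry.
  rewrite gt0_muley// lte_fin lt_neqAle sqn_ge0 andbT eq_sym.
  by apply: contraNneq psi00 => /sqn_eq0 ->.
have [c [B [c0 A0 FE]]] := gaussian_fourier_inverse q p_lt0.
set A := (4%:R * p)^-1 in A0 FE.
pose k := psi 0 * c.
have k0 : k != 0 by rewrite mulf_neq0.
pose G := fun x : line => k * qexp A B x.
have iG : cintegrable leb G by apply: cintegrableZ; exact: cintegrable_qexp.
have EG : (energy leb G < +oo)%E.
  rewrite energyZ; last exact: cmeas_qexp.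
  by rewrite energy_mul_fin ?lee_fin ?sqn_ge0 ?ltry ?energy_ge0 ?energy_qexp_fin.
have ED := energyB_fin mg (cintegrable_cmeas iG) energy_damped EG.
have iD := cintegrableB cintegrable_damped iG.
have F0 s : cint leb (fun x => (g x - G x) * chi (1 * s * x)) = 0.
  rewrite mul1r (_ : (fun x => _) = (fun x => g x * chi (s * x) - G x * chi (s * x))); last first.
    by apply/funext => x; rewrite mulrBl.
  rewrite cintB; [|apply: intchi; exact: cintegrable_damped|exact: intchi].
  apply/eqP; rewrite subr_eq0; apply/eqP; rewrite -/(fourier g s) psiE -FE.
  transitivity (cint leb (fun x => psi 0 * (c * qexp A B x * chi (s * x)))); last first.
    by congr (cint leb _); apply/funext => x; rewrite /G /k; ring.
  by rewrite cintZ//; apply: intchi; apply: cintegrableZ; exact: cintegrable_qexp.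
have c2 : 2 * pi / `|1| != 0 :> R by rewrite normr1 divr1 mulf_neq0 ?pi_neq0.
have ae := plancherel_injective (plancherel_scaled (oner_neq0 R)) c2 iD ED F0.
have fE : {ae leb, forall w, f w = k * qexp (A + 1) B w}.
  apply: filterS ae => x /eqP; rewrite subr_eq0 /damped => /eqP h1.
  apply: (mulfI (x := damp x)); first by rewrite dampE qexp_neq0.
  rewrite h1 /G dampE mulrCA; congr (_ * _).
  by rewrite qexp.unlock -cexpD; congr cexp; rewrite rmorphN rmorph1; ring.
have A1 : complex.Re (A + 1) < 0.
  apply: (@energy_qexp_lt0 _ (A + 1) B).
  have mq := cmeas_qexp (A + 1) B.
  have E : energy leb f = ((sqn k)%:E * energy leb (qexp (A + 1)%R B))%E.
    rewrite -energyZ//; apply: ae_eq_energy => //.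
    by apply: cmeasM => //; exact: cmeas_cst.
  have := Ef; rewrite E.
  case: (energy leb (qexp (A + 1) B)) (energy_ge0 leb (qexp (A + 1) B)) => [r| |]//= _.
    by move=> _; rewrite ltry.
  rewrite gt0_muley// lte_fin lt_neqAle sqn_ge0 andbT eq_sym.
  by apply: contraNneq k0 => /sqn_eq0 ->.
have [C kC] := complex_log k0.
exists (A + 1), B, C; split => //; apply: filterS fE => w ->.
by rewrite cexpD kC mulrC qexp.unlock.
Qed.

End functional_line.

(** * The functional equation in the plane *)

Section functional_plane.
Context {R : realType}.
Notation line := (measurableTypeR R).
Notation plane := (measurableTypeR R * measurableTypeR R)%type.
Notation pl := (leb \X leb : {sigma_finite_measure set plane -> \bar R}).

Lemma factor_fin (x y : \bar R) : (0 < y)%E -> (x * y < +oo)%E -> (x < +oo)%E.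
Proof. by case: x => [r|//|//] y0; rewrite ?ltry ?gt0_mulye. Qed.

Definition damp2 (w : plane) : R[i] := damp w.1 * damp w.2.

Lemma damp2E w : damp2 w = (expR (- rho w))%:C.
Proof. by rewrite /damp2 /damp /rho opprD expRD rmorphM. Qed.

Lemma cmeas_damp2 : cmeas damp2.
Proof. exact: (cmeas_tensor cmeas_damp cmeas_damp). Qed.

Lemma energy_damp2 : (energy pl damp2 < +oo)%E.
Proof.
rewrite (energy_tensor leb leb cmeas_damp cmeas_damp).
by apply: energy_mul_fin; rewrite ?energy_ge0 ?energy_damp.
Qed.

Variables (f : plane -> R[i]) (mf : cmeas f) (Ef : (energy pl f < +oo)%E).

Definition damped2 (w : plane) : R[i] := damp2 w * f w.
Local Notation g := damped2.

Lemma cintegrable_damped2 : cintegrable pl g.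
Proof. by apply: cintegrable_mulL2 => //; [exact: cmeas_damp2|exact: energy_damp2]. Qed.

Let mg : cmeas g. Proof. exact: cintegrable_cmeas cintegrable_damped2. Qed.

Lemma cintegrable_xdamped2 : cintegrable pl (fun w => (w.1)%:C * g w) /\
  cintegrable pl (fun w => (w.2)%:C * g w).
Proof.
have mx := @cmeas_xdamp R; have md := @cmeas_damp R.
have e1 := energy_tensor leb leb mx md; have e2 := energy_tensor leb leb md mx.
split.
  rewrite (_ : (fun w => _) = (fun w => ((w.1)%:C * damp w.1 * damp w.2) * f w)); last first.
    by apply/funext => w; rewrite /damped2 /damp2; ring.
  apply: cintegrable_mulL2 => //; first exact: (cmeas_tensor mx md).
  by rewrite e1; apply: energy_mul_fin; rewrite ?energy_ge0 ?energy_damp ?energy_xdamp.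
rewrite (_ : (fun w => _) = (fun w => (damp w.1 * ((w.2)%:C * damp w.2)) * f w)); last first.
  by apply/funext => w; rewrite /damped2 /damp2; ring.
apply: cintegrable_mulL2 => //; first exact: (cmeas_tensor md mx).
by rewrite e2; apply: energy_mul_fin; rewrite ?energy_ge0 ?energy_damp ?energy_xdamp.
Qed.

Lemma energy_damped2 : (energy pl g < +oo)%E.
Proof.
apply: le_lt_trans Ef; apply: ge0_le_integral => //.
- by move=> x _; rewrite lee_fin sqn_ge0.
- exact: measurable_sqn_EFin.
- exact: measurable_sqn_EFin.
move=> x _; rewrite lee_fin sqnM damp2E sqnR ler_piMl ?sqn_ge0// exprn_ile1 ?expR_ge0//.
by rewrite -expR0 ler_expR oppr_le0 rho_ge0.
Qed.

Definition wave (x w : plane) : R[i] := chi (x.1 * w.1 + x.2 * w.2).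

Lemma measurable_wave (x : plane) :
  measurable_fun setT (fun w : plane => x.1 * w.1 + x.2 * w.2).
Proof.
by apply: measurable_funD; (apply: measurable_funM;
  first exact: measurable_cst); [exact: measurable_fst|exact: measurable_snd].
Qed.

Lemma cintegrable_wave u x : cintegrable pl u -> cintegrable pl (fun w => u w * wave x w).
Proof.
by move=> iu; apply: cintegrable_mul_chi => //; exact: measurable_wave.
Qed.

Definition fourier2 u (x : plane) : R[i] := cint pl (fun w => u w * wave x w).

Lemma plancherel_fourier2 :
  plancherel_pair pl pl (fun x s : plane => 1 * x.1 * s.1 + 1 * x.2 * s.2)
    (2 * pi / `|1| * (2 * pi / `|1|)).
Proof.
have pp := plancherel_scaled (oner_neq0 R).
have c0 : 0 <= 2 * pi / `|1| :> R by rewrite normr1 divr1 mulr_ge0 ?pi_ge0.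
exact: (plancherel_product pp pp c0 c0).
Qed.

Let const_neq0 : 2 * pi / `|1| * (2 * pi / `|1|) != 0 :> R.
Proof. by rewrite normr1 divr1 !mulf_neq0 ?pi_neq0. Qed.

Lemma fourier2_injective u : cintegrable pl u -> (energy pl u < +oo)%E ->
  (forall x, fourier2 u x = 0) -> {ae pl, forall w, u w = 0}.
Proof.
move=> iu Eu u0; apply: (plancherel_injective plancherel_fourier2 const_neq0 iu Eu) => x.
by rewrite -[RHS](u0 x) /fourier2 /wave; congr (cint _ _); apply/funext => w; rewrite !mul1r.
Qed.

Lemma energy_fourier2_fin u : cintegrable pl u -> (energy pl u < +oo)%E ->
  (energy pl (fourier2 u) < +oo)%E.
Proof.
move=> iu Eu; have := plancherel_fourier2.2 u iu Eu.
rewrite (_ : (fun x => _) = fourier2 u) => [->|].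
  apply: energy_mul_fin; rewrite ?energy_ge0 ?ltry// lee_fin.
  by rewrite normr1 divr1 !mulr_ge0 ?pi_ge0.
by apply/funext => x; rewrite /fourier2 /wave; congr (cint _ _); apply/funext => w; rewrite !mul1r.
Qed.

Local Notation psi := (fourier2 g).
Local Notation moment1 := (fourier2 (fun w : plane => (w.1)%:C * g w)).
Local Notation moment2 := (fourier2 (fun w : plane => (w.2)%:C * g w)).

Lemma cderiv_psi1 y s : cderiv (fun t => psi (t, y)) s (- 'i * moment1 (s, y)).
Proof.
have my : measurable_fun setT (fun w : plane => y * w.2).
  by apply: measurable_funM; [exact: measurable_cst|exact: measurable_snd].
have key u : cintegrable pl u -> cintegrable pl (fun w => u w * chi (y * w.2)).
  by move=> iu; exact: cintegrable_mul_chi.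
have := key _ cintegrable_xdamped2.1; under eq_fun do rewrite -mulrA.
move=> i2.
have := cderiv_fourier (key _ cintegrable_damped2) (@measurable_fst _ _ line line) i2 s.
have E u t : cint pl (fun w : plane => u w * chi (y * w.2) * chi (t * w.1)) =
    fourier2 u (t, y).
  congr (cint _ _); apply/funext => w.
  by rewrite /wave /= addrC chiD mulrA.
rewrite (funext (E g)) => /cderiv_eq; apply; congr (_ * _); rewrite -E.
by congr (cint _ _); apply/funext => w; rewrite !mulrA.
Qed.

Lemma cderiv_psi2 x s : cderiv (fun t => psi (x, t)) s (- 'i * moment2 (x, s)).
Proof.
have mx : measurable_fun setT (fun w : plane => x * w.1).
  by apply: measurable_funM; [exact: measurable_cst|exact: measurable_fst].
have key u : cintegrable pl u -> cintegrable pl (fun w => u w * chi (x * w.1)).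
  by move=> iu; exact: cintegrable_mul_chi.
have := key _ cintegrable_xdamped2.2; under eq_fun do rewrite -mulrA.
move=> i2.
have := cderiv_fourier (key _ cintegrable_damped2) (@measurable_snd _ _ line line) i2 s.
have E u t : cint pl (fun w : plane => u w * chi (x * w.1) * chi (t * w.2)) =
    fourier2 u (x, t).
  congr (cint _ _); apply/funext => w.
  by rewrite /wave /= chiD mulrA.
rewrite (funext (E g)) => /cderiv_eq; apply; congr (_ * _); rewrite -E.
by congr (cint _ _); apply/funext => w; rewrite !mulrA.
Qed.

Variable K : plane * line -> R[i].
Hypotheses (mK : cmeas K)
  (fK : {ae pl \X pl, forall z, tens2 f z = K (z.1, rho z.2)}).

(** In the coordinates [coords2], the plane component of the frequency [(x, y)]
    is along [x - y], and the two sides differ by a multiple of the transform,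
    at this frequency, of the tensor square of [damped2], which is still radial,
    times a linear factor across [x - y]. It vanishes by [radial_orthogonal]. *)
Lemma functional_equation2 (x y : plane) :
  (x.2 - y.2)%:C * (moment1 x * psi y - psi x * moment1 y) =
  (x.1 - y.1)%:C * (moment2 x * psi y - psi x * moment2 y).
Proof.
pose P s (w : plane) := g w * wave s w.
pose Q1 s (w : plane) := (w.1)%:C * g w * wave s w.
pose Q2 s (w : plane) := (w.2)%:C * g w * wave s w.
have iP s : cintegrable pl (P s) by apply: cintegrable_wave; exact: cintegrable_damped2.
have iQ1 s : cintegrable pl (Q1 s) by apply: cintegrable_wave; exact: cintegrable_xdamped2.1.
have iQ2 s : cintegrable pl (Q2 s) by apply: cintegrable_wave; exact: cintegrable_xdamped2.2.
apply/eqP; rewrite -subr_eq0; apply/eqP; rewrite /fourier2.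
rewrite -(cint_tensor (iQ1 x) (iP y)) -(cint_tensor (iP x) (iQ1 y)).
rewrite -(cint_tensor (iQ2 x) (iP y)) -(cint_tensor (iP x) (iQ2 y)).
have j1 := cintegrable_tensor (iQ1 x) (iP y); have j2 := cintegrable_tensor (iP x) (iQ1 y).
have j3 := cintegrable_tensor (iQ2 x) (iP y); have j4 := cintegrable_tensor (iP x) (iQ2 y).
have k1 := cintegrableZ (x.2 - y.2)%:C (cintegrableB j1 j2).
have k2 := cintegrableZ (x.1 - y.1)%:C (cintegrableB j3 j4).
have j := cintegrableB k1 k2.
rewrite -(cintB j1 j2) -(cintB j3 j4) -(cintZ _ (cintegrableB j1 j2)) -(cintZ _ (cintegrableB j3 j4)).
rewrite -(cintB k1 k2).
rewrite -(mpres_cint mpres_coords2 (cintegrable_cmeas j)).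
have {}j := (mpres_cintegrable mpres_coords2 (cintegrable_cmeas j)).2 j.
pose r : R := Num.sqrt 2.
have r2 : r ^+ 2 = 2 := sqr_sqrt2; have r0 : r != 0 := sqrt2_neq0.
pose a := (x.1 - y.1) / r; pose b := (x.2 - y.2) / r.
pose u (s : plane) : R := s.1 * ((x.1 + y.1) / r) + s.2 * ((x.2 + y.2) / r).
pose H (z : plane * plane) := (expR (- (rho z.1 + rho z.2)))%:C * tens2 f z.
pose K' (q : plane * line) := (expR (- (rho q.1 + q.2)))%:C * K q.
set L := (fun z => _) in j *.
have E : L = (fun z : plane * plane => 2%:C * ((b * z.2.1 - a * z.2.2)%:C * H z *
      chi (u z.1 + (a * z.2.1 + b * z.2.2)))).
  apply/funext => z; rewrite /L.
  have lin : 2 * (b * z.2.1 - a * z.2.2) =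
      (x.2 - y.2) * ((coords2 z).1.1 - (coords2 z).2.1) -
      (x.1 - y.1) * ((coords2 z).1.2 - (coords2 z).2.2).
    rewrite /coords2 /= -/r /a /b.
    by field.
  have ph : u z.1 + (a * z.2.1 + b * z.2.2) =
      (x.1 * (coords2 z).1.1 + x.2 * (coords2 z).1.2) +
      (y.1 * (coords2 z).2.1 + y.2 * (coords2 z).2.2).
    by rewrite /coords2 /= -/r /a /b /u; field.
  have dm : (expR (- (rho z.1 + rho z.2)))%:C = damp2 (coords2 z).1 * damp2 (coords2 z).2.
    by rewrite !damp2E -coords2_sqr opprD expRD rmorphM.
  rewrite [RHS]mulrA [2%:C * _]mulrA -rmorphM lin ph /H dm [in RHS]chiD /P /Q1 /Q2.
  rewrite /tens2 /double /wave /damped2 !(rmorphB, rmorphM) /=; ring.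
rewrite E in j *.
have n2 : 2%:C != 0 :> R[i] by rewrite (_ : 0 = 0%:C)// (inj_eq (@complexI _)).
have := cintegrableZ (2%:C)^-1 j.
under eq_fun do rewrite mulKf//.
move=> j'.
have mrho : measurable_fun setT (fun z : plane * plane => rho z.1).
  exact: (measurableT_comp measurable_rho measurable_fst).
rewrite cintZ// (radial_orthogonal (K := K')) ?mulr0//.
- apply: cmeasM; last exact: cmeas_tens2.
  apply: cmeas_real; apply: measurableT_comp => //; apply: measurableT_comp => //.
  apply: measurable_funD => //.
  exact: (measurableT_comp measurable_rho measurable_snd).
- apply: cmeasM => //; apply: cmeas_real; apply: measurableT_comp => //; apply: measurableT_comp => //.
  apply: measurable_funD; last exact: measurable_snd.
  exact: (measurableT_comp measurable_rho measurable_fst).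
- by apply: measurable_funD; apply: measurable_funM; (exact: measurable_fst || exact: measurable_snd || exact: measurable_cst).
- by apply: filterS fK => z; rewrite /H /K' /= => ->.
Qed.

Hypothesis f_neq0 : ~ {ae pl, forall w, f w = 0}.

(** The logarithmic gradient of the transform, known to be parallel to
    increments by [functional_equation2], is affine: test it on three points
    spanning the plane. *)
Lemma affine_log_gradient : exists v1 v2 m : R[i], forall x : plane,
  moment1 x = (v1 + m * (x.1)%:C) * psi x /\ moment2 x = (v2 + m * (x.2)%:C) * psi x.
Proof.
have [[c1 c2] px0] : exists x, psi x != 0.
  apply/not_existsP => p0; apply: f_neq0.
  have z0 s : psi s = 0 by have /negP := p0 s; rewrite negbK => /eqP.
  have := fourier2_injective cintegrable_damped2 energy_damped2 z0.
  apply: filterS => w /eqP; rewrite /damped2 mulf_eq0 => /orP[|/eqP//].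
  by rewrite mulf_eq0 !dampE !(negbTE (qexp_neq0 _ _ _)).
have [h [h0 px1]] := cderiv_nonzero (cderiv_psi1 c2) px0.
have [k [k0 px2]] := cderiv_nonzero (cderiv_psi2 c1) px0.
have hc : h%:C != 0 by rewrite (_ : 0 = 0%:C)// (inj_eq (@complexI _)).
have kc : k%:C != 0 by rewrite (_ : 0 = 0%:C)// (inj_eq (@complexI _)).
have F01 := functional_equation2 (c1 + h, c2) (c1, c2).
have F02 := functional_equation2 (c1, c2 + k) (c1, c2).
have F12 := functional_equation2 (c1 + h, c2) (c1, c2 + k).
rewrite /= in F01 F02 F12.
set p0 := psi (c1, c2) in px0 F01 F02 *.
set p1 := psi (c1 + h, c2) in px1 F01 F12 *.
set p2 := psi (c1, c2 + k) in px2 F02 F12 *.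
set a0 := moment1 (c1, c2) in F01 F02 *; set b0 := moment2 (c1, c2) in F01 F02 *.
set a1 := moment1 (c1 + h, c2) in F01 F12 *; set b1 := moment2 (c1 + h, c2) in F01 F12 *.
set a2 := moment1 (c1, c2 + k) in F02 F12 *; set b2 := moment2 (c1, c2 + k) in F02 F12 *.
have {}F01 : b1 = b0 * p1 / p0.
  move: F01; rewrite subrr mul0r addrAC subrr add0r => /esym/eqP.
  rewrite mulf_eq0 (negbTE hc) /= subr_eq0 => /eqP e.
  by rewrite (mulrC _ p1) -e mulfK.
have {}F02 : a2 = a0 * p2 / p0.
  move: F02; rewrite [c1 - c1]subrr mul0r addrAC subrr add0r => /eqP.
  rewrite mulf_eq0 (negbTE kc) /= subr_eq0 => /eqP e.
  by rewrite (mulrC _ p2) -e mulfK.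
pose m := (a1 / p1 - a0 / p0) / h%:C.
have mk : b2 = (b0 / p0 + m * k%:C) * p2.
  move: F12; rewrite F01 F02 opprD addrA subrr add0r addrAC subrr add0r rmorphN => F12.
  apply: (mulfI px1); apply: (mulfI hc).
  have -> : h%:C * (p1 * b2) = h%:C * (b0 * p1 / p0 * p2) + k%:C * (a1 * p2 - p1 * (a0 * p2 / p0)).
    have -> : k%:C * (a1 * p2 - p1 * (a0 * p2 / p0)) = - (- k%:C * (a1 * p2 - p1 * (a0 * p2 / p0))) by ring.
    by rewrite F12; ring.
  by rewrite /m; field; rewrite px0 px1 hc.
exists (a0 / p0 - m * c1%:C), (b0 / p0 - m * c2%:C), m => -[s t] /=.
have G0 := functional_equation2 (s, t) (c1, c2).
have G1 := functional_equation2 (s, t) (c1 + h, c2).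
have G2 := functional_equation2 (s, t) (c1, c2 + k).
rewrite /= -/p0 -/p1 -/p2 -/a0 -/a1 -/a2 -/b0 -/b1 -/b2 in G0 G1 G2.
rewrite mk F02 in G2; rewrite F01 in G1.
have a1E : a1 = (a0 / p0 + m * h%:C) * p1 by rewrite /m; field; rewrite px0 px1 hc.
rewrite a1E in G1.
set X := moment1 (s, t) in G0 G1 G2 *; set Y := moment2 (s, t) in G0 G1 G2 *.
set Z := psi (s, t) in G0 G1 G2 *.
rewrite !(rmorphB, rmorphD) /= in G0 G1 G2.
pose X' := X - (a0 / p0 - m * c1%:C + m * s%:C) * Z.
pose Y' := Y - (b0 / p0 - m * c2%:C + m * t%:C) * Z.
have H0 : (t%:C - c2%:C) * X' = (s%:C - c1%:C) * Y'.
  apply: (mulfI px0); rewrite /X' /Y'.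
  apply/eqP; rewrite -subr_eq0; apply/eqP; move/eqP: G0; rewrite -subr_eq0 => /eqP <-.
  by field; rewrite px0.
have H1 : (t%:C - c2%:C) * X' = (s%:C - (c1%:C + h%:C)) * Y'.
  apply: (mulfI px1); rewrite /X' /Y'.
  apply/eqP; rewrite -subr_eq0; apply/eqP; move/eqP: G1; rewrite -subr_eq0 => /eqP <-.
  by field; rewrite px0.
have H2 : (t%:C - (c2%:C + k%:C)) * X' = (s%:C - c1%:C) * Y'.
  apply: (mulfI px2); rewrite /X' /Y'.
  apply/eqP; rewrite -subr_eq0; apply/eqP; move/eqP: G2; rewrite -subr_eq0 => /eqP <-.
  by field; rewrite px0.
have Y0 : Y' = 0.
  apply: (mulfI hc); rewrite mulr0.
  transitivity ((s%:C - c1%:C) * Y' - (s%:C - (c1%:C + h%:C)) * Y'); first by ring.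
  by rewrite -H0 -H1 subrr.
have X0 : X' = 0.
  apply: (mulfI kc); rewrite mulr0.
  transitivity ((t%:C - c2%:C) * X' - (t%:C - (c2%:C + k%:C)) * X'); first by ring.
  by rewrite H0 H2 subrr.
by split; apply/eqP; rewrite -subr_eq0; apply/eqP; [exact: X0|exact: Y0].
Qed.

(** By [affine_log_gradient] the transform solves the equation of a Gaussian in
    each variable, with the same quadratic coefficient [p] in both. *)
Lemma gaussian_of_radial2 : exists A B1 B2 C : R[i], complex.Re A < 0 /\
  {ae pl, forall w : plane, f w = cexp (A * (rho w)%:C + (B1 * (w.1)%:C + B2 * (w.2)%:C) + C)}.
Proof.
have [v1 [v2 [m E]]] := affine_log_gradient.
pose p := - 'i * m / 2%:R; pose q1 := - 'i * v1; pose q2 := - 'i * v2.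
have n2 : 2%:R != 0 :> R[i] by rewrite pnatr_eq0.
have psi1 y : forall t, psi (t, y) = psi (0, y) * qexp p q1 t.
  apply: linear_ode_qexp => s; apply: cderiv_eq (cderiv_psi1 y s) _.
  by rewrite (E (s, y)).1 /p /q1 /=; field.
have psi2 : forall t, psi (0, t) = psi (0, 0) * qexp p q2 t.
  apply: linear_ode_qexp => s; apply: cderiv_eq (cderiv_psi2 0 s) _.
  by rewrite (E (0, s)).2 /p /q2 /=; field.
have psiE x : psi x = psi (0, 0) * (qexp p q1 x.1 * qexp p q2 x.2).
  by case: x => s t /=; rewrite psi1 psi2; ring.
have psi00 : psi (0, 0) != 0.
  apply/eqP => z; apply: f_neq0.
  have z0 s : psi s = 0 by rewrite psiE z mul0r.
  have := fourier2_injective cintegrable_damped2 energy_damped2 z0.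
  apply: filterS => w /eqP; rewrite /damped2 mulf_eq0 => /orP[|/eqP//].
  by rewrite mulf_eq0 !dampE !(negbTE (qexp_neq0 _ _ _)).
have sqn_gt0 (z : R[i]) : z != 0 -> (0 < (sqn z)%:E)%E.
  move=> z0; rewrite lte_fin lt_neqAle sqn_ge0 andbT eq_sym.
  by apply: contraNneq z0 => /sqn_eq0 ->.
have lt0_of (k P Q1 Q2 : R[i]) (u : plane -> R[i]) : k != 0 -> (energy pl u < +oo)%E ->
    cmeas u -> {ae pl, forall w, u w = k * (qexp P Q1 w.1 * qexp P Q2 w.2)} -> complex.Re P < 0.
  move=> k0 Eu mu_ uE; apply: (@energy_qexp_lt0 _ P Q1).
  have mt : cmeas (fun w : plane => qexp P Q1 w.1 * qexp P Q2 w.2).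
    exact: (cmeas_tensor (cmeas_qexp P Q1) (cmeas_qexp P Q2)).
  have mkt : cmeas (fun w : plane => k * (qexp P Q1 w.1 * qexp P Q2 w.2)).
    by apply: cmeasM => //; exact: cmeas_cst.
  move: Eu; rewrite (ae_eq_energy mu_ mkt uE) energyZ//.
  rewrite (energy_tensor leb leb (cmeas_qexp P Q1) (cmeas_qexp P Q2)) muleC.
  move=> /(factor_fin (sqn_gt0 _ k0)); apply: factor_fin; exact: energy_qexp_gt0.
have mpsi : cmeas psi.
  apply: (@cmeas_cint R _ _ _ _ pl (fun z : plane * plane => g z.2 * wave z.1 z.2)).
  apply: cmeasM; first exact: (cmeas_comp mg measurable_snd).
  apply: cmeas_chi_comp; apply: measurable_funD; apply: measurable_funM.
  - exact: (measurableT_comp measurable_fst measurable_fst).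
  - exact: (measurableT_comp measurable_fst measurable_snd).
  - exact: (measurableT_comp measurable_snd measurable_fst).
  - exact: (measurableT_comp measurable_snd measurable_snd).
have p_lt0 : complex.Re p < 0.
  apply: (lt0_of _ p q1 q2 psi psi00 _ mpsi); last by apply: aeW.
  exact: (energy_fourier2_fin cintegrable_damped2 energy_damped2).
have [d1 [B1 [d10 A0 FE1]]] := gaussian_fourier_inverse q1 p_lt0.
have [d2 [B2 [d20 _ FE2]]] := gaussian_fourier_inverse q2 p_lt0.
set A := (4%:R * p)^-1 in A0 FE1 FE2.
pose k := psi (0, 0) * d1 * d2.
have k0 : k != 0 by rewrite !mulf_neq0.
have iq (B : R[i]) := cintegrable_qexp B A0.
have mq := cmeas_tensor (cmeas_qexp A B1) (cmeas_qexp A B2).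
have iqq := cintegrable_tensor (iq B1) (iq B2).
pose G := fun w : plane => k * (qexp A B1 w.1 * qexp A B2 w.2).
have iG : cintegrable pl G by exact: cintegrableZ.
have mG := cintegrable_cmeas iG.
have EG : (energy pl G < +oo)%E.
  rewrite energyZ// (energy_tensor leb leb (cmeas_qexp A B1) (cmeas_qexp A B2)).
  by repeat (apply: energy_mul_fin; rewrite ?mule_ge0 ?energy_ge0 ?lee_fin ?sqn_ge0 ?ltry ?energy_qexp_fin//).
have ED := energyB_fin mg mG energy_damped2 EG.
have iD := cintegrableB cintegrable_damped2 iG.
have F0 x : fourier2 (fun w => g w - G w) x = 0.
  rewrite /fourier2 (_ : (fun w => _) = (fun w => g w * wave x w - G w * wave x w)); last first.
    by apply/funext => w; rewrite mulrBl.
  rewrite cintB; [|apply: cintegrable_wave; exact: cintegrable_damped2|exact: cintegrable_wave].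
  apply/eqP; rewrite subr_eq0; apply/eqP; rewrite -/(fourier2 g x) psiE.
  rewrite -FE1 -FE2 /fourier.
  have ic d B s : cintegrable leb (fun t => d * qexp A B t * chi (s * t)).
    have id' : cintegrable leb (fun t => d * qexp A B t) by exact: cintegrableZ.
    exact: (cintegrable_chi id' (@measurable_id _ _ _)).
  have it := cintegrable_tensor (ic d1 B1 x.1) (ic d2 B2 x.2).
  rewrite -(cint_tensor (ic d1 B1 x.1) (ic d2 B2 x.2)) -cintZ//.
  by congr (cint _ _); apply/funext => w; rewrite /G /k /wave [in RHS]chiD; ring.
have fE : {ae pl, forall w, f w = k * (qexp (A + 1) B1 w.1 * qexp (A + 1) B2 w.2)}.
  have := fourier2_injective iD ED F0; apply: filterS => w /eqP.
  rewrite subr_eq0 /damped2 /damp2 => /eqP h1.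
  apply: (mulfI (x := damp w.1 * damp w.2)); first by rewrite mulf_neq0// dampE qexp_neq0.
  have s B t : qexp A B t = damp t * qexp (A + 1) B t.
    by rewrite dampE qexp.unlock -cexpD; congr cexp; rewrite rmorphN rmorph1; ring.
  by rewrite h1 /G !s; ring.
have A1 : complex.Re (A + 1) < 0 by exact: (lt0_of _ _ _ _ f k0 Ef mf fE).
have [C kC] := complex_log k0.
exists (A + 1), B1, B2, C; split => //; apply: filterS fE => w ->.
rewrite cexpD kC mulrC; congr (_ * _); rewrite qexp.unlock -cexpD; congr cexp.
by rewrite /rho rmorphD; ring.
Qed.

End functional_plane.

(** * From the functional to the sharp inequality *)

Section sharp.
Context {R : realType} (n m : nat) (m_gt0 : (0 < m)%N).
Local Notation Rn := (n.-tuple (measurableTypeR R)).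
Local Notation mu := (lebesgueRn R n).
Local Notation lift := (@lift_parab R n).
Local Notation P := (paraboloid R n).
Local Notation normL2 := (cLnorm mu setT 2).

Definition gaussian (A C : R[i]) (b : n.-tuple R[i]) (w : Rn) : R[i] :=
  cexp (A * (dotp w w)%:C + cdotp b w + C).

Lemma cmeas_gaussian A C b : cmeas (gaussian A C b).
Proof.
apply: cmeas_cexp; apply: cmeasD; last exact: cmeas_cst.
apply: cmeasD.
  apply: cmeasM; first exact: cmeas_cst.
  by apply: cmeas_real; exact: measurable_dotp.
have H (s : seq 'I_n) : cmeas (fun w : Rn => \sum_(j <- s) tnth b j * (tnth w j : R)%:C).
  elim: s => [|j s IH].
    by under eq_fun do rewrite big_nil; exact: cmeas_cst.
  under eq_fun do rewrite big_cons; apply: cmeasD => //.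
  apply: cmeasM; first exact: cmeas_cst.
  by apply: cmeas_real; exact: measurable_tnth.
exact: H.
Qed.

Lemma measurable_zeros d (T : measurableType d) (f : T -> R[i]) : cmeas f ->
  measurable [set x | f x = 0].
Proof.
move=> [f1 f2]; rewrite (_ : [set x | _] =
    (setT `&` (fun x => complex.Re (f x)) @^-1` [set 0]) `&`
    (setT `&` (fun x => complex.Im (f x)) @^-1` [set 0])).
  by apply: measurableI; [apply: f1|apply: f2] => //; exact: measurable_set1.
apply/seteqP; split => x /=; first by move=> ->.
by move=> [[_ e1] [_ e2]]; exact: complex_ext.
Qed.

Lemma mpres_ae_eq d d' (X : measurableType d) (Y : measurableType d')
    (mu1 : {measure set X -> \bar R}) (mu2 : {measure set Y -> \bar R}) (phi : X -> Y)
    (f g : Y -> R[i]) : mpres mu1 mu2 phi -> cmeas f -> cmeas g ->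
  {ae mu1, forall x, f (phi x) = g (phi x)} <-> {ae mu2, forall y, f y = g y}.
Proof.
move=> h mf mg; have mz := measurable_zeros (cmeasB mf mg).
have [H1 H2] := mpres_ae h mz; split => ae.
  apply: filterS (H1 _) => [y /eqP|]; first by rewrite subr_eq0 => /eqP.
  by apply: filterS ae => x /= ->; rewrite subrr.
apply: filterS (H2 _) => [y /eqP|]; first by rewrite subr_eq0 => /eqP.
by apply: filterS ae => x /= ->; rewrite subrr.
Qed.

Lemma pint_eq_cLnorm d (T : measurableType d) (nu : {measure set T -> \bar R})
    (f : T -> R[i]) (c : R) : 0 <= c ->
  cLnorm nu setT m%:R f = c%:E <-> pint nu m f = (c ^+ m)%:E.
Proof.
move=> c0; split => h; first by rewrite (pintE _ _ m_gt0) h poweR_EFin powR_mulrn.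
rewrite cLnormE h -(powR_mulrn m c0) -poweR_EFin -poweRrM mulfV ?poweRe1//.
by rewrite pnatr_eq0 -lt0n.
Qed.

Variables (V : (Rn -> R[i]) -> \bar R) (K : R).
Hypothesis K_ge0 : 0 <= K.
Hypothesis pint_extn : forall f, cintegrable mu f -> (energy mu f < +oo)%E ->
  pint (lebesgueST R n) m (extn f) = V f.
Hypothesis V_ge0 : forall f, (0 <= V f)%E.
Hypothesis V_le : forall f, cmeas f -> (energy mu f < +oo)%E ->
  (V f <= ((K * fine (normL2 f)) ^+ m)%:E)%E.
Hypothesis V_cvg : forall (h : nat -> Rn -> R[i]) f, (forall k, cmeas (h k)) -> cmeas f ->
  (forall k, energy mu (h k) < +oo)%E -> (energy mu f < +oo)%E ->
  (fun k => energy mu (fun x => h k x - f x)) @ \oo --> 0%E ->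
  (fun k => V (h k)) @ \oo --> V f.
Hypothesis V_max : forall f, cmeas f -> (energy mu f < +oo)%E ->
  ~ {ae mu, forall w, f w = 0} -> V f = ((K * fine (normL2 f)) ^+ m)%:E ->
  exists A C b, complex.Re A < 0 /\ {ae mu, forall w, f w = gaussian A C b w}.
Hypothesis V_gaussian : forall A C b, (energy mu (gaussian A C b) < +oo)%E ->
  V (gaussian A C b) = ((K * fine (normL2 (gaussian A C b))) ^+ m)%:E.
Let standard : Rn -> R[i] := gaussian (-1) 0 [tuple of nseq n 0].
Hypothesis standard_fin : (energy mu standard < +oo)%E.
Hypothesis standard_gt0 : (0 < energy mu standard)%E.

Let kap := fourier_factor n : R.

Let kap_gt0 : 0 < kap.
Proof. by apply: powR_gt0; rewrite mulr_gt0// pi_gt0. Qed.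

Let K1 := kap * K.

Let normS g := cLnorm (dsigma R n) P 2 g.

Let normS_fin g : memL (dsigma R n) P 2 g ->
  [/\ cmeas (g \o lift), (energy mu (g \o lift) < +oo)%E, normS g \is a fin_num &
      normS g = normL2 (g \o lift)].
Proof.
move=> [mg gfin]; have E : normS g = normL2 (g \o lift) by exact: (cLnorm_dsigma (ltn0Sn 1)).
split=> //.
- exact: cmeas_lift.
- by rewrite -pint2; apply/(pint_fin _ _ (ltn0Sn 1)); rewrite -E.
- by rewrite ge0_fin_numE// cLnorm_ge0.
Qed.

Let pintF g F : memL (dsigma R n) P 2 g -> is_fourier_dsigma m%:R g F ->
  pint (lebesgueST R n) m F = ((kap ^+ m)%:E * V (g \o lift))%E.
Proof. exact: (pint_is_fourier_dsigma m_gt0 pint_extn V_ge0 V_le V_cvg). Qed.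

Lemma sharp_inequality g F : memL (dsigma R n) P 2 g -> is_fourier_dsigma m%:R g F ->
  (cLnorm (lebesgueST R n) setT m%:R F <= K1%:E * normS g)%E.
Proof.
move=> gL FP; have [mg Eg fg E] := normS_fin gL.
rewrite -(fineK fg) -EFinM; have n0 : 0 <= fine (normS g) by rewrite fine_ge0// cLnorm_ge0.
apply/(pint_le_cLnorm _ _ m_gt0); first by rewrite !mulr_ge0// ltW.
rewrite (pintF gL FP) /K1 -mulrA exprMn EFinM; apply: lee_wpmul2l.
  by rewrite lee_fin exprn_ge0// ltW.
by rewrite E; exact: V_le.
Qed.

(** The norm of the transform depends on the density through [V] only. *)
Lemma sharp_equality_V g F : memL (dsigma R n) P 2 g -> is_fourier_dsigma m%:R g F ->
  cLnorm (lebesgueST R n) setT m%:R F = (K1%:E * normS g)%E <->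
  V (g \o lift) = ((K * fine (normL2 (g \o lift))) ^+ m)%:E.
Proof.
move=> gL FP; have [mg Eg fg E] := normS_fin gL.
rewrite -(fineK fg) -EFinM; have n0 : 0 <= fine (normS g) by rewrite fine_ge0// cLnorm_ge0.
have c0 : 0 <= K1 * fine (normS g) by rewrite !mulr_ge0// ltW.
have km0 : kap ^+ m != 0 by rewrite expf_neq0// gt_eqF.
split => [/(pint_eq_cLnorm _ _ c0)|h].
  rewrite (pintF gL FP) /K1 -mulrA exprMn EFinM E.
  move=> /(congr1 (fun t => (kap ^+ m)^-1%:E * t)%E).
  by rewrite !muleA -!EFinM mulVf// mul1e mul1r.
apply/(pint_eq_cLnorm _ _ c0).
by rewrite (pintF gL FP) h -EFinM -exprMn /K1 mulrA E.
Qed.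

(** This is continuity along a constant sequence. *)
Lemma V_ae f g : cmeas f -> cmeas g -> (energy mu f < +oo)%E ->
  {ae mu, forall w, f w = g w} -> V f = V g.
Proof.
move=> mf mg Ef fg; have Eg : (energy mu g < +oo)%E by rewrite -(ae_eq_energy mf mg fg).
have c : (fun k : nat => V f) @ \oo --> V g.
  apply: (V_cvg (h := fun=> f)) => //.
  rewrite energy0; first exact: cvg_cst.
  - by apply: filterS fg => w ->; rewrite subrr.
  - exact: cmeasB.
exact: (cvg_unique (@ereal_hausdorff R) (cvg_cst _) c).
Qed.

Lemma sharp_equality_gaussian g F : memL (dsigma R n) P 2 g -> is_fourier_dsigma m%:R g F ->
  ~ {ae dsigma R n, forall p, P p -> g p = 0} ->
  cLnorm (lebesgueST R n) setT m%:R F = (K1%:E * normS g)%E <->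
  exists A C b, complex.Re A < 0 /\
    {ae mu, forall w, g (dotp w w, w) = cexp (A * (dotp w w)%:C + cdotp b w + C)}.
Proof.
move=> gL FP g0; have [mg Eg fg E] := normS_fin gL.
rewrite (sharp_equality_V gL FP); split; first last.
  move=> [A [C [b [A0 ae]]]].
  have mG := cmeas_gaussian A C b.
  have ae' : {ae mu, forall w, (g \o lift) w = gaussian A C b w} by [].
  have EG : (energy mu (gaussian A C b) < +oo)%E by rewrite -(ae_eq_energy mg mG ae').
  by rewrite (V_ae mg mG Eg ae') V_gaussian// (ae_eq_cLnorm 2 mg mG ae').
move=> /(V_max mg Eg); apply => ae; apply: g0.
have mP : measurable [set p | P p -> g p = 0].
  have [[g1 g2] _] := gL; have mPar := @measurable_paraboloid R n.
  rewrite (_ : [set p | _] = ~` P `|` ((P `&` (fun x => complex.Re (g x)) @^-1` [set 0]) `&`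
     (P `&` (fun x => complex.Im (g x)) @^-1` [set 0]))).
    apply: measurableU; first exact: measurableC.
    by apply: measurableI; [apply: g1|apply: g2] => //; exact: measurable_set1.
  apply/seteqP; split => p /=.
    have [Pp h|Pp _] := pselect (P p); last by left.
    by right; rewrite h.
  by move=> [nP /nP//|[[_ e1] [_ e2]] _]; exact: complex_ext.
by apply/(mpres_ae (mpres_lift n) mP); apply: filterS ae => w /= h _.
Qed.

(** Equality holds for the standard Gaussian. *)
Lemma sharp_constant K' :
  (forall g F, memL (dsigma R n) P 2 g -> is_fourier_dsigma m%:R g F ->
    (cLnorm (lebesgueST R n) setT m%:R F <= K'%:E * normS g)%E) -> K1 <= K'.
Proof.
move=> HK; pose G := gaussian (-1) 0 [tuple of nseq n 0%R].
have mG : cmeas G := cmeas_gaussian _ _ _.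
have gL : memL (dsigma R n) P 2 (fun p => G p.2).
  have mGp := cmeas_paraboloid_snd mG; split=> //.
  by rewrite (cLnorm_dsigma (ltn0Sn 1) mGp); apply/(pint_fin _ _ (ltn0Sn 1)); rewrite pint2.
have [F FP] := exists_fourier_dsigma m_gt0 K_ge0 pint_extn V_le gL.
have [mg Eg fg E] := normS_fin gL.
have := HK _ _ gL FP; rewrite ((sharp_equality_V gL FP).2 (V_gaussian standard_fin)).
rewrite -(fineK fg) -!EFinM lee_fin ler_pM2r// fine_gt0//.
rewrite lt_neqAle cLnorm_ge0 -ge0_fin_numE ?cLnorm_ge0// fg !andbT.
apply/negP => /eqP /esym; rewrite E => N0.
have E0 : energy mu G = 0%E.
  by rewrite -pint2 (pintE _ _ (ltn0Sn 1)) N0 poweR0r.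
by have := standard_gt0; rewrite /standard -/G E0 ltxx.
Qed.

End sharp.

(** * Coordinates on tuples *)

Section tuples.
Context {R : realType}.
Notation line := (measurableTypeR R).
Notation plane := (measurableTypeR R * measurableTypeR R)%type.
Notation pl := (leb \X leb : {sigma_finite_measure set plane -> \bar R}).

Lemma mpres_consT n : mpres (leb \X lebesgueRn R n) (lebesgueRn R n.+1) (@consT R n).
Proof.
split; first exact: measurable_cons.
by move=> F mF F0; rewrite [RHS]ge0_integral_pushforward//; exact: measurable_cons.
Qed.

(** Lebesgue measure on the empty product is a unit mass. *)
Lemma mpres_nil : mpres leb (leb \X lebesgueRn R 0) (fun x : line => (x, [tuple])).
Proof.
have m : measurable_fun setT (fun x : line => (x, [tuple]) : line * Rn R 0).
  by apply: measurable_fun_pair => //; exact: measurable_cst.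
split=> // F mF F0; rewrite tonelli1//; apply: eq_integral => x _.
have mFx : measurable_fun setT (fun y => F (x, y)) := measurableT_comp mF (measurable_pair1 x).
transitivity (\d_([tuple] : Rn R 0) setT * F (x, [tuple]))%E; first by rewrite diracT mul1e.
by rewrite -(integral_dirac _ measurableT mFx).
Qed.

Definition tup1 (x : line) : Rn R 1 := consT (x, [tuple]).

Lemma mpres_tup1 : mpres leb (lebesgueRn R 1) tup1.
Proof. exact: (mpres_comp mpres_nil (mpres_consT 0)). Qed.

Definition tup2 (w : plane) : Rn R 2 := consT (w.1, tup1 w.2).

Lemma mpres_tup2 : mpres pl (lebesgueRn R 2) tup2.
Proof. exact: (mpres_comp (mpres_prod (mpres_id leb) mpres_tup1) (mpres_consT 1)). Qed.

Lemma dotp_tup1 x y : dotp (tup1 x) (tup1 y) = x * y.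
Proof. by rewrite /dotp big_ord_recl big_ord0 addr0 /= !(tnth_nth 0). Qed.

Lemma cdotp_tup1 (b : 1.-tuple R[i]) x : cdotp b (tup1 x) = tnth b ord0 * x%:C.
Proof. by rewrite /cdotp big_ord_recl big_ord0 addr0 /= [tnth (tup1 x) _](tnth_nth 0). Qed.

Lemma dotp_tup2 x y : dotp (tup2 x) (tup2 y) = x.1 * y.1 + x.2 * y.2.
Proof. by rewrite /dotp !big_ord_recl big_ord0 addr0 /= !(tnth_nth 0). Qed.

Lemma cdotp_tup2 (b : 2.-tuple R[i]) x :
  cdotp b (tup2 x) = tnth b ord0 * (x.1)%:C + tnth b (lift ord0 ord0) * (x.2)%:C.
Proof. by rewrite /cdotp !big_ord_recl big_ord0 addr0 /= ![tnth (tup2 x) _](tnth_nth 0). Qed.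

End tuples.

Section interface.
Context {R : realType} (n : nat) d (W : measurableType d).
Variables (om : {sigma_finite_measure set W -> \bar R}) (tup : W -> Rn R n).
Hypothesis mpres_tup : mpres om (lebesgueRn R n) tup.

Lemma energy_tup (f : Rn R n -> R[i]) : cmeas f ->
  energy (lebesgueRn R n) f = energy om (f \o tup).
Proof. by move=> mf; rewrite -(mpres_energy mpres_tup mf). Qed.

Lemma cmeas_tup (f : Rn R n -> R[i]) : cmeas f -> cmeas (f \o tup).
Proof. by move=> mf; exact: (cmeas_comp mf mpres_tup.1). Qed.

Lemma normL2_tup (f : Rn R n -> R[i]) : (energy (lebesgueRn R n) f < +oo)%E ->
  energy (lebesgueRn R n) f = (fine (cLnorm (lebesgueRn R n) setT 2 f) ^+ 2)%:E.
Proof.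
move=> Ef; rewrite -pint2; apply: (pint_fine (ltn0Sn 1)).
by apply/(pint_fin _ _ (ltn0Sn 1)); rewrite pint2.
Qed.

Lemma pint_extn_tup m (f : Rn R n -> R[i]) : cmeas f ->
  pint (lebesgueST R n) m (extn f) =
  pint (leb \X om) m (fun z => extn f (z.1, tup z.2)).
Proof.
move=> mf; have H := mpres_prod (mpres_id (@leb R)) mpres_tup.
apply/esym; apply: (H.2 _ (measurable_normcX m (cmeas_extn mf))) => z.
by rewrite lee_fin exprn_ge0// normc_ge0.
Qed.

Lemma extn_tup (f : Rn R n -> R[i]) t x : cmeas f ->
  extn f (t, tup x) =
  cint om (fun w => f (tup w) * chi (t * dotp (tup w) (tup w) + dotp (tup w) (tup x))).
Proof.
move=> mf; rewrite /extn /= -(mpres_cint mpres_tup)//.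
apply: cmeasM => //; apply: cmeas_chi_comp; apply: measurable_funD.
  by apply: measurable_funM; [exact: measurable_cst|exact: measurable_dotp].
by apply: measurable_dotp => //; exact: measurable_cst.
Qed.

End interface.

(** * The sharp constants *)

Section constants.
Context {R : realType}.

Let pi0 : 0 < pi :> R. Proof. exact: pi_gt0. Qed.

Lemma powR_natK (a : R) (x : R) (k : nat) : 0 <= a -> (a `^ x) ^+ k = a `^ (x * k%:R).
Proof. by move=> a0; rewrite -powR_mulrn ?powR_ge0// -powRrM. Qed.

(** The factors [2 pi / sqrt m] and [2 pi] come from Plancherel's theorem along
    the diagonal and in the squared radius, and the factor [pi] from the total
    mass of circles. *)
Definition C1 : R := 2 * pi / Num.sqrt 3 * (2 * pi) * pi.
Definition C2 : R := 2 * pi / Num.sqrt 2 * (2 * pi / Num.sqrt 2) * (2 * pi) * pi.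

Definition K1 : R := (2 * pi) `^ (- 2^-1) * 12 `^ (- 12^-1).
Definition K2 : R := (4 * pi) `^ (- 2^-1).

Lemma fourier_factor1 : fourier_factor 1 = (2 * pi)^-1 :> R.
Proof. by rewrite /fourier_factor divff ?pnatr_eq0// powR_inv1// mulr_ge0// ltW. Qed.

Lemma K1_pow : (K1 / fourier_factor 1) ^+ 6 = C1.
Proof.
have p2 : 0 <= 2 * pi :> R by rewrite mulr_ge0// ltW.
rewrite fourier_factor1 invrK exprMn /K1 exprMn !powR_natK//.
have -> : - 2^-1 * 6%:R = - (3%:R) :> R by field.
have -> : - 12^-1 * 6%:R = - 2^-1 :> R by field.
rewrite !powRN powR_mulrn// powR12_sqrt//.
have -> : Num.sqrt 12 = 2 * Num.sqrt 3 :> R.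
  have -> : 12 = 2 ^+ 2 * 3 :> R by ring.
  by rewrite sqrtrM ?sqr_ge0// sqrtr_sqr ger0_norm.
rewrite /C1; have := sqrt3_neq0 (R := R); move: (Num.sqrt 3) (@pi R) (pi_neq0 (R := R)) => r p p0 r0.
by field; rewrite r0 p0.
Qed.

Lemma K2_pow : (K2 / fourier_factor 2) ^+ 4 = C2.
Proof.
have p2 : 0 <= 2 * pi :> R by rewrite mulr_ge0// ltW.
have p4 : 0 <= 4 * pi :> R by rewrite mulr_ge0// ltW.
rewrite expr_div_n /K2 /fourier_factor !powR_natK//.
have -> : - 2^-1 * 4%:R = - (2%:R) :> R by field.
have -> : - (3%:R / 2) * 4%:R = - (6%:R) :> R by field.
rewrite !powRN !powR_mulrn// /C2.
have h := sqr_sqrt2 (R := R); have r0 := sqrt2_neq0 (R := R).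
have -> : 2 * pi / Num.sqrt 2 * (2 * pi / Num.sqrt 2) = 2 * pi ^+ 2 :> R.
  transitivity ((2 * pi) ^+ 2 / Num.sqrt 2 ^+ 2 : R); first by field.
  by rewrite h; field.
move: (@pi R) (pi_neq0 (R := R)) => p p0.
by field; rewrite p0.
Qed.

End constants.

(** * The parabola and the paraboloid in three-space *)

Section parabola.
Context {R : realType}.
Notation line := (measurableTypeR R).
Notation plane := (measurableTypeR R * measurableTypeR R)%type.
Notation pl := (leb \X leb : {sigma_finite_measure set plane -> \bar R}).
Local Notation mu := (lebesgueRn R 1).
Implicit Type f : Rn R 1 -> R[i].

Let K : R := K1 / fourier_factor 1.
Let c : R := 2 * pi / Num.sqrt 3.

Definition V1 f : \bar R := spacetime_energy leb c tens1 (f \o tup1).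

Lemma fourier_factor_gt0 n : 0 < fourier_factor n :> R.
Proof. by apply: powR_gt0; rewrite mulr_gt0// pi_gt0. Qed.

Let K_ge0 : 0 <= K.
Proof. by rewrite divr_ge0 ?mulr_ge0 ?powR_ge0// ltW// fourier_factor_gt0. Qed.

Let c_ge0 : 0 <= c.
Proof. by rewrite divr_ge0 ?sqrtr_ge0// mulr_ge0 ?pi_ge0. Qed.

Let E_fin f : cmeas f -> (energy mu f < +oo)%E ->
  cmeas (f \o tup1) /\ (energy leb (f \o tup1) < +oo)%E.
Proof.
move=> mf Ef; split; first exact: (cmeas_tup mpres_tup1).
by rewrite -(energy_tup mpres_tup1 mf).
Qed.

Let V1_bound f : cmeas f -> (energy mu f < +oo)%E ->
  ((c * (2 * pi) * pi)%:E * energy (leb \X pl) (tens1 (f \o tup1)))%E =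
  ((K * fine (cLnorm mu setT 2 f)) ^+ 6)%:E.
Proof.
move=> mf Ef; have [mt Et] := E_fin mf Ef.
rewrite energy_tens1// -(energy_tup mpres_tup1 mf) normL2_tup// -!EFinM; congr EFin.
by rewrite exprMn K1_pow /C1 /c; ring.
Qed.

Let pint_extn1 f : cintegrable mu f -> (energy mu f < +oo)%E ->
  pint (lebesgueST R 1) 6 (extn f) = V1 f.
Proof.
move=> intf Ef; have mf := cintegrable_cmeas intf; have [mt Et] := E_fin mf Ef.
have it : cintegrable leb (f \o tup1) := (mpres_cintegrable mpres_tup1 mf).2 intf.
rewrite (pint_extn_tup mpres_tup1)// -[RHS](pint_ext1 it Et); congr (pint _ _ _).
apply/funext => -[t x]; rewrite (extn_tup mpres_tup1)// /ext1.
congr (cint _ _); apply/funext => w /=.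
by rewrite !dotp_tup1 -expr2 (mulrC w x).
Qed.

Let V1_ge0 f : (0 <= V1 f)%E.
Proof. by rewrite mule_ge0 ?energy_ge0// lee_fin !mulr_ge0 ?pi_ge0. Qed.

Let V1_le f : cmeas f -> (energy mu f < +oo)%E ->
  (V1 f <= ((K * fine (cLnorm mu setT 2 f)) ^+ 6)%:E)%E.
Proof.
move=> mf Ef; have [mt Et] := E_fin mf Ef; rewrite -V1_bound//.
exact: (spacetime_energy_le c_ge0 cmeas_tens1 energy_tens1_fin mt Et).
Qed.

Let V1_cvg (h : nat -> Rn R 1 -> R[i]) f : (forall k, cmeas (h k)) -> cmeas f ->
  (forall k, energy mu (h k) < +oo)%E -> (energy mu f < +oo)%E ->
  (fun k => energy mu (fun x => h k x - f x)) @ \oo --> 0%E ->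
  (fun k => V1 (h k)) @ \oo --> V1 f.
Proof.
move=> mh mf Eh Ef hf; have [mt Et] := E_fin mf Ef.
have mht k := (E_fin (mh k) (Eh k)).1; have Eht k := (E_fin (mh k) (Eh k)).2.
have H := spacetime_energy_cvg (c := c) cmeas_tens1 energy_tens1_fin
  (h := fun k => h k \o tup1) mht mt Eht Et.
apply: H; apply: tens1_cvg => //; move: hf.
by under eq_fun => k do rewrite (energy_tup mpres_tup1 (cmeasB (mh k) mf)).
Qed.

Let tens1_gaussian (A C B : R[i]) f : (forall x, f (tup1 x) = cexp (A * (x ^+ 2)%:C + B * x%:C + C)) ->
  forall z, tens1 (f \o tup1) z =
  cexp (A * (z.1 ^+ 2 + rho z.2)%:C + B * (Num.sqrt 3 * z.1)%:C + 3%:R * C).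
Proof.
move=> fE z; rewrite /tens1 /triple /comp !fE -!cexpD; congr cexp.
by rewrite -coords1_sqr -coords1_sum !rmorphD; ring.
Qed.

Let gaussian_tup1 A C (b : 1.-tuple R[i]) x :
  gaussian A C b (tup1 x) = cexp (A * (x ^+ 2)%:C + tnth b ord0 * x%:C + C).
Proof. by rewrite /gaussian dotp_tup1 cdotp_tup1. Qed.

Let V1_gaussian A C (b : 1.-tuple R[i]) : (energy mu (gaussian A C b) < +oo)%E ->
  V1 (gaussian A C b) = ((K * fine (cLnorm mu setT 2 (gaussian A C b))) ^+ 6)%:E.
Proof.
move=> EG; have mG := cmeas_gaussian A C b; have [mt Et] := E_fin mG EG.
rewrite -V1_bound//.
pose Phi (y : line * line) := cexp (A * (y.1 ^+ 2 + y.2)%:C +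
  tnth b ord0 * (Num.sqrt 3 * y.1)%:C + 3%:R * C).
apply: (spacetime_energy_radial leb c (Phi := Phi) cmeas_tens1 _ mt).
  apply: cmeas_cexp; apply: cmeasD; last exact: cmeas_cst.
  apply: cmeasD; (apply: cmeasM; first exact: cmeas_cst); apply: cmeas_real.
    apply: measurable_funD; last exact: measurable_snd.
    by apply: measurable_funX; exact: measurable_fst.
  by apply: measurable_funM; [exact: measurable_cst|exact: measurable_fst].
exact: (tens1_gaussian (gaussian_tup1 A C b)).
Qed.

Let V1_max f : cmeas f -> (energy mu f < +oo)%E ->
  ~ {ae mu, forall w, f w = 0} -> V1 f = ((K * fine (cLnorm mu setT 2 f)) ^+ 6)%:E ->
  exists A C b, complex.Re A < 0 /\ {ae mu, forall w, f w = gaussian A C b w}.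
Proof.
move=> mf Ef f0; have [mt Et] := E_fin mf Ef; rewrite -V1_bound// => E.
have c0 : c != 0 by rewrite !mulf_neq0 ?invr_neq0 ?pi_neq0 ?sqrt3_neq0.
have ae := spacetime_energy_eq cmeas_tens1 energy_tens1_fin c0 mt Et E.
have f0' : ~ {ae leb, forall w, (f \o tup1) w = 0}.
  move=> h; apply: f0; apply/(mpres_ae_eq mpres_tup1 mf (cmeas_cst _ (0 : R[i]))).
  exact: h.
have mA := cmeas_angular (cmeas_tens1 mt).
have mK : cmeas (fun y : line * line => angular (tens1 (f \o tup1)) y * (pi^-1)%:C).
  by apply: cmeasM => //; exact: cmeas_cst.
have [A [B [C [A0 fE]]]] := gaussian_of_radial1 mt Et mK ae f0'.
exists A, C, [tuple B]; split => //.
apply/(mpres_ae_eq mpres_tup1 mf (cmeas_gaussian A C [tuple B])).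
by apply: filterS fE => x /= ->; rewrite gaussian_tup1.
Qed.

Let standard_tup1 : (gaussian (-1) 0 [tuple of nseq 1 0]) \o tup1 = @damp R.
Proof.
apply/funext => x /=; rewrite gaussian_tup1 dampE qexp.unlock; congr cexp.
by rewrite (tnth_nth 0) /= rmorphN rmorph1; ring.
Qed.

Let standard_fin1 : (energy mu (gaussian (-1)%R 0%R [tuple of nseq 1 0%R]) < +oo)%E.
Proof.
rewrite (energy_tup mpres_tup1 (cmeas_gaussian _ _ _)) standard_tup1.
exact: energy_damp.
Qed.

Let standard_gt01 : (0 < energy mu (gaussian (-1)%R 0%R [tuple of nseq 1 0%R]))%E.
Proof.
rewrite (energy_tup mpres_tup1 (cmeas_gaussian _ _ _)) standard_tup1 dampE.
exact: energy_qexp_gt0.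
Qed.

Let factorK : fourier_factor 1 * K = K1.
Proof. by rewrite mulrC divfK// gt_eqF// fourier_factor_gt0. Qed.

Lemma exists_fourier_parabola g : memL (dsigma R 1) (paraboloid R 1) 2 g ->
  exists F, is_fourier_dsigma 6 g F.
Proof. exact: (exists_fourier_dsigma (ltn0Sn 5) K_ge0 pint_extn1 V1_le). Qed.

Lemma parabola_inequality g F : memL (dsigma R 1) (paraboloid R 1) 2 g ->
  is_fourier_dsigma 6 g F ->
  (cLnorm (lebesgueST R 1) setT 6 F <=
   K1%:E * cLnorm (dsigma R 1) (paraboloid R 1) 2 g)%E.
Proof.
rewrite -factorK.
exact: (sharp_inequality (ltn0Sn 5) K_ge0 pint_extn1 V1_ge0 V1_le V1_cvg).
Qed.

Lemma parabola_sharp K' : (forall g F, memL (dsigma R 1) (paraboloid R 1) 2 g ->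
    is_fourier_dsigma 6 g F ->
    (cLnorm (lebesgueST R 1) setT 6 F <=
     K'%:E * cLnorm (dsigma R 1) (paraboloid R 1) 2 g)%E) -> K1 <= K'.
Proof.
rewrite -factorK.
exact: (sharp_constant (ltn0Sn 5) K_ge0 pint_extn1 V1_ge0 V1_le V1_cvg V1_gaussian
  standard_fin1 standard_gt01).
Qed.

Lemma parabola_equality g F : memL (dsigma R 1) (paraboloid R 1) 2 g ->
  is_fourier_dsigma 6 g F ->
  ~ {ae dsigma R 1, forall p, paraboloid R 1 p -> g p = 0} ->
  cLnorm (lebesgueST R 1) setT 6 F =
    (K1%:E * cLnorm (dsigma R 1) (paraboloid R 1) 2 g)%E <->
  exists A C b, complex.Re A < 0 /\
    {ae mu, forall w, g (dotp w w, w) = cexp (A * (dotp w w)%:C + cdotp b w + C)}.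
Proof.
rewrite -factorK.
exact: (sharp_equality_gaussian (ltn0Sn 5) K_ge0 pint_extn1 V1_ge0 V1_le V1_cvg V1_max V1_gaussian).
Qed.

End parabola.

Section paraboloid_space.
Context {R : realType}.
Notation line := (measurableTypeR R).
Notation plane := (measurableTypeR R * measurableTypeR R)%type.
Notation pl := (leb \X leb : {sigma_finite_measure set plane -> \bar R}).
Local Notation mu := (lebesgueRn R 2).
Implicit Type f : Rn R 2 -> R[i].

Let K : R := K2 / fourier_factor 2.
Let c : R := 2 * pi / Num.sqrt 2 * (2 * pi / Num.sqrt 2).

Definition V2 f : \bar R := spacetime_energy pl c tens2 (f \o tup2).

Let K_ge0 : 0 <= K.
Proof. by rewrite divr_ge0 ?powR_ge0// ltW// fourier_factor_gt0. Qed.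

Let c_ge0 : 0 <= c.
Proof.
have h : 0 <= 2 * pi / Num.sqrt 2 :> R by rewrite divr_ge0 ?sqrtr_ge0// mulr_ge0 ?pi_ge0.
exact: mulr_ge0.
Qed.

Let E_fin f : cmeas f -> (energy mu f < +oo)%E ->
  cmeas (f \o tup2) /\ (energy pl (f \o tup2) < +oo)%E.
Proof.
move=> mf Ef; split; first exact: (cmeas_tup mpres_tup2).
by rewrite -(energy_tup mpres_tup2 mf).
Qed.

Let V2_bound f : cmeas f -> (energy mu f < +oo)%E ->
  ((c * (2 * pi) * pi)%:E * energy (pl \X pl) (tens2 (f \o tup2)))%E =
  ((K * fine (cLnorm mu setT 2 f)) ^+ 4)%:E.
Proof.
move=> mf Ef; have [mt Et] := E_fin mf Ef.
rewrite energy_tens2// -(energy_tup mpres_tup2 mf) normL2_tup// -!EFinM; congr EFin.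
by rewrite exprMn K2_pow /C2 /c; ring.
Qed.

Let pint_extn2 f : cintegrable mu f -> (energy mu f < +oo)%E ->
  pint (lebesgueST R 2) 4 (extn f) = V2 f.
Proof.
move=> intf Ef; have mf := cintegrable_cmeas intf; have [mt Et] := E_fin mf Ef.
have it : cintegrable pl (f \o tup2) := (mpres_cintegrable mpres_tup2 mf).2 intf.
rewrite (pint_extn_tup mpres_tup2)// -[RHS](pint_ext2 it Et); congr (pint _ _ _).
apply/funext => -[t x]; rewrite (extn_tup mpres_tup2)// /ext2.
congr (cint _ _); apply/funext => w /=.
by rewrite !dotp_tup2 /rho !expr2 (mulrC w.1 x.1) (mulrC w.2 x.2).
Qed.

Let V2_ge0 f : (0 <= V2 f)%E.
Proof. by rewrite mule_ge0 ?energy_ge0// lee_fin !mulr_ge0 ?pi_ge0. Qed.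

Let V2_le f : cmeas f -> (energy mu f < +oo)%E ->
  (V2 f <= ((K * fine (cLnorm mu setT 2 f)) ^+ 4)%:E)%E.
Proof.
move=> mf Ef; have [mt Et] := E_fin mf Ef; rewrite -V2_bound//.
exact: (spacetime_energy_le c_ge0 cmeas_tens2 energy_tens2_fin mt Et).
Qed.

Let V2_cvg (h : nat -> Rn R 2 -> R[i]) f : (forall k, cmeas (h k)) -> cmeas f ->
  (forall k, energy mu (h k) < +oo)%E -> (energy mu f < +oo)%E ->
  (fun k => energy mu (fun x => h k x - f x)) @ \oo --> 0%E ->
  (fun k => V2 (h k)) @ \oo --> V2 f.
Proof.
move=> mh mf Eh Ef hf; have [mt Et] := E_fin mf Ef.
have mht k := (E_fin (mh k) (Eh k)).1; have Eht k := (E_fin (mh k) (Eh k)).2.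
have H := spacetime_energy_cvg (c := c) cmeas_tens2 energy_tens2_fin
  (h := fun k => h k \o tup2) mht mt Eht Et.
apply: H; apply: tens2_cvg => //; move: hf.
by under eq_fun => k do rewrite (energy_tup mpres_tup2 (cmeasB (mh k) mf)).
Qed.

Let tens2_gaussian (A C B1 B2 : R[i]) f :
  (forall x, f (tup2 x) = cexp (A * (rho x)%:C + (B1 * (x.1)%:C + B2 * (x.2)%:C) + C)) ->
  forall z, tens2 (f \o tup2) z =
  cexp (A * (rho z.1 + rho z.2)%:C +
    (B1 * (Num.sqrt 2 * z.1.1)%:C + B2 * (Num.sqrt 2 * z.1.2)%:C) + 2%:R * C).
Proof.
move=> fE z; rewrite /tens2 /double /comp !fE -!cexpD; congr cexp.
have [s1 s2] := coords2_sum z.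
by rewrite -coords2_sqr -s1 -s2 !rmorphD; ring.
Qed.

Let gaussian_tup2 A C (b : 2.-tuple R[i]) x :
  gaussian A C b (tup2 x) = cexp (A * (rho x)%:C +
    (tnth b ord0 * (x.1)%:C + tnth b (lift ord0 ord0) * (x.2)%:C) + C).
Proof. by rewrite /gaussian dotp_tup2 cdotp_tup2. Qed.

Let V2_gaussian A C (b : 2.-tuple R[i]) : (energy mu (gaussian A C b) < +oo)%E ->
  V2 (gaussian A C b) = ((K * fine (cLnorm mu setT 2 (gaussian A C b))) ^+ 4)%:E.
Proof.
move=> EG; have mG := cmeas_gaussian A C b; have [mt Et] := E_fin mG EG.
rewrite -V2_bound//.
pose Phi (y : plane * line) := cexp (A * (rho y.1 + y.2)%:C +
  (tnth b ord0 * (Num.sqrt 2 * y.1.1)%:C +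
   tnth b (lift ord0 ord0) * (Num.sqrt 2 * y.1.2)%:C) + 2%:R * C).
apply: (spacetime_energy_radial pl c (Phi := Phi) cmeas_tens2 _ mt).
  have m1 : measurable_fun setT (fun y : plane * line => y.1.1).
    exact: (measurableT_comp measurable_fst measurable_fst).
  have m2 : measurable_fun setT (fun y : plane * line => y.1.2).
    exact: (measurableT_comp measurable_snd measurable_fst).
  apply: cmeas_cexp; apply: cmeasD; last exact: cmeas_cst.
  apply: cmeasD; [|apply: cmeasD]; (apply: cmeasM; first exact: cmeas_cst); apply: cmeas_real.
  - apply: measurable_funD; last exact: measurable_snd.
    exact: (measurableT_comp measurable_rho measurable_fst).
  - by apply: measurable_funM => //; exact: measurable_cst.
  - by apply: measurable_funM => //; exact: measurable_cst.
exact: (tens2_gaussian (gaussian_tup2 A C b)).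
Qed.

Let V2_max f : cmeas f -> (energy mu f < +oo)%E ->
  ~ {ae mu, forall w, f w = 0} -> V2 f = ((K * fine (cLnorm mu setT 2 f)) ^+ 4)%:E ->
  exists A C b, complex.Re A < 0 /\ {ae mu, forall w, f w = gaussian A C b w}.
Proof.
move=> mf Ef f0; have [mt Et] := E_fin mf Ef; rewrite -V2_bound// => E.
have c0 : c != 0 by rewrite !mulf_neq0 ?invr_neq0 ?pi_neq0 ?sqrt2_neq0.
have ae := spacetime_energy_eq cmeas_tens2 energy_tens2_fin c0 mt Et E.
have f0' : ~ {ae pl, forall w, (f \o tup2) w = 0}.
  move=> h; apply: f0; apply/(mpres_ae_eq mpres_tup2 mf (cmeas_cst _ (0 : R[i]))).
  exact: h.
have mA := cmeas_angular (cmeas_tens2 mt).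
have mK : cmeas (fun y : plane * line => angular (tens2 (f \o tup2)) y * (pi^-1)%:C).
  by apply: cmeasM => //; exact: cmeas_cst.
have [A [B1 [B2 [C [A0 fE]]]]] := gaussian_of_radial2 mt Et mK ae f0'.
exists A, C, [tuple B1; B2]; split => //.
apply/(mpres_ae_eq mpres_tup2 mf (cmeas_gaussian A C [tuple B1; B2])).
by apply: filterS fE => x /= ->; rewrite gaussian_tup2.
Qed.

Let standard_tup2 : (gaussian (-1) 0 [tuple of nseq 2 0]) \o tup2 = @damp2 R.
Proof.
apply/funext => x /=; rewrite gaussian_tup2 /damp2 !dampE qexp.unlock -cexpD; congr cexp.
by rewrite !(tnth_nth 0) /= rmorphN rmorph1 /rho rmorphD; ring.
Qed.

Let standard_fin2 : (energy mu (gaussian (-1)%R 0%R [tuple of nseq 2 0%R]) < +oo)%E.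
Proof.
rewrite (energy_tup mpres_tup2 (cmeas_gaussian _ _ _)) standard_tup2.
exact: energy_damp2.
Qed.

Let standard_gt02 : (0 < energy mu (gaussian (-1)%R 0%R [tuple of nseq 2 0%R]))%E.
Proof.
rewrite (energy_tup mpres_tup2 (cmeas_gaussian _ _ _)) standard_tup2.
rewrite (energy_tensor leb leb (@cmeas_damp R) (@cmeas_damp R)).
by rewrite mule_gt0// dampE energy_qexp_gt0.
Qed.

Let factorK : fourier_factor 2 * K = K2.
Proof. by rewrite mulrC divfK// gt_eqF// fourier_factor_gt0. Qed.

Lemma exists_fourier_paraboloid g : memL (dsigma R 2) (paraboloid R 2) 2 g ->
  exists F, is_fourier_dsigma 4 g F.
Proof. exact: (exists_fourier_dsigma (ltn0Sn 3) K_ge0 pint_extn2 V2_le). Qed.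

Lemma paraboloid_inequality g F : memL (dsigma R 2) (paraboloid R 2) 2 g ->
  is_fourier_dsigma 4 g F ->
  (cLnorm (lebesgueST R 2) setT 4 F <=
   K2%:E * cLnorm (dsigma R 2) (paraboloid R 2) 2 g)%E.
Proof.
rewrite -factorK.
exact: (sharp_inequality (ltn0Sn 3) K_ge0 pint_extn2 V2_ge0 V2_le V2_cvg).
Qed.

Lemma paraboloid_sharp K' : (forall g F, memL (dsigma R 2) (paraboloid R 2) 2 g ->
    is_fourier_dsigma 4 g F ->
    (cLnorm (lebesgueST R 2) setT 4 F <=
     K'%:E * cLnorm (dsigma R 2) (paraboloid R 2) 2 g)%E) -> K2 <= K'.
Proof.
rewrite -factorK.
exact: (sharp_constant (ltn0Sn 3) K_ge0 pint_extn2 V2_ge0 V2_le V2_cvg V2_gaussian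
  standard_fin2 standard_gt02).
Qed.

Lemma paraboloid_equality g F : memL (dsigma R 2) (paraboloid R 2) 2 g ->
  is_fourier_dsigma 4 g F ->
  ~ {ae dsigma R 2, forall p, paraboloid R 2 p -> g p = 0} ->
  cLnorm (lebesgueST R 2) setT 4 F =
    (K2%:E * cLnorm (dsigma R 2) (paraboloid R 2) 2 g)%E <->
  exists A C b, complex.Re A < 0 /\
    {ae mu, forall w, g (dotp w w, w) = cexp (A * (dotp w w)%:C + cdotp b w + C)}.
Proof.
rewrite -factorK.
exact: (sharp_equality_gaussian (ltn0Sn 3) K_ge0 pint_extn2 V2_ge0 V2_le V2_cvg V2_max V2_gaussian).
Qed.

End paraboloid_space.

Theorem theorem4 (R : realType) :
  let L2S (n : nat) := memL (dsigma R n) (paraboloid R n) 2 in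
  let normS (n : nat) := cLnorm (dsigma R n) (paraboloid R n) 2 in
  let norm6 := cLnorm (lebesgueST R 1) setT 6 in
  let norm4 := cLnorm (lebesgueST R 2) setT 4 in
  let K1 : R := (2 * pi) `^ (- 2^-1) * 12 `^ (- 12^-1) in
  let K2 : R := (4 * pi) `^ (- 2^-1) in
  let nonzero (n : nat) (g : spacetime R n -> R[i]) :=
    ~ {ae dsigma R n, forall p, paraboloid R n p -> g p = 0} in
  let gaussian (n : nat) (g : spacetime R n -> R[i]) :=
    exists (A C : R[i]) (b : n.-tuple R[i]),
      complex.Re A < 0 /\
      {ae lebesgueRn R n, forall w,
        g (dotp w w, w) = cexp (A * (dotp w w)%:C + cdotp b w + C)} in
  [/\ forall g : spacetime R 1 -> R[i], L2S 1%N g ->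
        (exists F, is_fourier_dsigma 6 g F) /\
        (forall F, is_fourier_dsigma 6 g F ->
           (norm6 F <= K1%:E * normS 1%N g)%E),
      forall g : spacetime R 2 -> R[i], L2S 2%N g ->
        (exists F, is_fourier_dsigma 4 g F) /\
        (forall F, is_fourier_dsigma 4 g F ->
           (norm4 F <= K2%:E * normS 2%N g)%E),
      (forall K : R,
         (forall g F : spacetime R 1 -> R[i], L2S 1%N g ->
            is_fourier_dsigma 6 g F -> (norm6 F <= K%:E * normS 1%N g)%E) ->
         K1 <= K) /\
      (forall K : R,
         (forall g F : spacetime R 2 -> R[i], L2S 2%N g ->
            is_fourier_dsigma 4 g F -> (norm4 F <= K%:E * normS 2%N g)%E) ->
         K2 <= K),
      forall g F : spacetime R 1 -> R[i], L2S 1%N g ->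
        is_fourier_dsigma 6 g F -> nonzero 1%N g ->
        (norm6 F = (K1%:E * normS 1%N g)%E <-> gaussian 1%N g)
    & forall g F : spacetime R 2 -> R[i], L2S 2%N g ->
        is_fourier_dsigma 4 g F -> nonzero 2%N g ->
        (norm4 F = (K2%:E * normS 2%N g)%E <-> gaussian 2%N g)].
Proof.
move=> L2S normS norm6 norm4 k1 k2 nonzero gauss; split.
- move=> g gL; split; first exact: exists_fourier_parabola.
  by move=> F; exact: parabola_inequality.
- move=> g gL; split; first exact: exists_fourier_paraboloid.
  by move=> F; exact: paraboloid_inequality.
- by split => K; [exact: parabola_sharp|exact: paraboloid_sharp].
- move=> g F gL FP g0; rewrite (parabola_equality gL FP g0).
  by split => [[A [C [b H]]]|[A [C [b H]]]]; exists A, C, b.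
- move=> g F gL FP g0; rewrite (paraboloid_equality gL FP g0).
  by split => [[A [C [b H]]]|[A [C [b H]]]]; exists A, C, b.
Qed.
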